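(* Let $p\in[1,\infty]$, let $\iota:F\hookrightarrow E$ be an isometric embedding of Banach spaces, and let $C>0$. The following are equivalent: (1) $\overline\iota:\mathrm{FBL}^{(p)}[F]\to \mathrm{FBL}^{(p)}[E]$ is a lattice $C$-isomorphic embedding, i.e. $\|\overline\iota f\|\ge \|f\|/C$ for all $f\in\mathrm{FBL}^{(p)}[F]$; (2) for every $\sigma$-finite measure $\mu$, any bounded linear operator $T:F\to L_p(\mu)$ extends to a bounded linear operator $\widetilde T:E\to L_p(\mu)$ (that is, $\widetilde T\iota=T$) with $\|\widetilde T\|\le C\|T\|$; (3) for every $n\in\mathbb N$ and $\varepsilon>0$, any linear operator $T:F\to \ell_p^n$ extends to $\widetilde T:E\to\ell_p^n$ with $\|\widetilde T\|\le C(1+\varepsilon)\|T\|$.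
   Context: Banach spaces are real. $H[E]$ is the vector lattice (pointwise operations) of positively homogeneous functions $f:E^*\to\mathbb R$. For $1\le p<\infty$ put $\|f\|_{\mathrm{FBL}^{(p)}[E]}=\sup\{(\sum_{k=1}^n|f(x_k^* )|^p)^{1/p}: n\in\mathbb N,\ x_1^*,\dots,x_n^*\in E^*,\ \sup_{x\in B_E}\sum_{k=1}^n|x_k^*(x)|^p\le 1\}$, and for $p=\infty$ put $\|f\|_{\mathrm{FBL}^{(\infty)}[E]}=\sup_{x^*\in B_{E^*}}|f(x^* )|$. For $x\in E$ let $\delta_x(x^* )=x^*(x)$. $\mathrm{FBL}^{(p)}[E]$ is the closure, in the space of $f\in H[E]$ with finite norm, of the sublattice generated by $\{\delta_x:x\in E\}$; $\phi_E(x)=\delta_x$ is a linear isometric embedding $E\to\mathrm{FBL}^{(p)}[E]$. $\overline\iota:\mathrm{FBL}^{(p)}[F]\to\mathrm{FBL}^{(p)}[E]$ is the unique lattice homomorphism with $\overline\iota\phi_F=\phi_E\iota$; it has norm $\|\iota\|=1$. As is the paper's convention, $F$ and $E$ are nonzero. *)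

(* Defs.v *)
From HB Require Import structures.
From mathcomp Require Import all_boot all_order all_algebra.
From mathcomp Require Import all_classical all_reals all_analysis.

Set Implicit Arguments.
Unset Strict Implicit.
Unset Printing Implicit Defensive.
Import Order.TTheory GRing.Theory Num.Theory.
Import numFieldNormedType.Exports.
Local Open Scope classical_set_scope.
Local Open Scope ring_scope.

(* [opnorm N T] is the operator norm of [T : V -> W] when the target is normed
   by [N]; it is [+oo] when [T] is unbounded. The target norm is an argument
   because neither L_p nor l_p^n carries the norm used here in the library. *)
Definition opnorm (R : realType) (V : normedModType R) (W : Type)
    (N : W -> \bar R) (T : V -> W) : \bar R :=
  ereal_sup [set N (T x) | x in [set x : V | `|x| <= 1]].

Section Dual.
Context (R : realType) (E : normedModType R).

Definition is_dual : {pred E -> R^o} :=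
  mem [set f : E -> R^o | linear f /\ continuous f].

Lemma is_dual_submod_closed : submod_closed is_dual.
Proof.
split=> [|a f g]; rewrite !inE /=.
  split=> [b x y|x]; last exact: cst_continuous.
  by rewrite [LHS]/(0 : R^o) [X in X + _]scaler0 [RHS]addr0.
move=> [lf cf] [lg cg]; split=> [b x y|x].
  rewrite /= !fctE lf lg !scalerDr !scalerA [a * b]mulrC -!addrA.
  by congr (_ + _); rewrite addrCA.
by apply: cvgD; [apply: cvgZl_tmp; exact: cf | exact: cg].
Qed.

HB.instance Definition _ :=
  GRing.isSubmodClosed.Build _ _ is_dual is_dual_submod_closed.

Record dual := Dual { dual_fun :> E -> R^o ; _ : dual_fun \in is_dual }.

HB.instance Definition _ := [isSub for dual_fun].
HB.instance Definition _ := [Choice of dual by <:].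
HB.instance Definition _ := [SubChoice_isSubLmodule of dual by <:].

Lemma dual_linear (xs : dual) : linear (xs : E -> R^o).
Proof. by case: xs => f /=; rewrite inE => -[]. Qed.

Lemma dual_continuous (xs : dual) : continuous (xs : E -> R^o).
Proof. by case: xs => f /=; rewrite inE => -[]. Qed.

HB.instance Definition _ (xs : dual) :=
  GRing.isLinear.Build R E R^o _ (xs : E -> R^o) (dual_linear xs).

Definition dual_norm (xs : dual) : \bar R :=
  opnorm (fun y : R^o => `|y|%:E) (xs : E -> R^o).

End Dual.

Definition vector_sublattice (R : realType) (X : Type) (A : set (X -> R^o)) :=
  [/\ A 0,
      forall (a : R) f g, A f -> A g -> A (a *: f + g)
    & forall f g, A f -> A g -> A (f \max g) /\ A (f \min g)].

Section FBL.
Context (R : realType) (p : \bar R) (E : normedModType R).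
Implicit Type f : dual E -> R^o.

Definition pos_homogeneous f :=
  forall (a : R) (xs : dual E), 0 <= a -> f (a *: xs) = a * f xs.

Definition fbl_norm f : \bar R :=
  match p with
  | r%:E => ereal_sup [set z | exists (n : nat) (xs : 'I_n -> dual E),
      (ereal_sup [set (\sum_(k < n) `|xs k x| `^ r)%:E
                 | x in [set x : E | (`|x| <= 1)%R]] <= 1)%E
      /\ z = ((\sum_(k < n) `|f (xs k)| `^ r) `^ r^-1)%:E]
  | +oo%E => ereal_sup [set `|f xs|%:E
                       | xs in [set xs : dual E | (dual_norm xs <= 1)%E]]
  | -oo%E => 0%E (* junk: only 1 <= p is used *)
  end.

Definition delta (x : E) : dual E -> R^o := fun xs => xs x.

Definition delta_lattice : set (dual E -> R^o) :=
  smallest (@vector_sublattice R (dual E)) (range delta).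

Definition FBL : set (dual E -> R^o) :=
  [set f | [/\ pos_homogeneous f, (fbl_norm f < +oo)%E
    & forall e : R, 0 < e ->
        exists2 g, delta_lattice g & (fbl_norm (f - g)%R < e%:E)%E]].

End FBL.

(* Elements of A and B are functions, with the pointwise operations; the values
   of J outside A are irrelevant. *)
Definition lattice_hom (R : realType) (X Y : Type)
    (A : set (X -> R^o)) (B : set (Y -> R^o))
    (J : (X -> R^o) -> (Y -> R^o)) :=
  [/\ forall f, A f -> B (J f),
      forall (a : R) f g, A f -> A g -> J (a *: f + g) = a *: J f + J g
    & forall f g, A f -> A g ->
        J (f \max g) = J f \max J g /\ J (f \min g) = J f \min J g].

Definition is_fbl_extension (R : realType) (p : \bar R) (F E : normedModType R)
    (iota : F -> E) (J : (dual F -> R^o) -> (dual E -> R^o)) :=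
  lattice_hom (FBL p (E := F)) (FBL p (E := E)) J /\
  forall x : F, J (delta x) = delta (iota x).

(* The extension exists and is composition with the adjoint of iota. *)
Section Existence.
Context (R : realType) (F E : normedModType R) (iota : {linear F -> E}).
Hypothesis iota_isometry : forall x, `|iota x| = `|x|.

Lemma pullback_subproof (ys : dual E) :
  ((ys : E -> R^o) \o iota : F -> R^o) \in @is_dual R F.
Proof.
rewrite inE /=; split=> [a x y|x]; first by rewrite /= !linearP.
apply: continuous_comp; last exact: dual_continuous.
apply/(@cvgrPdist_lt _ _ _ (nbhs x)) => e e0; near=> y.
by rewrite -linearB iota_isometry; near: y; exact: cvgr_dist_lt.
Unshelve. all: by end_near. Qed.

Definition pullback (ys : dual E) : dual F := Dual (pullback_subproof ys).

Lemma pullback_norm p (f : dual F -> R^o) :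
  (fbl_norm p (f \o pullback) <= fbl_norm p f)%E.
Proof.
rewrite /fbl_norm; case: p => [r| |//]; apply: ereal_sup_le => z /=.
  move=> [n [xs [xs1 ->]]]; exists n, (pullback \o xs); split=> //.
  apply: le_trans xs1; apply: ereal_sup_le => _ /= [x x1 <-].
  by exists (iota x) => //=; rewrite iota_isometry.
move=> [xs xs1 <-]; exists (pullback xs) => //=.
apply: le_trans xs1; apply: ereal_sup_le => _ /= [x x1 <-].
by exists (iota x) => //=; rewrite iota_isometry.
Qed.

Lemma fbl_extension_exists p :
  is_fbl_extension p iota (fun f => f \o pullback).
Proof.
split=> //; split=> // f [hf nf cf]; split.
- move=> a xs a0 /=; rewrite -hf//; congr f.
  exact/val_inj.
- exact: le_lt_trans (pullback_norm p f) nf.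
- move=> e e0; have [g gg fg] := cf e e0; exists (g \o pullback).
    apply: (gg [set h : dual F -> R^o | delta_lattice (h \o pullback)]); split=> [|_ [x _ <-]]; last first.
      by move=> B [_ dB]; apply: dB; exists (iota x).
    split=> [|a h k Ah Ak|h k Ah Ak].
    + by move=> B [[B0 _ _] _]; exact: B0.
    + by move=> B PB; have [[_ B1 _] _] := PB; apply: B1; [apply: Ah|apply: Ak].
    + by split=> B PB; have [[_ _ B2] _] := PB;
        have [] := B2 _ _ (Ah B PB) (Ak B PB).
  exact: le_lt_trans (pullback_norm p (f - g)) fg.
Qed.

End Existence.

(* [T : V -> LspaceType mu p1] takes values in the quotient L_p(mu); the library
   gives this type no vector space structure, so linearity is expressed on
   representatives, which determines it since equality in LspaceType is
   almost-everywhere equality. *)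
Section LpOperators.
Context (R : realType) (d : measure_display) (X : measurableType d).
Variables (mu : {measure set X -> \bar R}) (p : \bar R) (p1 : (1 <= p)%E).

Definition Lp_norm (h : LspaceType mu p1) : \bar R :=
  Lnorm mu p (EFin \o (h : X -> R)).

Definition bounded_Lp_operator (V : normedModType R)
    (T : V -> LspaceType mu p1) :=
  (forall (a : R) (x y : V),
     {ae mu, forall t : X, T (a *: x + y) t = a * T x t + T y t :> R}) /\
  (opnorm Lp_norm T < +oo)%E.

End LpOperators.

(* The norm of l_p^n; it is not the library norm on 'rV[R]_n unless p = +oo. *)
Definition lp_norm (R : realType) (p : \bar R) (n : nat) (v : 'rV[R]_n) : \bar R :=
  match p with
  | r%:E => ((\sum_(i < n) `|v 0 i| `^ r) `^ r^-1)%:E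
  | +oo%E => (\big[Order.max/0]_(i < n) `|v 0 i|)%:E
  | -oo%E => 0%E (* junk: only 1 <= p is used *)
  end.

(* Main.v *)
Require Import Defs.
From HB Require Import structures.
From mathcomp Require Import all_boot all_order all_algebra.
From mathcomp Require Import all_classical all_reals all_analysis.
From mathcomp Require Import measurable_realfun ess_sup_inf ring lra.

Set Implicit Arguments.
Unset Strict Implicit.
Unset Printing Implicit Defensive.
Import Order.TTheory GRing.Theory Num.Theory.
Import numFieldNormedType.Exports.
Local Open Scope classical_set_scope.
Local Open Scope ring_scope.

(* (3) => (1): the norm of [f] in FBL^(p)[F] is tested on tuples
   [x_1^*, .., x_n^*] in the dual of [F] that are operators of norm at most one
   into l_p^n; extending them to [E] gives tuples on which the norm of
   [iotabar f] is tested. (2) => (3): l_p^n embeds in L_p of the counting measure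
   on nat by adding zeros, and restricts back without increasing the norm.

   (1) => (2) for the target l_p^n, with constant exactly [C]: by Hahn-Banach on
   the space of tuples [e_1, .., e_n] in [E]. The sublinear functional used is
   the infimum of the [A] for which there are positive weights [t_k] of sum at
   most one with [max_k t_k^-(1-1/p) |delta_(e_k)|] of norm at most [A]. On tuples
   coming from [F] this maximum lies in the lattice generated by the [delta_x],
   so that (1) and the duality of l_p^n bound the functional
   [z |-> sum_k (T z_k)_k].

   (1) => (2) for general [mu]: with an integrable weight [v > 0] and
   [m = v mu], an operator [T] of norm [K] into L_p(mu) becomes the family of set
   functions [lam_z (A) = int_A (T z) v^(1-1/p)], and the bound
   [|T z|_p <= K |z|] becomes a bound on [lam_z] along finite partitions.
   Extending along every finite partition, and passing to a generalized limit
   over the partitions, gives finitely additive set functions on [E] with the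
   bound multiplied by [C]. Their countably additive parts still extend [lam] and
   satisfy the same bound, and have densities by Radon-Nikodym. *)

(** * Duality for the norm of l_p^n *)

(** The obstacle in (1) => (2) is to keep the constant [C] for all p in [1, +oo] at once. Bounded
    sets of L_1 need not be weakly compact, so a limit of extensions along partitions may leave L_1.
    The set functions int_A g v^(1-1/p) are finite for every p because v is integrable, and they
    turn an L_p bound into finite inequalities, which survive generalized limits; what a limit can
    lose is countable additivity only.

    The duality estimates are written with the single exponent s = 1 - 1/p in [0, 1], so that p = 1
    and p = +oo are the ends s = 0 and s = 1 of Hoelder's inequality.

    A second obstacle is that iotabar is given as a lattice homomorphism with prescribed values on
    the delta_x, without a norm bound. It has to be identified with composition with the adjoint of
    iota: on the lattice generated by the delta_x this is algebra, on the closure it rests on the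
    completeness of FBL^(p)[F]. *)

Section Hoelder.
Context (R : realType).
Implicit Types (a b s : R).

Lemma powR_amgm a b s : 0 <= a -> 0 <= b -> 0 <= s <= 1 ->
  a `^ s * b `^ (1 - s) <= s * a + (1 - s) * b.
Proof.
move=> a0 b0 /andP[].
rewrite le_eqVlt => /predU1P[<- _|s0].
  by rewrite powRr0 subr0 powRr1// !mul1r mul0r add0r.
rewrite le_eqVlt => /predU1P[->|s1].
  by rewrite powRr1// subrr powRr0 mulr1 mul1r mul0r addr0.
have s10 : 0 < 1 - s by rewrite subr_gt0.
have := @conjugate_powR _ (a `^ s) (b `^ (1 - s)) s^-1 (1 - s)^-1
  (powR_ge0 _ _) (powR_ge0 _ _).
rewrite !invrK !invr_gt0 => /(_ s0 s10 (subrKC _ _)).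
by rewrite -!powRrM !mulfV ?gt_eqF// !powRr1// ![_ * s]mulrC ![_ * (1 - s)]mulrC.
Qed.

(** Divide by the two sums so that both become one, and add up the weighted arithmetic-geometric
    inequality. The ends s = 0 and s = 1 rely on the convention that any number to the power 0 is
    1. *)
Lemma sum_hoelder (I : finType) (a b : I -> R) s : 0 <= s <= 1 ->
  (forall i, 0 <= a i) -> (forall i, 0 <= b i) ->
  \sum_i a i `^ s * b i `^ (1 - s) <=
  (\sum_i a i) `^ s * (\sum_i b i) `^ (1 - s).
Proof.
move=> s01 a0 b0; set A := \sum_i a i; set B := \sum_i b i.
have A0 : 0 <= A by exact: sumr_ge0.
have B0 : 0 <= B by exact: sumr_ge0.
case: (eqVneq s 0) => [->|sn0].
  rewrite powRr0 subr0 powRr1// mul1r ler_sum// => i _.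
  by rewrite powRr0 powRr1// mul1r.
case: (eqVneq s 1) => [->|sn1].
  rewrite subrr powRr0 powRr1// mulr1 ler_sum// => i _.
  by rewrite powRr0 powRr1// mulr1.
case: (eqVneq A 0) => [/eqP A0'|An0].
  rewrite big1 ?mulr_ge0 ?powR_ge0// => i _.
  move: A0'; rewrite psumr_eq0// => /allP /(_ i) /[!mem_index_enum] /(_ isT).
  by move=> /eqP ->; rewrite powR0// mul0r.
have s1n0 : 1 - s != 0 by rewrite subr_eq0 eq_sym.
case: (eqVneq B 0) => [/eqP B0'|Bn0].
  rewrite big1 ?mulr_ge0 ?powR_ge0// => i _.
  move: B0'; rewrite psumr_eq0// => /allP /(_ i) /[!mem_index_enum] /(_ isT).
  by move=> /eqP ->; rewrite [X in _ * X]powR0// mulr0.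
have At : 0 < A by rewrite lt_neqAle eq_sym An0.
have Bt : 0 < B by rewrite lt_neqAle eq_sym Bn0.
have -> : \sum_i a i `^ s * b i `^ (1 - s) =
  A `^ s * B `^ (1 - s) *
  \sum_i (a i / A) `^ s * (b i / B) `^ (1 - s).
  rewrite mulr_sumr; apply: eq_bigr => i _.
  rewrite mulrACA -!powRM ?divr_ge0//.
  by rewrite ![_ * (_ / _)]mulrC !divfK.
rewrite ler_piMr ?mulr_ge0 ?powR_ge0//.
apply: (@le_trans _ _ (\sum_i (s * (a i / A) + (1 - s) * (b i / B)))).
  by apply: ler_sum => i _; rewrite powR_amgm ?divr_ge0.
rewrite big_split/= -!mulr_sumr -!mulr_suml -/A -/B !divff// !mulr1.
by rewrite addrC subrK.
Qed.

Lemma powRV a r : 0 <= a -> a^-1 `^ r = (a `^ r)^-1.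
Proof. by move=> a0; rewrite -(powR_inv1 a0) -powRrM mulN1r powRN. Qed.

Lemma powR_le1 a r : 0 <= r -> 0 <= a <= 1 -> a `^ r <= 1.
Proof.
move=> r0 /andP[a0 a1]; apply: (@le_trans _ _ (1 `^ r)); last by rewrite powR1.
by rewrite ge0_ler_powR ?nnegrE.
Qed.

Lemma powR_invr_le1 a r : 0 <= a -> 0 < r -> (a `^ r^-1 <= 1) = (a <= 1).
Proof.
move=> a0 r0; apply/idP/idP => a1; last first.
  by apply: powR_le1; rewrite ?a0// invr_ge0 ltW.
have -> : a = (a `^ r^-1) `^ r by rewrite -powRrM mulVf ?gt_eqF// powRr1.
by apply: powR_le1; rewrite ?powR_ge0// ltW.
Qed.

(** From (1 + x)^s <= 1 + x. It controls the growth of a sum of weights that are moved off zero. *)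
Lemma ler_powRD a b s : 0 < a -> 0 <= b -> 0 <= s <= 1 ->
  (a + b) `^ s <= a `^ s + a `^ s * (b / a).
Proof.
move=> a0 b0 /andP[s0 s1].
have -> : a + b = a * (1 + b / a).
  by rewrite mulrDr mulr1 mulrC divfK ?gt_eqF.
rewrite powRM ?(ltW a0) ?addr_ge0 ?divr_ge0 ?(ltW a0)//.
rewrite -[X in _ <= X + _]mulr1 -mulrDr ler_wpM2l ?powR_ge0//.
by rewrite ler1_powR// lerDl divr_ge0// ltW.
Qed.

End Hoelder.

(* The reciprocal [1 - 1/p] of the conjugate exponent. It is [1] for [p = +oo],
   because [fine +oo = 0] and [0^-1 = 0], and for [p = 1] the weights below are
   [0 `^ 0 = 1], so that every duality formula is uniform in [p]. *)
Definition cexp (R : realType) (p : \bar R) : R := 1 - (fine p)^-1.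

Section LpNorm.
Context (R : realType) (p : \bar R) (p1 : (1 <= p)%E).
Local Notation s := (cexp p).

Lemma cexp_itv : 0 <= s <= 1.
Proof.
rewrite /cexp; move: p1; case: p => [r|_|//] /=.
  rewrite lee_fin => r1; rewrite subr_ge0 invf_le1 ?(lt_le_trans _ r1)// r1/=.
  by rewrite gerBl invr_ge0 (le_trans _ r1).
by rewrite invr0 subr0 ler01 lexx.
Qed.

Lemma cexp_ge0 : 0 <= s. Proof. by have /andP[] := cexp_itv. Qed.

Lemma lp_norm_dual_le n (v : 'rV[R]_n) (t : 'I_n -> R) :
  (forall i, 0 <= t i) ->
  ((\sum_i t i `^ s * `|v 0 i|)%:E <= ((\sum_i t i) `^ s)%:E * lp_norm p v)%E.
Proof.
move=> t0; have := cexp_itv; rewrite /cexp; move: p1; case: p => [r|_|//] /=.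
  rewrite lee_fin => r1 s01; rewrite -EFinM lee_fin.
  have rn0 : r != 0 by rewrite gt_eqF// (lt_le_trans _ r1).
  apply: le_trans (le_trans (sum_hoelder (b := fun i => `|v 0 i| `^ r) s01 t0 _) _).
  - apply: ler_sum => i _; rewrite subKr -powRrM mulfV//.
    by rewrite powRr1.
  - by move=> i; exact: powR_ge0.
  - by rewrite subKr.
rewrite invr0 subr0 => _; rewrite -EFinM lee_fin powRr1 ?sumr_ge0//.
rewrite mulr_suml; apply: ler_sum => i _; rewrite powRr1// ler_wpM2l//.
exact: (le_bigmax _ (fun i => `|v 0 i|)).
Qed.

(** Converse of Hoelder: the extremal weights are |v_i|^p for finite p and the indicator of one
    coordinate for p = +oo. They may vanish, whereas the test weights are positive, as [tuple_gauge]
    will require; so they are shifted by a small [d]. *)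
Lemma lp_norm_dual_ge n (v : 'rV[R]_n) (K : R) : 0 <= K ->
  (forall t : 'I_n -> R, (forall i, 0 < t i) ->
     \sum_i t i `^ s * `|v 0 i| <= K * (\sum_i t i) `^ s) ->
  (lp_norm p v <= K%:E)%E.
Proof.
move=> K0; have := cexp_itv; rewrite /cexp; move: p1; case: p => [r|_|//] /=.
  rewrite lee_fin => r1; set q := 1 - r^-1 => s01 H.
  have r0 : 0 < r by rewrite (lt_le_trans _ r1).
  rewrite lee_fin.
  set S := \sum_i _.
  have S0 : 0 <= S by apply: sumr_ge0 => i _; exact: powR_ge0.
  have [SE|Sn0] := eqVneq S 0; first by rewrite SE powR0 ?invr_neq0 ?gt_eqF.
  have {Sn0} S0' : 0 < S by rewrite lt_neqAle eq_sym Sn0.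
  have SK : S <= K * S `^ q.
    apply/ler_addgt0Pr => e e0.
    (* Shifting all weights by [d] raises the right-hand side by at most [c * d], and
       [d = e / (c + 1)] makes this at most [e]. *)
    pose c := K * S `^ q * (n%:R / S).
    have c0 : 0 <= c by rewrite !mulr_ge0 ?powR_ge0// ?invr_ge0 ?ler0n.
    pose d := e / (c + 1).
    have d0 : 0 < d by rewrite divr_gt0// ltr_wpDl.
    have := H (fun i => `|v 0 i| `^ r + d) _.
    have pos i : 0 < `|v 0 i| `^ r + d by rewrite ltr_wpDl ?powR_ge0.
    move=> /(_ pos) H'.
    apply: (@le_trans _ _ (\sum_i (`|v 0 i| `^ r + d) `^ q * `|v 0 i|)).
      apply: ler_sum => i _.
      have [->|vn0] := eqVneq (v 0 i) 0.
        by rewrite normr0 powR0 ?gt_eqF// mulr0.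
      apply: (@le_trans _ _ ((`|v 0 i| `^ r) `^ q * `|v 0 i|)).
        rewrite -powRrM -[X in _ * X]powRr1// -powRD ?vn0 ?implybT//; last first.
          by rewrite normr_eq0 vn0 implybT.
        by rewrite /q mulrBr mulr1 mulfV ?gt_eqF// subrK.
      rewrite ler_wpM2r// ge0_ler_powR// ?nnegrE ?powR_ge0 ?(ltW (pos i))//.
        by case/andP: s01.
      by rewrite lerDl ltW.
    apply: (le_trans H').
    have -> : \sum_i (`|v 0 i| `^ r + d) = S + n%:R * d.
      by rewrite big_split/= sumr_const card_ord mulr_natl.
    apply: (@le_trans _ _ (K * (S `^ q + S `^ q * (n%:R * d / S)))).
      by rewrite ler_wpM2l// ler_powRD// mulr_ge0// ltW.
    rewrite mulrDr lerD2l.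
    have -> : K * (S `^ q * (n%:R * d / S)) = c * d by rewrite /c; ring.
    rewrite /d mulrCA -[leRHS]mulr1 ler_wpM2l ?(ltW e0)//.
    by rewrite ler_pdivrMr ?mul1r ?lerDl// ltr_wpDl.
  have : S `^ q * S `^ r^-1 <= S `^ q * K.
    rewrite -powRD; last by rewrite (gt_eqF S0') implybT.
    by rewrite /q subrK powRr1// mulrC.
  by rewrite ler_pM2l// powR_gt0.
rewrite invr0 subr0 => _ H; rewrite lee_fin.
apply/bigmax_leP; split => // i _.
apply/ler_addgt0Pr => e e0.
pose d := e / (K * n%:R + 1).
have c0 : 0 <= K * n%:R by rewrite mulr_ge0.
have d0 : 0 < d by rewrite divr_gt0// ltr_wpDl.
have := H (fun j => (j == i)%:R + d) _.
have pos j : 0 < (j == i)%:R + d by rewrite ltr_wpDl ?ler0n.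
move=> /(_ pos) H'.
apply: (@le_trans _ _ (\sum_j ((j == i)%:R + d) `^ 1 * `|v 0 j|)).
  rewrite (bigD1 i)//= eqxx powRr1 ?addr_ge0 ?(ltW d0)//.
  rewrite ler_wpDr ?sumr_ge0// => [j _|]; first by rewrite mulr_ge0 ?powR_ge0.
  by rewrite mulrDl mul1r lerDl mulr_ge0// ltW.
apply: (le_trans H').
have -> : \sum_j ((j == i)%:R + d) = 1 + n%:R * d.
  rewrite big_split/= sumr_const card_ord mulr_natl.
  rewrite (bigD1 i)//= eqxx big1 ?addr0// => j /negPf -> //.
rewrite powRr1; last by rewrite addr_ge0// (mulr_ge0 (ler0n _ _) (ltW d0)).
rewrite mulrDr mulr1 lerD2l mulrA /d mulrCA -[leRHS]mulr1 ler_wpM2l ?(ltW e0)//.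
by rewrite ler_pdivrMr ?mul1r ?lerDl// ltr_wpDl.
Qed.

Lemma lp_norm_fin n (v : 'rV[R]_n) : lp_norm p v \is a fin_num.
Proof. by move: p1; rewrite /lp_norm; case: p. Qed.

Lemma lp_norm_ge0 n (v : 'rV[R]_n) : (0 <= lp_norm p v)%E.
Proof.
rewrite /lp_norm; case: p => [r||//]; rewrite lee_fin ?powR_ge0//.
by elim/big_ind : _ => // x y x0 y0; rewrite le_max x0.
Qed.

Lemma lp_norm_dual_leK n (v : 'rV[R]_n) (t : 'I_n -> R) K :
  (forall i, 0 <= t i) -> (lp_norm p v <= K%:E)%E ->
  \sum_i t i `^ s * `|v 0 i| <= K * (\sum_i t i) `^ s.
Proof.
move=> t0 vK; rewrite -lee_fin; apply: le_trans (lp_norm_dual_le v t0) _.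
by rewrite [K * _]mulrC EFinM lee_wpmul2l// lee_fin powR_ge0.
Qed.

(** Minkowski's inequality from duality: the norm is the least constant in a family of bounds on
    weighted sums of absolute values, each of which is subadditive. *)
Lemma lp_normD n (v w : 'rV[R]_n) :
  (lp_norm p (v + w) <= lp_norm p v + lp_norm p w)%E.
Proof.
have [vf wf] := (lp_norm_fin v, lp_norm_fin w).
have [v0 w0] := (lp_norm_ge0 v, lp_norm_ge0 w).
rewrite -(fineK vf) -(fineK wf) -EFinD; apply: lp_norm_dual_ge => [|t t0].
  by rewrite addr_ge0 ?fine_ge0.
apply: (@le_trans _ _ (\sum_i (t i `^ s * `|v 0 i| + t i `^ s * `|w 0 i|))).
  apply: ler_sum => i _; rewrite -mulrDr ler_wpM2l ?powR_ge0//.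
  by rewrite !mxE ler_normD.
rewrite big_split/= mulrDl lerD ?lp_norm_dual_leK ?fineK// => i; exact: ltW.
Qed.

Lemma lp_normZ n a (v : 'rV[R]_n) : lp_norm p (a *: v) = (`|a|%:E * lp_norm p v)%E.
Proof.
have le b (w : 'rV[R]_n) : (lp_norm p (b *: w) <= `|b|%:E * lp_norm p w)%E.
  have wf := lp_norm_fin w; have w0 := lp_norm_ge0 w.
  rewrite -(fineK wf) -EFinM; apply: lp_norm_dual_ge => [|t t0].
    by rewrite mulr_ge0 ?fine_ge0.
  rewrite -mulrA; apply: (@le_trans _ _ (`|b| * (\sum_i t i `^ s * `|w 0 i|))).
    by rewrite mulr_sumr ler_sum// => i _; rewrite mxE normrM mulrCA.
  by rewrite ler_wpM2l// lp_norm_dual_leK ?fineK// => i; exact: ltW.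
apply/eqP; rewrite eq_le le/=.
have [->|a0] := eqVneq a 0; first by rewrite normr0 mul0e lp_norm_ge0.
rewrite -[v in leLHS](scalerK a0) -lee_pdivlMl ?normr_gt0// -normfV.
exact: le.
Qed.

Lemma lp_norm_le n (v w : 'rV[R]_n) : (forall i, `|v 0 i| <= `|w 0 i|) ->
  (lp_norm p v <= lp_norm p w)%E.
Proof.
move=> vw; have wf := lp_norm_fin w; have w0 := lp_norm_ge0 w.
rewrite -(fineK wf); apply: lp_norm_dual_ge => [|t t0]; first exact: fine_ge0.
apply: (@le_trans _ _ (\sum_i t i `^ s * `|w 0 i|)).
  by apply: ler_sum => i _; rewrite ler_wpM2l ?powR_ge0.
by rewrite lp_norm_dual_leK ?fineK// => i; exact: ltW.
Qed.

Lemma coord_lp_norm n (v : 'rV[R]_n) i : (`|v 0 i|%:E <= lp_norm p v)%E.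
Proof.
have vf := lp_norm_fin v.
have := @lp_norm_dual_leK _ v (fun j => (j == i)%:R) (fine (lp_norm p v)).
rewrite fineK// => /(_ (fun=> ler0n _ _) (lexx _)).
have -> : \sum_j ((j == i)%:R : R) = 1.
  by rewrite (bigD1 i)//= eqxx big1 ?addr0// => j /negPf ->.
rewrite powR1 mulr1 => H; rewrite -(fineK vf) lee_fin; apply: le_trans H.
rewrite (bigD1 i)//= eqxx powR1 mul1r lerDl.
by apply: sumr_ge0 => j _; rewrite mulr_ge0 ?powR_ge0.
Qed.

End LpNorm.

(** * The Hahn-Banach theorem *)

Section HahnBanach.
Context (R : realType).

(* [Q v A] stands for an upper bound [A] of a sublinear functional at [v]; the
   functional itself is [inf [set A | Q v A]]. *)
Definition sublinear_gauge (V : lmodType R) (Q : V -> R -> Prop) :=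
  [/\ forall v, exists A, Q v A,
      forall A, Q 0 A -> 0 <= A,
      forall v w A B, Q v A -> Q w B -> Q (v + w) (A + B)
    & forall a v A, 0 < a -> Q v A -> Q (a *: v) (a * A)].

Section Gauge.
Context (V : lmodType R) (Q : V -> R -> Prop) (gQ : sublinear_gauge Q).

Lemma gauge_has_inf v : has_inf [set A | Q v A].
Proof.
have [tQ pQ aQ _] := gQ; split; first exact: tQ.
have [B QB] := tQ (- v); exists (- B) => A /= QA.
by rewrite lerNl -subr_ge0 opprK addrC; apply: pQ; rewrite -(subrr v); exact: aQ.
Qed.

Lemma gauge_inf_le v A : Q v A -> inf [set A | Q v A] <= A.
Proof. by move=> QA; apply: ge_inf => //; have [] := gauge_has_inf v. Qed.

Lemma gauge_le_inf v B : (forall A, Q v A -> B <= A) -> B <= inf [set A | Q v A].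
Proof. by move=> H; apply: lb_le_inf => //; have [] := gauge_has_inf v. Qed.

Lemma gauge_inf_adherent v e : 0 < e ->
  exists2 A, Q v A & A < inf [set A | Q v A] + e.
Proof. by move=> e0; have := inf_adherent e0 (gauge_has_inf v). Qed.

Lemma gauge_infD v w :
  inf [set A | Q (v + w) A] <= inf [set A | Q v A] + inf [set A | Q w A].
Proof.
have [_ _ aQ _] := gQ.
apply/ler_addgt0Pr => e e0; have e2 : 0 < e / 2 by rewrite divr_gt0.
have [A QA Ae] := gauge_inf_adherent v e2.
have [B QB Be] := gauge_inf_adherent w e2.
apply: le_trans (gauge_inf_le (aQ _ _ _ _ QA QB)) _.
rewrite [e in leRHS]splitr addrACA.
by apply: lerD; exact: ltW.
Qed.

Lemma gauge_infZ a v : 0 < a ->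
  inf [set A | Q (a *: v) A] = a * inf [set A | Q v A].
Proof.
have [_ _ _ sQ] := gQ => a0; apply/eqP; rewrite eq_le; apply/andP; split.
  rewrite -ler_pdivrMl//; apply: gauge_le_inf => A QA.
  by rewrite ler_pdivrMl//; apply: gauge_inf_le; exact: sQ.
apply: gauge_le_inf => A QA; rewrite -ler_pdivlMl//; apply: gauge_inf_le.
rewrite -[v](scalerK (lt0r_neq0 a0)); apply: sQ => //.
by rewrite invr_gt0.
Qed.

End Gauge.

(* A gauge with maximal epigraph is linear: adding the point [-v0] with value
   [- inf (Q v0)] to the epigraph again yields a gauge. *)
Lemma hahn_banach_dominated (V : lmodType R) (Q : V -> R -> Prop) :
  sublinear_gauge Q ->
  exists f : {linear V -> R^o}, forall v A, Q v A -> f v <= A.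
Proof.
move=> gQ.
pose GU (X : set (V * R)) v A := Q v A \/ X (v, A).
pose P := [set X : set (V * R) | sublinear_gauge (GU X)].
have [X [PX maxX]] : exists X, P X /\ forall Y, X `<` Y -> ~ P Y.
  apply: Zorn_bigcup => F FP Ftot.
  (* Two points of the union of a chain already lie in one gauge [GU Z], with [Z] a member of the
     chain or empty; each axiom is checked there. *)
  have pick2 v w A B : GU (\bigcup_(X in F) X) v A ->
      GU (\bigcup_(X in F) X) w B -> exists Z, [/\ sublinear_gauge (GU Z),
      GU Z v A, GU Z w B & Z `<=` \bigcup_(X in F) X].
    have g0 : GU set0 = Q.
      by apply/funext => x; apply/funext => y; apply/propext; split=> [[]//|]; left.
    move=> [QA|[Y FY YA]] [QB|[Z FZ ZB]].
    - by exists set0; rewrite g0; split.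
    - exists Z; split; [exact: FP|by left|by right|exact: bigcup_sup].
    - exists Y; split; [exact: FP|by right|by left|exact: bigcup_sup].
    - case: (Ftot _ _ FY FZ) => S.
      + by exists Z; split; [exact: FP|right; exact: S|right|exact: bigcup_sup].
      + by exists Y; split; [exact: FP|right|right; exact: S|exact: bigcup_sup].
  have mono Z v A : Z `<=` \bigcup_(X in F) X -> GU Z v A ->
      GU (\bigcup_(X in F) X) v A.
    by move=> ZF [|/ZF]; [left|right].
  have [tQ _ _ _] := gQ; split.
  - by move=> v; have [A QA] := tQ v; exists A; left.
  - by move=> A GA; have [Z [[_ pZ _ _] ZA _ _]] := pick2 _ _ _ _ GA GA; exact: pZ.
  - move=> v w A B GA GB; have [Z [[_ _ aZ _] ZA ZB ZF]] := pick2 _ _ _ _ GA GB.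
    by apply: mono ZF _; exact: aZ.
  - move=> a v A a0 GA; have [Z [[_ _ _ sZ] ZA _ ZF]] := pick2 _ _ _ _ GA GA.
    by apply: mono ZF _; exact: sZ.
set G := GU X in PX *; rewrite /P/= -/G in PX.
have [tG pG aG sG] := PX.
pose f v := inf [set A | G v A].
have fD v0 x : f (x + v0) = f x + f v0.
  apply/eqP; rewrite eq_le gauge_infD//=.
  pose Y := [set z : V * R | exists t B,
    [/\ 0 <= t, G (z.1 + t *: v0) B & z.2 = B - t * f v0]].
  have GY v A : G v A -> Y (v, A).
    by move=> GA; exists 0, A; rewrite lexx scale0r addr0 mul0r subr0.
  have GUY v A : GU Y v A <-> Y (v, A).
    by split=> [[QA|//]|]; [apply: GY; left|right].
  have PY : P Y.
    split.
    - by move=> v; have [A GA] := tG v; exists A; right; exact: GY.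
    - move=> A /GUY [t [B [t0 /=]]]; rewrite add0r => GB ->; rewrite subr_ge0.
      move: t0; rewrite le_eqVlt => /predU1P[t0|t0].
        by rewrite -t0 mul0r; apply: pG; rewrite -(scale0r v0) t0.
      by rewrite /f -gauge_infZ//; exact: gauge_inf_le.
    - move=> v w A B /GUY[t [A' [/= t0 GA ->]]] /GUY[t' [B' [/= t'0 GB ->]]].
      apply/GUY; exists (t + t'), (A' + B'); split=> /=.
      + exact: addr_ge0.
      + by rewrite scalerDl addrACA; exact: aG.
      + by rewrite mulrDl opprD addrACA.
    - move=> a v A a0 /GUY[t [A' [/= t0 GA ->]]].
      apply/GUY; exists (a * t), (a * A'); split=> /=.
      + by rewrite mulr_ge0// ltW.
      + by rewrite -scalerA -scalerDr; exact: sG.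
      + by rewrite mulrBr mulrA.
  have YX : Y `<=` X.
    apply: contrapT => nYX; apply: (maxX Y) => //; split=> // -[v A] XA.
    by apply: GY; right.
  (* With [t = 1], a bound [B] at [x + v0] gives the bound [B - f v0] at [x]: this is
     superadditivity, the half of linearity that comes from maximality. *)
  apply: gauge_le_inf => // B GB.
  rewrite -lerBrDr; apply: gauge_inf_le => //; right; apply: YX.
  by exists 1, B; rewrite ler01 scale1r mul1r.
have fZ a v : 0 < a -> f (a *: v) = a * f v by move=> a0; exact: gauge_infZ.
have f0 : f 0 = 0 by apply: (addIr (f 0)); rewrite -fD !add0r.
have fN v : f (- v) = - f v.
  by apply: (addIr (f v)); rewrite -fD addNr addNr.
have {}fZ a u : f (a *: u) = a * f u.
  have [a0|a0|a0] := ltgtP a 0; last by rewrite a0 mul0r scale0r.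
    by rewrite -[a]opprK scaleNr fN fZ ?oppr_gt0// [RHS]mulNr.
  exact: fZ.
have lf : linear (f : V -> R^o) by move=> a u v; rewrite fD fZ.
pose lfM := GRing.isLinear.Build R V R^o *:%R f lf.
pose fL : {linear V -> R^o} := HB.pack f lfM.
exists fL => v A QA; rewrite /fL/=; apply: gauge_inf_le => //; by left.
Qed.

(** The gauge [G] is the infimal convolution of [Q] with [psi] carried along [iota]. A linear form
    below it is at most [psi] on the range of [iota], and replacing [z] by [-z] gives equality. *)
Lemma hahn_banach_extension (F V : lmodType R) (iota : {linear F -> V})
    (Q : V -> R -> Prop) (psi : {linear F -> R^o}) :
  sublinear_gauge Q -> (forall z A, Q (iota z) A -> psi z <= A) ->
  exists f : {linear V -> R^o},
    (forall z, f (iota z) = psi z) /\ forall v A, Q v A -> f v <= A.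
Proof.
move=> gQ psiQ; have [tQ pQ aQ sQ] := gQ.
pose G v A := exists z B, Q (v - iota z) B /\ A = B + psi z.
have gG : sublinear_gauge G.
  split.
  - by move=> v; have [A QA] := tQ v; exists (A + psi 0), 0, A; rewrite linear0 subr0.
  - move=> A [z [B [QB ->]]]; rewrite -lerBlDr sub0r.
    by have := psiQ (- z) B; rewrite !linearN; apply; rewrite -sub0r.
  - move=> v w A B [y [A' [QA ->]]] [z [B' [QB ->]]].
    exists (y + z), (A' + B'); split; last by rewrite linearD addrACA.
    by rewrite linearD opprD addrACA; exact: aQ.
  - move=> a v A a0 [z [B [QB ->]]]; exists (a *: z), (a * B); split.
      by rewrite linearZ/= -scalerBr; exact: sQ.
    by rewrite linearZ/= mulrDr.
have [f fG] := hahn_banach_dominated gG; exists f; split; last first.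
  by move=> v A QA; apply: fG; exists 0, A; rewrite linear0 subr0 linear0 addr0.
have le z : f (iota z) <= psi z.
  (* [Q 0 0] is not among the axioms; a bound [A] at 0 is scaled by [a] until it drops below [e]. *)
  have [A QA] := tQ 0; have A0 := pQ _ QA.
  apply/ler_addgt0Pr => e e0; pose a := e / (A + 1).
  have a0 : 0 < a by rewrite divr_gt0// ltr_wpDl.
  apply: (@le_trans _ _ (a * A + psi z)).
    apply: fG; exists z, (a * A); rewrite subrr; split=> //.
    by rewrite -(scaler0 _ a); exact: sQ.
  rewrite addrC lerD2l /a mulrAC ler_pdivrMr ?ltr_wpDl//.
  by rewrite ler_wpM2l ?lerDl// ltW.
move=> z; apply/eqP; rewrite eq_le le/= -lerN2 -!linearN; exact: le.
Qed.

End HahnBanach.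

(** * The free Banach lattice and the uniqueness of the extension *)

Section Operators.
Context (R : realType) (E : normedModType R).

Lemma linear_dual (f : {linear E -> R^o}) (K : R) :
  (forall x, `|f x| <= K * `|x|) -> exists ys : dual E, forall x, ys x = f x.
Proof.
move=> fK; have fd : (f : E -> R^o) \in @is_dual R E.
  rewrite inE; split; first exact: linearP.
  apply/linear_bounded_continuous/linear_boundedP.
  exists K; split=> [|r Kr x]; first exact: num_real.
  by apply: le_trans (fK x) _; rewrite ler_wpM2r// ltW.
by exists (Dual fd).
Qed.

(* Homogeneity is only assumed on representatives, because the target
   [LspaceType] carries no scaling. *)
Lemma opnorm_bound (W : Type) (N : W -> \bar R) (T : E -> W) (K : R) :
  (forall a x, 0 <= a -> N (T (a *: x)) = (a%:E * N (T x))%E) ->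
  (opnorm N T <= K%:E)%E -> forall x, (N (T x) <= (K * `|x|)%:E)%E.
Proof.
move=> NZ NK x.
have [->|x0] := eqVneq x 0.
  by rewrite normr0 mulr0 -(scale0r (0 : E)) NZ// mul0e.
have nx0 : 0 < `|x| by rewrite normr_gt0.
rewrite -[x in leLHS](scalerKV (lt0r_neq0 nx0)) NZ// mulrC EFinM.
rewrite lee_wpmul2l ?lee_fin//; apply: le_trans NK.
apply: ereal_sup_ubound; exists (`|x|^-1 *: x) => //=.
by rewrite normrZ normfV normr_id mulVf// gt_eqF.
Qed.

Lemma opnorm_le (W : Type) (N : W -> \bar R) (T : E -> W) (K : R) : 0 <= K ->
  (forall x, (N (T x) <= (K * `|x|)%:E)%E) -> (opnorm N T <= K%:E)%E.
Proof.
move=> K0 NK; apply: ge_ereal_sup => _ [x /= x1 <-].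
by apply: le_trans (NK x) _; rewrite lee_fin ler_piMr.
Qed.

End Operators.

(** * The FBL norm as a supremum over weakly p-summable tuples *)

Section FblNorm.
Context (R : realType) (p : \bar R) (p1 : (1 <= p)%E) (E : normedModType R).
Implicit Types (f g : dual E -> R^o).

Definition weakly_lp_le (K : R) n (xs : 'I_n -> dual E) :=
  forall x, (lp_norm p (\row_k (xs k x : R)) <= (K * `|x|)%:E)%E.

Lemma weakly_lp_dual (K : R) n (xs : 'I_n -> dual E) (t : 'I_n -> R) x :
  weakly_lp_le K xs -> (forall k, 0 <= t k) ->
  \sum_k t k `^ cexp p * `|xs k x| <= K * `|x| * (\sum_k t k) `^ cexp p.
Proof.
move=> xsK t0; apply: le_trans (lp_norm_dual_leK p1 t0 (xsK x)).
by apply: ler_sum => k _; rewrite mxE.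
Qed.

(** Together with [fbl_norm_le] this gives one description of the norm for all p, as the supremum of
    the l_p^n norms of [f] along tuples. For p = +oo the maximum over a tuple is reduced to a single
    functional. *)
Lemma fbl_norm_ge n (xs : 'I_n -> dual E) f : weakly_lp_le 1 xs ->
  (lp_norm p (\row_k (f (xs k) : R)) <= fbl_norm p f)%E.
Proof.
move=> xs1.
have {}xs1 x : `|x| <= 1 -> (lp_norm p (\row_k (xs k x : R)) <= 1)%E.
  by move=> x1; apply: le_trans (xs1 x) _; rewrite mul1r lee_fin.
have cxs k x : `|x| <= 1 -> (`|xs k x|%:E <= 1)%E.
  move=> x1; apply: le_trans (xs1 x x1).
  by have := coord_lp_norm p1 (\row_k (xs k x : R)) k; rewrite mxE.
move: p1 xs1; rewrite /fbl_norm /lp_norm; case: p => [r|_ _|//].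
  rewrite lee_fin => r1 xs1; have r0 : 0 < r by rewrite (lt_le_trans _ r1).
  apply: ereal_sup_ubound; exists n, xs; split; last first.
    by congr ((_ `^ _)%:E); apply: eq_bigr => k _; rewrite mxE.
  apply: ge_ereal_sup => _ [x /= x1 <-].
  have := xs1 x x1; rewrite !lee_fin powR_invr_le1//; last first.
    by apply: sumr_ge0 => k _; exact: powR_ge0.
  by apply: le_trans; rewrite ler_sum// => k _; rewrite mxE.
have sup_ge (ys : dual E) : (dual_norm ys <= 1)%E ->
    (`|f ys|%:E <= ereal_sup [set `|f xs|%:E | xs in [set xs | (dual_norm xs <= 1)%E]])%E.
  by move=> ys1; apply: ereal_sup_ubound; exists ys.
have : (\big[Order.max/0]_(i < n) `|(\row_k (f (xs k) : R)) 0 i|)%R = 0 \/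
    exists i, (\big[Order.max/0]_(i < n) `|(\row_k (f (xs k) : R)) 0 i|)%R = `|f (xs i)|.
  elim/big_ind : _ => [|x y xP yP|i _]; [by left| |by right; exists i; rewrite mxE].
  by rewrite /Order.max; case: ifP.
(* The maximum over an empty tuple is 0; it is compared with the value at the zero functional. *)
case=> [->|[i ->]].
  apply: (@le_trans _ _ `|f 0|%:E); rewrite ?lee_fin//; apply: sup_ge.
  by apply: ge_ereal_sup => _ [x /= _ <-]; rewrite normr0 lee_fin.
by apply: sup_ge; apply: ge_ereal_sup => _ [x /= x1 <-]; exact: cxs.
Qed.

Lemma fbl_norm_le f (A : \bar R) :
  (forall n (xs : 'I_n -> dual E), weakly_lp_le 1 xs ->
     (lp_norm p (\row_k (f (xs k) : R)) <= A)%E) -> (fbl_norm p f <= A)%E.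
Proof.
have homog n (xs : 'I_n -> dual E) :
    (forall x, `|x| <= 1 -> (lp_norm p (\row_k (xs k x : R)) <= 1)%E) ->
    weakly_lp_le 1 xs.
  move=> xs1; apply: opnorm_bound => [a x a0|].
    rewrite -[a in RHS]ger0_norm// -lp_normZ//; congr lp_norm.
    by apply/rowP => k; rewrite !mxE linearZ.
  by apply: ge_ereal_sup => _ [x /= x1 <-]; exact: xs1.
move: p1 homog; rewrite /weakly_lp_le /fbl_norm /lp_norm; case: p => [r|_|//].
  rewrite lee_fin => r1 homog fA; have r0 : 0 < r by rewrite (lt_le_trans _ r1).
  apply: ge_ereal_sup => _ [n [xs [xs1 ->]]].
  apply: le_trans (fA n xs _); last first.
    apply: homog => x x1; rewrite lee_fin.
    rewrite powR_invr_le1//; last by apply: sumr_ge0 => k _; exact: powR_ge0.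
    rewrite -lee_fin; apply: le_trans xs1; apply: ereal_sup_ubound; exists x => //.
    by congr (_%:E); apply: eq_bigr => k _; rewrite mxE.
  rewrite lee_fin le_eqVlt; apply/orP; left; apply/eqP.
  by congr (_ `^ _); apply: eq_bigr => k _; rewrite mxE.
move=> homog fA; apply: ge_ereal_sup => _ [ys /= ys1 <-].
apply: le_trans (fA 1 (fun=> ys) _); last first.
  apply: homog => x x1; rewrite big_ord_recl big_ord0 mxE; apply: le_trans ys1.
  apply: (@le_trans _ _ (`|ys x|%:E)); first by rewrite lee_fin ge_max lexx normr_ge0.
  by apply: ereal_sup_ubound; exists x.
by rewrite big_ord_recl big_ord0 mxE lee_fin le_max lexx.
Qed.

Lemma fbl_norm_ge0 f : (0 <= fbl_norm p f)%E.
Proof.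
pose xs (k : 'I_0) : dual E := 0.
have := @fbl_norm_ge 0 xs f; set v := \row_k _ => H.
apply: le_trans (lp_norm_ge0 p v) (H _) => x.
have -> : \row_k (xs k x : R) = 0 *: 0 by apply/rowP => -[].
by rewrite lp_normZ// normr0 mul0e mul1r lee_fin.
Qed.

Lemma fbl_norm_geZ n (xs : 'I_n -> dual E) f (K : R) : 0 < K ->
  pos_homogeneous f -> weakly_lp_le K xs ->
  (lp_norm p (\row_k (f (xs k) : R)) <= K%:E * fbl_norm p f)%E.
Proof.
move=> K0 hf xsK; have Kn0 := lt0r_neq0 K0.
have -> : \row_k (f (xs k) : R) = K *: \row_k (f (K^-1 *: xs k) : R).
  apply/rowP => k; rewrite !mxE hf ?invr_ge0 ?(ltW K0)//.
  by rewrite mulrA divff// mul1r.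
rewrite lp_normZ// gtr0_norm// lee_pmul2l ?lte_fin//.
apply: fbl_norm_ge => x.
have -> : \row_k ((K^-1 *: xs k) x : R) = K^-1 *: \row_k (xs k x : R).
  by apply/rowP => k; rewrite !mxE.
rewrite lp_normZ// ger0_norm ?invr_ge0 ?(ltW K0)// lee_pdivrMl// -EFinM mul1r.
exact: xsK.
Qed.

Lemma le_fbl_norm f g : (forall y, `|f y| <= `|g y|) ->
  (fbl_norm p f <= fbl_norm p g)%E.
Proof.
move=> fg; apply: fbl_norm_le => n xs xs1; apply: le_trans (fbl_norm_ge g xs1).
by apply: lp_norm_le => // i; rewrite !mxE; exact: fg.
Qed.

Lemma fbl_normD f g : (fbl_norm p (f + g)%R <= fbl_norm p f + fbl_norm p g)%E.
Proof.
apply: fbl_norm_le => n xs xs1.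
have -> : \row_k ((f + g) (xs k) : R) =
    \row_k (f (xs k) : R) + \row_k (g (xs k) : R) by apply/rowP => k; rewrite !mxE.
by apply: le_trans (lp_normD _ _ _) _ => //; apply: leeD; exact: fbl_norm_ge.
Qed.

Lemma fbl_normZ_le (a : R) f : (fbl_norm p (a *: f)%R <= `|a|%:E * fbl_norm p f)%E.
Proof.
apply: fbl_norm_le => n xs xs1.
have -> : \row_k ((a *: f) (xs k) : R) = a *: \row_k (f (xs k) : R).
  by apply/rowP => k; rewrite !mxE.
by rewrite lp_normZ// lee_wpmul2l ?lee_fin//; exact: fbl_norm_ge.
Qed.

(** A single functional is a tuple of length one. Convergence in the FBL norm therefore implies
    pointwise convergence. *)
Lemma coord_fbl_norm f (ys : dual E) (K : R) : 0 < K -> pos_homogeneous f ->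
  (forall x, `|ys x| <= K * `|x|) -> (`|f ys|%:E <= K%:E * fbl_norm p f)%E.
Proof.
move=> K0 hf ysK; have := @fbl_norm_geZ 1 (fun=> ys) f K K0 hf; set v := \row_k _.
move=> H; apply: le_trans (H _).
  by have := coord_lp_norm p1 v ord0; rewrite /v mxE.
move=> x; apply: (@lp_norm_dual_ge _ _ p1).
  by apply: le_trans (ysK x).
by move=> t t0; rewrite !big_ord1 mxE mulrC ler_wpM2r// powR_ge0.
Qed.

Lemma dual_bounded (ys : dual E) : exists2 K, 0 < K & forall x, `|ys x| <= K * `|x|.
Proof.
have := @dual_continuous _ _ ys.
move=> /linear_bounded_continuous /linear_boundedP [M [_ HM]]; exists (Num.max M 0 + 1).
  by rewrite ltr_wpDl// le_max lexx orbT.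
by apply: HM; rewrite ltr_pwDr// le_max lexx.
Qed.

End FblNorm.

Section Geometric.
Context (R : realType).

Lemma le0_geometric (x c : R) : (forall M, x <= c / 2 ^+ M) -> x <= 0.
Proof.
move=> xc; rewrite leNgt; apply/negP => x0.
have := archi_boundP (normr_ge0 (c / x)); set M := Num.bound _ => cM.
have M2 : M%:R < 2 ^+ M :> R by rewrite -natrX ltr_nat ltn_expl.
have := xc M; rewrite ler_pdivlMr ?exprn_gt0// -ler_pdivlMl// mulrC => H.
have := le_lt_trans (ler_norm _) cM; rewrite ltNge => /negP; apply.
exact: le_trans (ltW M2) H.
Qed.

(** The partial sum plus the bound of its tail is a decreasing sequence [u], so every [u n] bounds
    every partial sum. *)
Lemma geometric_sup (a : nat -> R) (c : R) :
  (forall n, 0 <= a n <= c / 2 ^+ n) -> forall M,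
  \sum_(i < M) a i <= sup (range (fun N => \sum_(i < N) a i)) <=
  \sum_(i < M) a i + 2 * c / 2 ^+ M.
Proof.
move=> ac; pose h N := \sum_(i < N) a i; pose u N := h N + 2 * c / 2 ^+ N.
have c0 : 0 <= c by have /andP[+ +] := ac 0%N; rewrite divr1; exact: le_trans.
have hS : {homo h : m n / (m <= n)%N >-> m <= n}.
  apply: homo_leq => [//|y x z|n]; first exact: le_trans.
  by rewrite /h big_ord_recr/= lerDl; have /andP[] := ac n.
have uS : {homo u : m n / (m <= n)%N >-> n <= m}.
  apply: (@homo_leq _ u (fun x y => y <= x)) => [//|y x z xy yz|n]; first exact: le_trans yz xy.
  rewrite /u /h big_ord_recr/= -addrA lerD2l exprS invfM !mulrA.
  rewrite (mulrC 2) mulfK ?pnatr_eq0// -[_ * 2]/(c * (1 + 1)) mulrDr mulr1 mulrDl.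
  by rewrite lerD2r; have /andP[] := ac n.
have hu m n : h m <= u n.
  have [mn|/ltnW nm] := leqP m n.
    apply: (le_trans (hS _ _ mn)); rewrite lerDl.
    by rewrite divr_ge0 ?mulr_ge0 ?exprn_ge0.
  apply: le_trans (uS _ _ nm); rewrite lerDl.
  by rewrite divr_ge0 ?mulr_ge0 ?exprn_ge0.
move=> M; apply/andP; split.
  apply: ub_le_sup; last by exists M.
  by exists (u 0%N) => _ [N _ <-]; exact: hu.
apply: ge_sup; first by exists (h 0%N), 0%N.
by move=> _ [N _ <-]; exact: hu.
Qed.

End Geometric.

Section DeltaLattice.
Context (R : realType) (E : normedModType R).

Lemma delta_lattice_sublattice : vector_sublattice (@delta_lattice R E).
Proof.
split=> [|a h k Ah Ak|h k Ah Ak].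
- by move=> B [[B0 _ _] _]; exact: B0.
- by move=> B PB; have [[_ B1 _] _] := PB; apply: B1; [apply: Ah|apply: Ak].
- by split=> B PB; have [[_ _ B2] _] := PB; have [] := B2 _ _ (Ah B PB) (Ak B PB).
Qed.

Lemma delta_lattice_delta x : delta_lattice (@delta R E x).
Proof. by move=> B [_]; apply; exists x. Qed.

Lemma delta_lattice_ind (A : set (dual E -> R^o)) : vector_sublattice A ->
  (forall x, A (delta x)) -> @delta_lattice R E `<=` A.
Proof. by move=> vA dA f; apply; split=> // _ [x _ <-]. Qed.

Lemma sublattice_norm (X : Type) (A : set (X -> R^o)) f : vector_sublattice A ->
  A f -> A (fun y => `|f y|).
Proof.
move=> [A0 AZ AM] Af; have [+ _] := AM _ _ Af (AZ (-1) _ _ Af A0).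
congr A; apply/funext => y /=; rewrite [X in Order.max _ X]addr0.
rewrite [X in Order.max _ X]mulN1r; have [f0|f0] := leP 0 (f y).
  by rewrite ger0_norm// max_l// (le_trans _ f0)// oppr_le0.
by rewrite ltr0_norm// max_r// (le_trans (ltW f0))// oppr_ge0 ltW.
Qed.

Context (p : \bar R) (p1 : (1 <= p)%E).

Lemma fbl_norm_delta x : (fbl_norm p (@delta R E x) <= `|x|%:E)%E.
Proof. by apply: fbl_norm_le => // n xs xs1; have := xs1 x; rewrite mul1r. Qed.

Lemma fbl_norm0 : fbl_norm p (0 : dual E -> R^o) = 0%E.
Proof.
apply/eqP; rewrite eq_le fbl_norm_ge0// andbT.
have -> : (0 : dual E -> R^o) = delta 0.
  by apply/funext => y; rewrite /delta linear0.
by apply: le_trans (fbl_norm_delta 0) _; rewrite normr0.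
Qed.

Lemma delta_lattice_FBL : @delta_lattice R E `<=` FBL p (E := E).
Proof.
move=> f fd; have : pos_homogeneous f /\ (fbl_norm p f < +oo)%E.
  move: f fd; apply: delta_lattice_ind => [|x]; last first.
    split=> [a xs a0|]; first by [].
    exact: le_lt_trans (fbl_norm_delta x) (ltry _).
  have normD (f g h : dual E -> R^o) : (fbl_norm p f < +oo)%E ->
      (fbl_norm p g < +oo)%E -> (forall y, `|h y| <= `|f y| + `|g y|) ->
      (fbl_norm p h < +oo)%E.
    move=> nf ng hfg.
    pose F y : R^o := `|f y|; pose G y : R^o := `|g y|.
    apply: (@le_lt_trans _ _ (fbl_norm p F + fbl_norm p G)%E).
      apply: le_trans (fbl_normD _ _ _) => //; apply: le_fbl_norm => // y.
      by apply: le_trans (hfg y) _; exact: ler_norm.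
    by rewrite lte_add_pinfty//; [move: nf|move: ng]; apply: le_lt_trans;
      apply: le_fbl_norm => // y; rewrite normr_id.
  split.
  - split=> [a xs _|]; first by rewrite [LHS]/(0 : R) mulr0.
    by rewrite fbl_norm0.
  - move=> a f g [hf nf] [hg ng]; split=> [b xs b0|].
      change (a * f (b *: xs) + g (b *: xs) = b * (a * f xs + g xs) :> R).
      by rewrite hf// hg// mulrDr mulrCA.
    apply: (normD (a *: f) g) => // [|y]; last exact: ler_normD.
    apply: le_lt_trans (fbl_normZ_le p1 _ _) _.
    by rewrite lte_mul_pinfty// lee_fin.
  - move=> f g [hf nf] [hg ng]; split; split=> [a xs a0|].
    + by rewrite /= hf// hg// maxr_pMr.
    + apply: (normD f g) => // y /=.
      by rewrite /Order.max; case: ifP => _; rewrite ?lerDl ?lerDr.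
    + by rewrite /= hf// hg// minr_pMr.
    + apply: (normD f g) => // y /=.
      by rewrite /Order.min; case: ifP => _; rewrite ?lerDl ?lerDr.
move=> [hf nf]; split=> // e e0; exists f => //.
by rewrite subrr fbl_norm0 lte_fin.
Qed.

Lemma FBL_lin a (f g : dual E -> R^o) : FBL p f -> FBL p g -> FBL p (a *: f + g).
Proof.
move=> [hf nf cf] [hg ng cg]; split.
- move=> b xs b0.
  change (a * f (b *: xs) + g (b *: xs) = b * (a * f xs + g xs) :> R).
  by rewrite hf// hg// mulrDr mulrCA.
- apply: le_lt_trans (fbl_normD _ _ _) _ => //; rewrite lte_add_pinfty//.
  apply: le_lt_trans (fbl_normZ_le p1 _ _) _.
  by rewrite lte_mul_pinfty// lee_fin.
- move=> e e0; have e2 : 0 < e / 2 by rewrite divr_gt0.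
  have c0 : 0 < `|a| + 1 by rewrite ltr_wpDl.
  have [f' df' ff'] := cf (e / 2 / (`|a| + 1)) (divr_gt0 e2 c0).
  have [g' dg' gg'] := cg _ e2; exists (a *: f' + g').
    by have [_ + _] := delta_lattice_sublattice; apply.
  have -> : a *: f + g - (a *: f' + g') = a *: (f - f') + (g - g').
    by rewrite opprD addrACA -scalerBr.
  apply: le_lt_trans (fbl_normD _ _ _) _ => //; rewrite (splitr e) EFinD.
  apply: lteD => //; apply: le_lt_trans (fbl_normZ_le p1 _ _) _.
  apply: (@le_lt_trans _ _ (`|a|%:E * (e / 2 / (`|a| + 1))%:E)%E).
    by rewrite lee_wpmul2l ?lee_fin// ltW.
  by rewrite -EFinM lte_fin mulrA ltr_pdivrMr// mulrC ltr_pM2l// ltrDl.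
Qed.

Lemma FBL_abs (f : dual E -> R^o) : FBL p f -> FBL p (fun y => `|f y|).
Proof.
move=> [hf nf cf]; split.
- by move=> a xs a0; rewrite hf// normrM ger0_norm.
- by apply: le_lt_trans nf; apply: le_fbl_norm => // y; rewrite normr_id.
- move=> e e0; have [g dg fg] := cf e e0; exists (fun y => `|g y|).
    exact: sublattice_norm delta_lattice_sublattice dg.
  by apply: le_lt_trans fg; apply: le_fbl_norm => // y; exact: ler_dist_dist.
Qed.

(* Completeness of [FBL p]: [h] is the sum of the series. *)
Lemma FBL_series (d : nat -> dual E -> R^o) :
  (forall n, FBL p (d n)) -> (forall n y, 0 <= d n y) ->
  (forall n, (fbl_norm p (d n) <= ((2 ^+ n)^-1)%:E)%E) ->
  exists h, FBL p h /\ forall n y, d n y <= h y.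
Proof.
move=> Fd d0 dn; pose H N : dual E -> R^o := fun y => \sum_(i < N) (d i y : R).
pose h : dual E -> R^o := fun y => sup (range (H ^~ y)).
have hd n : pos_homogeneous (d n) by have [] := Fd n.
have dbd K (y : dual E) n : 0 < K -> (forall x, `|y x| <= K * `|x|) ->
    0 <= d n y <= K / 2 ^+ n.
  move=> K0 yK; rewrite d0/= -lee_fin -[d n y]ger0_norm//.
  apply: le_trans (coord_fbl_norm p1 K0 (hd n) yK) _.
  by rewrite EFinM lee_wpmul2l// lee_fin ltW.
have hH K (y : dual E) M : 0 < K -> (forall x, `|y x| <= K * `|x|) ->
    H M y <= h y <= H M y + 2 * K / 2 ^+ M.
  move=> K0 yK.
  exact: (@geometric_sup _ (fun i => d i y) K (fun n => dbd K y n K0 yK) M).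
have FH N : FBL p (H N).
  elim: N => [|N IH].
    rewrite (_ : H 0%N = 0).
      by have [z0 _ _] := delta_lattice_sublattice; exact: (delta_lattice_FBL z0).
    by apply/funext => y; rewrite /H big_ord0.
  rewrite (_ : H N.+1 = 1 *: d N + H N); first exact: FBL_lin.
  by apply/funext => y; rewrite /H big_ord_recr/= scale1r addrC.
have HMN N k : (fbl_norm p (H (N + k)%N - H N)%R <=
    (2 / 2 ^+ N - 2 / 2 ^+ (N + k))%:E)%E.
  elim: k => [|k IH]; first by rewrite addn0 !subrr fbl_norm0.
  rewrite (_ : H (N + k.+1)%N - H N = d (N + k)%N + (H (N + k)%N - H N)); last first.
    apply/funext => y; rewrite addnS.
    change (\sum_(i < (N + k).+1) (d i y : R) - \sum_(i < N) (d i y : R) =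
      (d (N + k)%N y : R) + (\sum_(i < N + k) (d i y : R) - \sum_(i < N) (d i y : R))).
    by rewrite big_ord_recr/= [in RHS]addrA [X in _ = X - _]addrC.
  apply: le_trans (fbl_normD _ _ _) _ => //.
  apply: le_trans (leeD (dn _) IH) _; rewrite -EFinD lee_fin addnS exprS invfM mulrA.
  rewrite divff// mul1r addrC -addrA lerD2l.
  by rewrite -[2 / _]/((1 + 1) / _) mulrDl !mul1r opprD -addrA addNr addr0.
have hHN N : (fbl_norm p (h - H N)%R <= (2 / 2 ^+ N)%:E)%E.
  apply: fbl_norm_le => // n xs xs1.
  have xsb k x : `|xs k x| <= 1 * `|x|.
    rewrite -lee_fin; apply: le_trans (xs1 x).
    by have := coord_lp_norm p1 (\row_k (xs k x : R)) k; rewrite mxE.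
  apply: (@lp_norm_dual_ge _ _ p1) => [|t t0]; first by rewrite divr_ge0.
  (* [h] is only a pointwise sum: on the tuple [xs] it is replaced by [H (N + k)] at a cost of order
     2^-k, and [k] is arbitrary. *)
  rewrite -subr_le0; apply: (@le0_geometric _ _ (2 * \sum_k t k `^ cexp p)) => k.
  rewrite lerBlDr.
  have A : \sum_i t i `^ cexp p * `|(H (N + k)%N - H N) (xs i)| <=
      2 / 2 ^+ N * (\sum_i t i) `^ cexp p.
    have /= := @lp_norm_dual_leK _ _ p1 n
      (\row_i ((H (N + k)%N - H N) (xs i) : R)) t (2 / 2 ^+ N) (fun i => ltW (t0 i)).
    under eq_bigr do rewrite mxE; apply.
    apply: le_trans (fbl_norm_ge p1 _ xs1) _; apply: le_trans (HMN _ _) _.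
    by rewrite lee_fin gerBl divr_ge0.
  apply: le_trans (lerD (lexx _) A).
  rewrite (mulrC 2) -mulrA mulr_suml -big_split/=; apply: ler_sum => i _.
  rewrite -mulrDr ler_wpM2l ?powR_ge0// mxE.
  have /andP[Hh hH2] := hH 1 (xs i) (N + k)%N ltr01 (xsb i).
  apply: le_trans (ler_distD (H (N + k)%N (xs i)) _ _) _.
  rewrite lerD2r ger0_norm ?subr_ge0// lerBlDl; apply: le_trans hH2 _.
  rewrite mulr1 lerD2l ler_wpM2l// lef_pV2 ?posrE ?exprn_gt0//.
  by rewrite ler_weXn2l ?ler1n// leq_addl.
exists h; split; last first.
  move=> n y; have [K K0 yK] := dual_bounded y.
  have /andP[+ _] := hH K y n.+1 K0 yK; apply: le_trans.
  rewrite /H big_ord_recr/= lerDr; apply: sumr_ge0 => i _; exact: d0.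
split.
- move=> a y a0; have [K K0 yK] := dual_bounded y.
  have K'0 : 0 < a * K + K by rewrite ltr_wpDl// mulr_ge0// ltW.
  have ayK x : `|(a *: y) x| <= (a * K + K) * `|x|.
    rewrite [(a *: y) x]/(a * y x) normrM ger0_norm// mulrDl -mulrA.
    by rewrite -[leLHS]addr0 lerD ?ler_wpM2l// mulr_ge0// ltW.
  have HZ M : H M (a *: y) = a * H M y.
    by rewrite /H mulr_sumr; apply: eq_bigr => i _; rewrite hd.
  have bd M := (hH K y M K0 yK, hH _ _ M K'0 ayK).
  apply/eqP; rewrite eq_le -subr_le0 -[X in _ && X]subr_le0; apply/andP; split.
    apply: (@le0_geometric _ _ (2 * (a * K + K))) => M.
    have [/andP[l1 _] /andP[_ u2]] := bd M.
    rewrite lerBlDr addrC; apply: le_trans u2 _; rewrite lerD2r HZ.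
    exact: ler_wpM2l.
  apply: (@le0_geometric _ _ (a * (2 * K))) => M.
  have [/andP[_ u1] /andP[l2 _]] := bd M.
  rewrite lerBlDr addrC; apply: (@le_trans _ _ (a * (H M y + 2 * K / 2 ^+ M))).
    exact: ler_wpM2l.
  by rewrite mulrDr [a * (_ / _)]mulrA lerD2r -HZ.
- apply: (@le_lt_trans _ _ (2 / 2 ^+ 0)%:E); last exact: ltry.
  apply: le_trans (hHN 0%N); rewrite (_ : H 0%N = 0) ?subr0//.
  by apply/funext => y; rewrite /H big_ord0.
- move=> e e0; have e2 : 0 < e / 2 by rewrite divr_gt0.
  have [N N2] : exists N, 2 / 2 ^+ N < e / 2.
    apply: contrapT => nN; suff : e / 2 <= 0 by rewrite leNgt e2.
    apply: (@le0_geometric _ _ 2) => M; rewrite leNgt; apply/negP => M2.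
    by apply: nN; exists M.
  have [_ _ /(_ _ e2)[g dg Hg]] := FH N; exists g => //.
  rewrite -(subrK (H N) h) -addrA (splitr e) EFinD.
  apply: le_lt_trans (fbl_normD _ _ _) _ => //.
  by apply: lteD => //; exact: le_lt_trans (hHN N) _.
Qed.

End DeltaLattice.

(** * Identification of the lattice homomorphism with composition by the adjoint *)

Section Uniqueness.
Context (R : realType) (p : \bar R) (p1 : (1 <= p)%E) (F E : normedModType R).
Context (iota : {linear F -> E}) (iota_isometry : forall x, `|iota x| = `|x|).
Context (J : (dual F -> R^o) -> (dual E -> R^o)).
Hypothesis JP : is_fbl_extension p iota J.
Local Notation pb := (pullback iota_isometry).

(** [J] and composition with [pb] preserve the operations and agree on the generators. Membership in
    [delta_lattice] is carried along because [J] is only controlled on FBL. *)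
Lemma fbl_extension_delta_lattice g : delta_lattice g -> J g = g \o pb.
Proof.
have [[JB JL JM] Jd] := JP => dg.
have sl := @delta_lattice_sublattice R F; have [s0 sL sM] := sl.
have dF := @delta_lattice_FBL _ F _ p1.
suff [] : delta_lattice g /\ J g = g \o pb by [].
move: g dg; apply: delta_lattice_ind => [|x]; last first.
  by split; [exact: delta_lattice_delta|rewrite Jd].
split.
- split=> //; have := JL (-1) _ _ (dF _ s0) (dF _ s0).
  by rewrite scaler0 addr0 scaleN1r addNr.
- move=> a f g [df Jf] [dg Jg]; split; first exact: sL.
  by rewrite JL ?Jf ?Jg//; exact: dF.
- move=> f g [df Jf] [dg Jg]; have [sMx sMn] := sM _ _ df dg.
  have [Jx Jn] := JM _ _ (dF _ df) (dF _ dg).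
  by split; split; rewrite ?Jx ?Jn ?Jf ?Jg.
Qed.

(* Continuity of the lattice homomorphism is automatic: if [g n] are lattice
   elements with [f - g n] of norm at most [4^-n], then all [2^n |f - g n|] are
   dominated by a single element [h] of [FBL p], and positivity gives
   [|J f - J (g n)| <= 2^-n J h] pointwise. *)
Lemma fbl_extension_unique f : FBL p f -> J f = f \o pb.
Proof.
have [[JB JL JM] Jd] := JP => Ff; have [hf nf cf] := Ff.
have dF := @delta_lattice_FBL _ F _ p1.
have s0 : delta_lattice (0 : dual F -> R^o) by have [] := @delta_lattice_sublattice R F.
have F0 := dF _ s0.
have J0 : J 0 = 0.
  by have := JL (-1) _ _ F0 F0; rewrite scaler0 addr0 scaleN1r addNr.
have JZ a g : FBL p g -> J (a *: g) = a *: J g.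
  by move=> Fg; have := JL a _ _ Fg F0; rewrite J0 !addr0.
(* Positivity comes from the lattice operations: if [g <= k], the maximum of both is [k], and [J]
   preserves it. *)
have JS g k y : FBL p g -> FBL p k -> (forall z, g z <= k z) -> J g y <= J k y.
  move=> Fg Fk gk; have [+ _] := JM _ _ Fg Fk.
  have -> : g \max k = k by apply/funext => z /=; rewrite max_r.
  by move=> /(congr1 (@^~ y)) /= ->; rewrite le_max lexx.
have Jabs g y : FBL p g -> `|J g y| <= J (fun z => `|g z|) y.
  move=> Fg; have Fa := FBL_abs p1 Fg.
  rewrite ler_norml; apply/andP; split; last by apply: JS => // z; exact: ler_norm.
  have FN : FBL p (-1 *: g) by have := FBL_lin p1 (-1) Fg F0; rewrite addr0.
  have : J (-1 *: g) y <= J (fun z => `|g z|) y.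
    apply: JS => // z; rewrite scaleN1r -normrN.
    exact: ler_norm.
  by rewrite JZ// scaleN1r lerNl.
have e0 n : 0 < (4 ^+ n)^-1 :> R by rewrite invr_gt0 exprn_gt0.
pose G n := sval (cid2 (cf _ (e0 n))).
have dG n : delta_lattice (G n) by rewrite /G; case: cid2.
have fG n : (fbl_norm p (f - G n)%R < ((4 ^+ n)^-1)%:E)%E by rewrite /G; case: cid2.
have FfG n : FBL p (f - G n)%R.
  have -> : f - G n = -1 *: G n + f by rewrite scaleN1r addrC.
  by apply: FBL_lin => //; exact: dF.
pose d n : dual F -> R^o := 2 ^+ n *: (fun y => `|(f - G n) y|).
have Fd n : FBL p (d n).
  by have := FBL_lin p1 (2 ^+ n) (FBL_abs p1 (FfG n)) F0; rewrite addr0.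
have dE n y : d n y = 2 ^+ n * `|(f - G n) y| by [].
have dn n : (fbl_norm p (d n) <= ((2 ^+ n)^-1)%:E)%E.
  apply: le_trans (fbl_normZ_le p1 _ _) _; rewrite ger0_norm ?exprn_ge0//.
  apply: (@le_trans _ _ ((2 ^+ n)%:E * ((4 ^+ n)^-1)%:E)%E).
    rewrite lee_wpmul2l ?lee_fin ?exprn_ge0//; apply/ltW; apply: le_lt_trans (fG n).
    by apply: le_fbl_norm => // y; rewrite normr_id.
  rewrite -EFinM lee_fin (_ : 4 = 2 * 2); last by rewrite -natrM.
  by rewrite exprMn invfM mulrA divff ?mul1r// expf_neq0.
have [|h [Fh dh]] := FBL_series p1 Fd _ dn.
  by move=> n y; rewrite dE mulr_ge0 ?exprn_ge0.
apply/funext => y /=; have [K K0 yK] := dual_bounded (pb y).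
apply/eqP; rewrite -subr_eq0 -normr_le0.
(* [J h y] comes from the domination by [h], and [K] from evaluating [f - G n] at [pb y], where 4^-n
   <= 2^-n. *)
apply: (@le0_geometric _ _ (J h y + K)) => n.
have JG : J (G n) y = G n (pb y) by rewrite fbl_extension_delta_lattice.
have JfG : J (f - G n) y = J f y - J (G n) y.
  have -> : f - G n = -1 *: G n + f by rewrite scaleN1r addrC.
  rewrite JL//; last exact: dF.
  by rewrite scaleN1r addrC.
apply: le_trans (ler_distD (J (G n) y) _ _) _; rewrite mulrDl; apply: lerD.
  rewrite -JfG; apply: le_trans (Jabs _ _ (FfG n)) _.
  rewrite ler_pdivlMr ?exprn_gt0// mulrC.
  have <- : J (d n) y = 2 ^+ n * J (fun z => `|(f - G n) z|) y.
    by rewrite /d JZ//; exact: FBL_abs.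
  by apply: JS => // z; exact: dh.
rewrite JG distrC -lee_fin.
have hfG : pos_homogeneous (f - G n) by have [] := FfG n.
apply: le_trans (coord_fbl_norm p1 K0 hfG yK) _.
rewrite EFinM lee_wpmul2l ?lee_fin ?(ltW K0)//; apply: le_trans (ltW (fG n)) _.
rewrite lee_fin lef_pV2 ?posrE ?exprn_gt0//.
by rewrite lerXn2r ?nnegrE// ler_nat.
Qed.

End Uniqueness.

(** * Extending operators into l_p^n along a lattice embedding *)

Lemma linear_formZ (R : realType) (V : lmodType R) (f : {linear V -> R^o}) a v :
  f (a *: v) = a * f v.
Proof. by rewrite linearZ. Qed.

Section Extension.
Context (R : realType) (p : \bar R) (p1 : (1 <= p)%E) (F E : normedModType R).
Context (iota : {linear F -> E}) (iota_isometry : forall x, `|iota x| = `|x|).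
Local Notation pb := (pullback iota_isometry).
Local Notation s := (cexp p).

(** Concavity of the power s, as Hoelder with two terms: A a^s = (A a)^s A^(1-s). *)
Lemma powR_concave2 (A B a b : R) : 0 < A -> 0 < B -> 0 <= a -> 0 <= b ->
  A * a `^ s + B * b `^ s <= (A + B) * ((A * a + B * b) / (A + B)) `^ s.
Proof.
move=> A0 B0 a0 b0; have := @sum_hoelder R bool
  (fun i => if i then A * a else B * b) (fun i => if i then A else B) _ (cexp_itv p1).
move=> H; have {H} := H _ _.
have wE (X x : R) : 0 < X -> 0 <= x -> (X * x) `^ s * X `^ (1 - s) = X * x `^ s.
  move=> X0 x0; rewrite powRM// ?(ltW X0)// mulrAC -powRD; last first.
    by rewrite (gt_eqF X0) implybT.
  by rewrite subrKC powRr1 ?ltW.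
rewrite !big_bool/= !wE// => H.
have AB0 : 0 < A + B by rewrite addr_gt0.
have Aa0 : 0 <= A * a by rewrite mulr_ge0// ltW.
have Bb0 : 0 <= B * b by rewrite mulr_ge0// ltW.
rewrite -(wE _ _ AB0); last by rewrite divr_ge0 ?addr_ge0// ltW.
rewrite [(A + B) * _]mulrC divfK ?gt_eqF//; apply: H => -[]//; exact: ltW.
Qed.

(** The last clause bounds by [A] the FBL norm of max_k t_k^-s |delta_(e_k)|, in dual form: [k j]
    selects a term of the maximum at [ys j], and the dual weight is [u j * t (k j)], so that the
    power of [t (k j)] cancels. *)
Definition tuple_gauge n (e : 'I_n -> E) (A : R) := 0 < A /\
  exists t : 'I_n -> R, [/\ forall k, 0 < t k, \sum_k t k <= 1 &
    forall m (ys : 'I_m -> dual E), weakly_lp_le p 1 ys ->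
    forall (k : 'I_m -> 'I_n) (u : 'I_m -> R), (forall j, 0 <= u j) ->
    \sum_j u j `^ s * `|ys j (e (k j))| <= A * (\sum_j u j * t (k j)) `^ s].

(* [tuple_gauge e A] says that [e k = t k `^ s * g] for some weights of sum at
   most one and, formally, some [g] of [FBL]-norm at most [A]; subadditivity is
   thus the p-convexity of [FBL^(p)], here Hoelder's inequality. *)
Lemma tuple_gauge_sublinear n : sublinear_gauge (@tuple_gauge n).
Proof.
split.
(* Uniform weights, with n + 1 instead of n to cover n = 0; the final 1 keeps the bound positive
   when [e] is zero. *)
- move=> e; exists (n.+1%:R `^ s * (\sum_k `|e k|) + 1); split.
    by rewrite ltr_wpDl// mulr_ge0 ?powR_ge0 ?sumr_ge0.
  have n0 : 0 < n.+1%:R^-1 :> R by rewrite invr_gt0 ltr0n.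
  exists (fun=> n.+1%:R^-1); split=> [//||m ys ys1 k u u0].
    rewrite sumr_const card_ord -[_ *+ _]mulr_natr mulrC ler_pdivrMr ?ltr0n//.
    by rewrite mul1r ler_nat.
  have U0 : 0 <= \sum_j u j by exact: sumr_ge0.
  apply: (@le_trans _ _ (\sum_i (`|e i| * (\sum_j u j) `^ s))).
    apply: (@le_trans _ _ (\sum_j \sum_i (u j `^ s * `|ys j (e i)|))).
      apply: ler_sum => j _; rewrite (bigD1 (k j))//= lerDl sumr_ge0// => i _.
      by rewrite mulr_ge0 ?powR_ge0.
    rewrite exchange_big/=; apply: ler_sum => i _.
    by have := weakly_lp_dual p1 (e i) ys1 u0; rewrite mul1r.
  rewrite -!mulr_suml; set S := \sum_k _; set U := \sum_j _.
  rewrite mulrDl ler_wpDr ?mul1r ?powR_ge0//.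
  rewrite [_ * S]mulrC -mulrA ler_wpM2l ?sumr_ge0// -powRM ?mulr_ge0 ?(ltW n0)//.
  by rewrite mulrCA divff ?mulr1// pnatr_eq0.
- by move=> A [/ltW].
- move=> v w A B [A0 [t [t0 t1 tA]]] [B0 [t' [t'0 t'1 tB]]].
  have AB0 : 0 < A + B by rewrite addr_gt0.
  (* Averaging [t] and [t'] in the proportion of the two bounds is what [powR_concave2] fits. *)
  split=> //; exists (fun k => (A * t k + B * t' k) / (A + B)); split.
  + by move=> k; rewrite divr_gt0// addr_gt0 ?mulr_gt0.
  + rewrite -mulr_suml ler_pdivrMr// mul1r big_split/= -!mulr_sumr.
    by apply: lerD; rewrite ler_piMr// ltW.
  + move=> m ys ys1 k u u0.
    apply: (@le_trans _ _ (\sum_j (u j `^ s * `|ys j (v (k j))| +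
                                   u j `^ s * `|ys j (w (k j))|))).
      apply: ler_sum => j _; rewrite -mulrDr ler_wpM2l ?powR_ge0//.
      by rewrite [(v + w) _]/(v (k j) + w (k j)) linearD ler_normD.
    rewrite big_split/=; apply: le_trans (lerD (tA _ _ ys1 k u u0) (tB _ _ ys1 k u u0)) _.
    apply: le_trans (powR_concave2 A0 B0 _ _) _.
      by apply: sumr_ge0 => j _; rewrite mulr_ge0// ltW.
      by apply: sumr_ge0 => j _; rewrite mulr_ge0// ltW.
    rewrite !mulr_sumr -big_split/= mulr_suml le_eqVlt; apply/orP; left; apply/eqP.
    congr (_ * _ `^ _); apply: eq_bigr => j _.
    by rewrite !mulrA mulrDr !mulrA ![u j * _]mulrC.
- move=> a v A a0 [A0 [t [t0 t1 tA]]]; split; first exact: mulr_gt0.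
  exists t; split=> // m ys ys1 k u u0; rewrite -mulrA.
  apply: (@le_trans _ _ (a * (\sum_j u j `^ s * `|ys j (v (k j))|))).
    rewrite mulr_sumr; apply: ler_sum => j _.
    rewrite [(a *: v) _]/(a *: v (k j)) linear_formZ.
    by rewrite normrM (gtr0_norm a0) mulrCA.
  by rewrite ler_wpM2l ?(ltW a0)//; exact: tA.
Qed.

Lemma coord_linear n (T : {linear F -> 'rV[R]_n}) (K : R) :
  (forall z, (lp_norm p (T z) <= (K * `|z|)%:E)%E) ->
  exists xs : 'I_n -> dual F, (forall k z, xs k z = T z 0 k) /\ weakly_lp_le p K xs.
Proof.
move=> TK; have H k : exists xs : dual F, forall z, xs z = T z 0 k.
  pose f z : R^o := T z 0 k.
  have lf : linear f by move=> a u v; rewrite /f linearP !mxE.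
  pose fL : {linear F -> R^o} := HB.pack f (GRing.isLinear.Build R F R^o *:%R f lf).
  apply: (@linear_dual _ _ fL K) => z; rewrite -lee_fin; apply: le_trans (TK z).
  exact: coord_lp_norm.
exists (fun k => sval (cid (H k))); split=> [k z|z].
  by case: cid.
apply: le_trans (TK z); apply: lp_norm_le => // k; rewrite mxE.
by case: cid => /= xs ->.
Qed.

Lemma bigmax_attained m (a : 'I_m.+1 -> R) :
  exists k, \big[Order.max/0]_i `|a i| <= `|a k|.
Proof.
have : \big[Order.max/0]_i `|a i| = 0 \/ exists k, \big[Order.max/0]_i `|a i| = `|a k|.
  elim/big_ind : _ => [|x y xP yP|i _]; [by left| |by right; exists i].
  by rewrite /Order.max; case: ifP.
by case=> [->|[k ->]]; [exists ord0|exists k].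
Qed.

Context (C : R) (C0 : 0 < C).
Hypothesis embC : forall f, @delta_lattice R F f ->
  ((C^-1)%:E * fbl_norm p f <= fbl_norm p (f \o pb))%E.

(** Let [f] be the maximum of the t_k^-s |delta_(z_k)| and x_k the coordinates of [T]. Then x_k(z_k)
    <= t_k^s f(x_k), and the sum over k is at most (sum t)^s <= 1 times the norm of (f(x_k))_k,
    hence at most K times the norm of [f]. The gauge bounds [f \o pb] by [A], and (1) bounds [f] by
    [C * A]. *)
Lemma tuple_gauge_iota n (T : {linear F -> 'rV[R]_n}) (K : R) : 0 < K ->
  (forall z, (lp_norm p (T z) <= (K * `|z|)%:E)%E) ->
  forall (z : 'I_n -> F) A, tuple_gauge (iota \o z) A ->
  \sum_k T (z k) 0 k <= C * K * A.
Proof.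
move=> K0 TK z A [A0 [t [t0 t1 tA]]].
case: n => [|n] in T TK z t t0 t1 tA *.
  by rewrite big_ord0 !mulr_ge0// ltW.
have [xs [xsT xsK]] := coord_linear TK.
pose f (y : dual F) : R^o := \big[Order.max/0]_k `|(t k `^ s)^-1 * y (z k)|.
have fd : delta_lattice f.
  have sl := @delta_lattice_sublattice R F; have [s0 sL sM] := sl.
  have term k : delta_lattice (fun y : dual F => `|(t k `^ s)^-1 * y (z k)| : R^o).
    apply: (sublattice_norm sl).
    have := sL (t k `^ s)^-1 _ _ (@delta_lattice_delta R F (z k)) s0.
    by rewrite addr0.
  rewrite /f; elim: (index_enum _) => [|k r IH].
    suff -> : (fun y : dual F => \big[Order.max/0]_(k <- [::]) `|(t k `^ s)^-1 * y (z k)|) = 0 by [].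
    by apply/funext => y; rewrite big_nil.
  have [+ _] := sM _ _ (term k) IH.
  congr delta_lattice; by apply/funext => y; rewrite big_cons.
have fA : (fbl_norm p (f \o pb) <= A%:E)%E.
  apply: fbl_norm_le => // m ys ys1; apply: (lp_norm_dual_ge p1) => [|u u0].
    exact: ltW.
  have [k kP] := choice (fun j => bigmax_attained (fun i => (t i `^ s)^-1 * ys j (iota (z i)))).
  (* At [ys j] the maximum is attained at [k j]; its factor t^-s moves into the weight, and the
     gauge gives back the sum of the [u j]. *)
  apply: (@le_trans _ _ (\sum_j (u j / t (k j)) `^ s * `|ys j (iota (z (k j)))|)).
    apply: ler_sum => j _; rewrite mxE ger0_norm; last first.
      by rewrite /f /=; elim/big_ind : _ => // x y x0 y0; rewrite le_max x0.
    rewrite powRM ?invr_ge0 ?(ltW (u0 j)) ?(ltW (t0 _))// -mulrA.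
    rewrite ler_wpM2l ?powR_ge0//; apply: (le_trans (kP j)).
    rewrite normrM ger0_norm ?invr_ge0 ?powR_ge0//.
    by rewrite powRV// ltW.
  apply: le_trans (tA _ _ ys1 k _ _) _ => [j|].
    by rewrite divr_ge0 ?ltW.
  rewrite le_eqVlt; apply/orP; left; apply/eqP; congr (_ * _ `^ _).
  by apply: eq_bigr => j _; rewrite divfK ?gt_eqF.
have fCA : (fbl_norm p f <= (C * A)%:E)%E.
  have := le_trans (embC fd) fA.
  by rewrite lee_pdivrMl// -EFinM.
have hf : pos_homogeneous f by have [] := delta_lattice_FBL p1 fd.
have := fbl_norm_geZ p1 K0 hf xsK.
move=> /le_trans => /(_ (K * (C * A))%:E) H.
have {}H : (lp_norm p (\row_k (f (xs k) : R)) <= (K * (C * A))%:E)%E.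
  by apply: H; rewrite [(K * _)%:E]EFinM lee_wpmul2l// lee_fin ltW.
have := @lp_norm_dual_leK _ _ p1 _ _ t _ (fun k => ltW (t0 k)) H => {}H.
apply: (@le_trans _ _ (K * (C * A) * (\sum_i t i) `^ s)); last first.
  rewrite (_ : K * (C * A) = C * K * A); last by ring.
  rewrite ler_piMr ?mulr_ge0 ?(ltW C0) ?(ltW K0) ?(ltW A0)// powR_le1 ?cexp_ge0//.
  by rewrite t1 andbT sumr_ge0// => k _; exact: ltW.
apply: le_trans H; apply: ler_sum => k _; rewrite mxE -xsT.
apply: le_trans (ler_norm _) _.
have tk0 : 0 < t k `^ s by rewrite powR_gt0.
rewrite -ler_pdivrMl//; apply: le_trans (ler_norm _).
apply: le_trans (le_bigmax _ (fun i => `|(t i `^ s)^-1 * xs k (z i)|) k).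
by rewrite normrM ger0_norm// invr_ge0 ltW.
Qed.

(** [psi] is the pairing of [T] with tuples, normalized to lie below the gauge. Its extension to
    tuples in E determines the coordinates of the extended operator through tuples with a single
    nonzero entry. *)
Lemma fbl_embedding_extension n (T : {linear F -> 'rV[R]_n}) (K : R) : 0 <= K ->
  (forall z, (lp_norm p (T z) <= (K * `|z|)%:E)%E) ->
  exists T' : {linear E -> 'rV[R]_n}, (forall z, T' (iota z) = T z) /\
    forall e, (lp_norm p (T' e) <= (C * K * `|e|)%:E)%E.
Proof.
(* For [K = 0] the pairing cannot be normalized, but then [T] vanishes and zero extends it. *)
rewrite le_eqVlt => /predU1P[<- TK|K0 TK].
  exists (\0 : {linear E -> 'rV[R]_n}); split=> [z|e].
    apply/rowP => k; rewrite mxE; apply/esym/eqP; rewrite -normr_le0 -lee_fin.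
    apply: le_trans (coord_lp_norm p1 _ _) _; apply: le_trans (TK z) _.
    by rewrite mul0r.
  have -> : (\0 : {linear E -> 'rV[R]_n}) e = 0 *: 0 by rewrite scale0r.
  by rewrite lp_normZ// normr0 mul0e mulr0 mul0r.
have CK0 : 0 < C * K by rewrite mulr_gt0.
pose iotan (z : 'I_n -> F) : 'I_n -> E := iota \o z.
have liotan : linear iotan.
  by move=> a u v; apply/funext => k; rewrite /iotan /= linearP.
pose iotaL : {linear ('I_n -> F) -> ('I_n -> E)} :=
  HB.pack iotan (GRing.isLinear.Build R _ _ *:%R iotan liotan).
pose psi (z : 'I_n -> F) : R^o := (C * K)^-1 * \sum_k T (z k) 0 k.
have lpsi : linear psi.
  move=> a u v; change (psi (a *: u + v) = a * psi u + psi v).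
  rewrite /psi mulrCA -mulrDr; congr (_ * _).
  rewrite mulr_sumr -big_split/=; apply: eq_bigr => k _.
  by rewrite [(_ + _) k]/(a *: u k + v k) linearP !mxE.
pose psiL : {linear ('I_n -> F) -> R^o} :=
  HB.pack psi (GRing.isLinear.Build R _ _ *:%R psi lpsi).
have [z A zA|f [fi fA]] := hahn_banach_extension (tuple_gauge_sublinear n) (iota := iotaL) (psi := psiL).
  by rewrite [psiL z]/(psi z) /psi ler_pdivrMl//; exact: tuple_gauge_iota TK _ _ zA.
pose single (V : lmodType R) k (e : V) : 'I_n -> V := fun j => if j == k then e else 0.
have lsingle (V : lmodType R) k : linear (@single V k).
  move=> a u v; apply/funext => j.
  change ((if j == k then a *: u + v else 0) =
    a *: (if j == k then u else 0) + (if j == k then v else 0)).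
  by case: (j == k) => //; rewrite scaler0 addr0.
pose T' e : 'rV[R]_n := \row_k (C * K * f (single E k e)).
have lT' : linear T'.
  move=> a u v; apply/rowP => k; rewrite !mxE lsingle linearD linear_formZ.
  by rewrite mulrDr mulrCA.
pose T'L : {linear E -> 'rV[R]_n} := HB.pack T' (GRing.isLinear.Build R _ _ *:%R T' lT').
exists T'L; split=> [z|e].
  apply/rowP => k; rewrite [T'L _]/(T' _) mxE.
  have -> : single E k (iota z) = iotaL (single F k z).
    by apply/funext => j; rewrite /single /= /iotan /=; case: ifP; rewrite ?linear0.
  rewrite fi [psiL _]/(psi _) /psi mulVKf ?gt_eqF//.
  rewrite (bigD1 k)//= big1 ?addr0 /single ?eqxx// => j /negPf ->.
  by rewrite linear0 mxE.
apply: (lp_norm_dual_ge p1) => [|t t0]; first by rewrite mulr_ge0// ltW.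
have [->|e0] := eqVneq e 0.
  rewrite normr0 mulr0 mul0r big1// => k _; rewrite [T'L _]/(T' _) mxE.
  have -> : single E k 0 = 0 by apply/funext => j; rewrite /single; case: ifP.
  by rewrite linear0 mulr0 normr0 mulr0.
case: n => [|n] in T TK iotan liotan iotaL psi lpsi psiL f fi fA single lsingle
  T' lT' T'L t t0 *.
  by rewrite big_ord0 !mulr_ge0 ?powR_ge0// ltW.
have t_gt0 : 0 < \sum_i t i.
  by rewrite big_ord_recl ltr_pwDl// sumr_ge0// => k _; exact: ltW.
pose sg k : R := Num.sg (f (single E k e)).
(* A tuple of multiples of [e] that tests the norm of [T' e] by duality: the signs produce absolute
   values, and its gauge is at most |e| (sum t)^s, with the normalized [t] as weights. *)
pose v : 'I_n.+1 -> E := fun k => (t k `^ s * sg k) *: e.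
have vE : v = \sum_k (t k `^ s * sg k) *: single E k e.
  apply/funext => j; rewrite fct_sumE (bigD1 j)//= big1 ?addr0.
    by rewrite fctE /single eqxx.
  by move=> k /negPf kj; rewrite fctE /single eq_sym kj scaler0.
have := fA v (`|e| * (\sum_i t i) `^ s) _.
rewrite vE linear_sum => H.
rewrite -mulrA; apply: (@le_trans _ _ (C * K * \sum_i f ((t i `^ s * sg i) *: single E i e))).
  rewrite mulr_sumr; apply: ler_sum => k _.
  rewrite [T'L _]/(T' _) mxE normrM (gtr0_norm CK0) mulrCA ler_wpM2l ?(ltW CK0)//.
  rewrite linear_formZ -mulrA ler_wpM2l ?powR_ge0//.
  by rewrite -normrEsg.
rewrite ler_wpM2l ?(ltW CK0)//; apply: H; rewrite -vE; split.
  by rewrite mulr_gt0 ?normr_gt0// powR_gt0.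
exists (fun k => t k / \sum_i t i); split.
- by move=> k; rewrite divr_gt0.
- by rewrite -mulr_suml divff ?gt_eqF.
- move=> m ys ys1 k u u0.
  apply: (@le_trans _ _ (\sum_j (u j * t (k j)) `^ s * `|ys j e|)).
    apply: ler_sum => j _; rewrite /v linear_formZ !normrM.
    rewrite powRM// ?(ltW (t0 _))// -[leRHS]mulrA ler_wpM2l ?powR_ge0//.
    rewrite (ger0_norm (powR_ge0 _ _)) -mulrA ler_wpM2l ?powR_ge0// ler_piMl//.
    by rewrite /sg normr_sg; case: (_ != _); rewrite ?ler01.
  have ut0 j : 0 <= u j * t (k j) by rewrite mulr_ge0// ltW.
  have := weakly_lp_dual p1 e ys1 ut0; rewrite mul1r => H'.
  apply: (le_trans H'); rewrite -mulrA -powRM ?(ltW t_gt0)//; last first.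
    by apply: sumr_ge0 => j _; rewrite mulr_ge0// divr_ge0// ltW.
  rewrite mulr_sumr; rewrite le_eqVlt; apply/orP; left; apply/eqP.
  congr (_ * _ `^ _); apply: eq_bigr => j _.
  by rewrite mulrCA [X in _ = _ * X]mulrC divfK ?gt_eqF.
Qed.

End Extension.

(** * From l_p^n to L_p by generalized limits *)

Section DirectedLimit.
Context (R : realType) (I : Type) (i0 : I) (le : I -> I -> Prop).
Hypothesis le_refl : forall i, le i i.
Hypothesis le_tr : forall i j k, le i j -> le j k -> le i k.
Hypothesis le_dir : forall i j, exists k, le i k /\ le j k.

Definition bounded_net (f : I -> R) := exists M, forall i, `|f i| <= M.

Definition directed_limit (L : (I -> R) -> R) :=
  (forall a f g, bounded_net f -> bounded_net g ->
     L (fun i => a * f i + g i) = a * L f + L g) /\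
  (forall f c i, bounded_net f -> (forall j, le i j -> f j <= c) -> L f <= c).

(** Take limits along an ultrafilter containing all tails: a bounded net carries it to an
    ultrafilter on a compact interval, which converges. *)
Lemma directed_limit_exists : exists L, directed_limit L.
Proof.
pose G : set_system I := [set A | exists i, forall j, le i j -> A j].
have GP : ProperFilter G.
  apply: Build_ProperFilter_ex => [A [i /(_ i (le_refl i)) Ai]|]; first by exists i.
  split.
  - by exists i0.
  - move=> A B [i iA] [j jB]; have [k [ik jk]] := le_dir i j.
    by exists k => l kl; split; [apply: iA|apply: jB]; apply: le_tr kl.
  - by move=> A B AB [i iA]; exists i => j /iA; exact: AB.
have [U [UU GU]] := ultraFilterLemma GP.
have UP : ProperFilter U by exact: ultra_proper.
have cvgU (f : I -> R) : bounded_net f -> cvg (f @ U).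
  move=> [M fM].
  have fU : UltraFilter (f @ U).
    constructor=> [|H HP fH]; first exact: fmap_proper_filter.
    apply/seteqP; split=> // A HA.
    have [//|UnA] := in_ultra_setVsetC (f @^-1` A) UU.
    exfalso; have : H (A `&` ~` A) by apply: filterI => //; exact: fH.
    by rewrite setICr; exact: filter_not_empty.
  have := @segment_compact R (- M) M; rewrite compact_ultra => /(_ _ fU).
  case; first by apply: (@filterS _ U _ setT) => [i _ /=|]; [rewrite in_itv/= -ler_norml|exact: filterT].
  by move=> l [_ fl]; apply/cvg_ex; exists l.
exists (fun f => lim (f @ U)); split=> [a f g bf bg|f c i bf fc].
  have cf := cvgU _ bf; have cg := cvgU _ bg.
  apply/cvg_lim => //; apply: cvgD => //; apply: cvgMr => //.
apply: limr_le; first exact: cvgU.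
by apply: GU; exists i.
Qed.

Lemma bounded_net_cst c : bounded_net (fun=> c).
Proof. by exists `|c|. Qed.

Lemma bounded_net_lin a f g : bounded_net f -> bounded_net g ->
  bounded_net (fun i => a * f i + g i).
Proof.
move=> [M fM] [N gN]; exists (`|a| * M + N) => i.
by apply: le_trans (ler_normD _ _) _; rewrite normrM lerD// ler_wpM2l.
Qed.

Lemma bounded_netZ a f : bounded_net f -> bounded_net (fun i => a * f i).
Proof.
move=> bf; have := bounded_net_lin a bf (bounded_net_cst 0).
by under [X in bounded_net X]eq_fun do rewrite addr0.
Qed.

Lemma bounded_net_sum (J : finType) (f : J -> I -> R) :
  (forall j, bounded_net (f j)) -> bounded_net (fun i => \sum_j f j i).
Proof.
move=> bf; have [M fM] := choice bf; exists (\sum_j M j) => i.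
by apply: le_trans (ler_norm_sum _ _ _) _; apply: ler_sum.
Qed.

Variables (L : (I -> R) -> R) (HL : directed_limit L).

Lemma dlim_lin a f g : bounded_net f -> bounded_net g ->
  L (fun i => a * f i + g i) = a * L f + L g.
Proof. by have [+ _] := HL; apply. Qed.

Lemma dlim_le i f c : bounded_net f -> (forall j, le i j -> f j <= c) -> L f <= c.
Proof. by have [_] := HL; apply. Qed.

Lemma dlim0 : L (fun=> 0) = 0.
Proof.
have := dlim_lin (-1) (bounded_net_cst 0) (bounded_net_cst 0).
by under [X in L X]eq_fun do rewrite mulr0 addr0; rewrite mulN1r addNr.
Qed.

Lemma dlimZ a f : bounded_net f -> L (fun i => a * f i) = a * L f.
Proof.
move=> bf; have := dlim_lin a bf (bounded_net_cst 0); rewrite dlim0 addr0 => <-.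
by congr L; apply/funext => i; rewrite addr0.
Qed.

Lemma dlimD f g : bounded_net f -> bounded_net g ->
  L (fun i => f i + g i) = L f + L g.
Proof.
move=> bf bg; have := dlim_lin 1 bf bg; rewrite mul1r => <-.
by congr L; apply/funext => i; rewrite mul1r.
Qed.

Lemma dlim_ge i f c : bounded_net f -> (forall j, le i j -> c <= f j) -> c <= L f.
Proof.
move=> bf cf; rewrite -lerN2 -mulN1r -dlimZ//.
by apply: (@dlim_le i) => [|j /cf]; [exact: bounded_netZ|rewrite mulN1r lerN2].
Qed.

Lemma dlim_eq i f c : bounded_net f -> (forall j, le i j -> f j = c) -> L f = c.
Proof.
move=> bf fc; apply/eqP; rewrite eq_le; apply/andP; split.
  by apply: (@dlim_le i) => // j /fc ->.
by apply: (@dlim_ge i) => // j /fc ->.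
Qed.

Lemma dlim_norm_le i f c : bounded_net f -> (forall j, le i j -> `|f j| <= c) ->
  `|L f| <= c.
Proof.
move=> bf fc; rewrite ler_norml; apply/andP; split.
  by apply: (@dlim_ge i) => // j /fc; rewrite ler_norml => /andP[].
by apply: (@dlim_le i) => // j /fc; rewrite ler_norml => /andP[].
Qed.

Lemma dlim_sum (J : finType) (f : J -> I -> R) : (forall j, bounded_net (f j)) ->
  L (fun i => \sum_j f j i) = \sum_j L (f j).
Proof.
move=> bf; suff H (r : seq J) : bounded_net (fun i => \sum_(j <- r) f j i) /\
  L (fun i => \sum_(j <- r) f j i) = \sum_(j <- r) L (f j) by have [] := H (index_enum J).
elim: r => [|j r [br Lr]].
  under eq_fun do rewrite big_nil.
  by split; [exact: bounded_net_cst|rewrite big_nil dlim0].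
under eq_fun do rewrite big_cons; rewrite big_cons -Lr dlimD//; split=> //.
have := bounded_net_lin 1 (bf j) br.
by under [X in bounded_net X]eq_fun do rewrite mul1r.
Qed.

(** The signs of the limits turn the sum of absolute values into one linear combination, which
    passes inside the limit. *)
Lemma dlim_sum_norm_le i (J : finType) (w : J -> R) (f : J -> I -> R) c :
  (forall j, 0 <= w j) -> (forall j, bounded_net (f j)) ->
  (forall k, le i k -> \sum_j w j * `|f j k| <= c) ->
  \sum_j w j * `|L (f j)| <= c.
Proof.
move=> w0 bf fc; pose v j := w j * Num.sg (L (f j)).
have -> : \sum_j w j * `|L (f j)| = L (fun i => \sum_j v j * f j i).
  rewrite dlim_sum => [|j]; last exact: bounded_netZ.
  by apply: eq_bigr => j _; rewrite dlimZ// -mulrA -normrEsg.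
apply: (@dlim_le i) => [|k /fc]; first by apply: bounded_net_sum => j; exact: bounded_netZ.
apply: le_trans; apply: ler_sum => j _; rewrite -mulrA ler_wpM2l//.
apply: le_trans (ler_norm _) _; rewrite normrM ler_piMl// normr_sg.
by case: (_ != _); rewrite ?ler01.
Qed.

End DirectedLimit.

(** * Set functions along finite measurable partitions *)

Section SetFunctions.
Context (R : realType) (d : measure_display) (X : measurableType d).
Implicit Types (L m : set X -> R) (A B : set X).

Definition set_additive L := forall A B, measurable A -> measurable B ->
  A `&` B = set0 -> L (A `|` B) = L A + L B.

(** A partition is given by its labelling function, so that a common refinement is a pairing of
    labels and a coarsening a composition. *)
Definition msr_part (I : Type) (u : X -> I) :=
  forall i, measurable (u @^-1` [set i]).

Lemma set_additive0 L : set_additive L -> L set0 = 0.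
Proof.
move=> aL; have := aL set0 set0 measurable0 measurable0 (setI0 _).
by rewrite setU0 -[LHS]addr0 => /addrI.
Qed.

Lemma msr_part_pair (I J : Type) (u : X -> I) (v : X -> J) :
  msr_part u -> msr_part v -> msr_part (fun x => (u x, v x)).
Proof.
move=> mu mv [i j].
rewrite (_ : _ @^-1` _ = u @^-1` [set i] `&` v @^-1` [set j]); first exact: measurableI.
by apply/seteqP; split=> x /= => [[-> ->]|[-> ->]].
Qed.

Lemma msr_part_bool A : measurable A -> msr_part (fun x => `[< A x >]).
Proof.
move=> mA [].
  rewrite (_ : _ @^-1` _ = A)//; apply/seteqP; split=> x /=; last by move/asboolP.
  by move/asboolP.
rewrite (_ : _ @^-1` _ = ~` A); first exact: measurableC.
apply/seteqP; split=> x /=; last by move=> /asboolPn/negbTE.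
by move=> /negbT/asboolPn.
Qed.

Lemma set_additive_part L (I : finType) (u : X -> I) A : set_additive L ->
  msr_part u -> measurable A -> L A = \sum_i L (A `&` u @^-1` [set i]).
Proof.
move=> aL mu mA.
suff H (r : seq I) : uniq r -> measurable (A `&` [set x | u x \in r]) /\
    L (A `&` [set x | u x \in r]) = \sum_(i <- r) L (A `&` u @^-1` [set i]).
  have [_ <-] := H _ (index_enum_uniq I); rewrite -[in LHS](setIT A).
  by congr (L (_ `&` _)); apply/seteqP; split=> x //= _; rewrite mem_index_enum.
elim: r => [_|i r IH /= /andP[ir ur]].
  rewrite (_ : A `&` _ = set0); last by apply/seteqP; split=> x //= [].
  by rewrite big_nil set_additive0.
have {IH ur}[mr Lr] := IH ur.
have E : A `&` [set x | u x \in i :: r] =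
    (A `&` u @^-1` [set i]) `|` (A `&` [set x | u x \in r]).
  apply/seteqP; split=> x /=.
    by rewrite inE => -[Ax /orP[/eqP ->|uxr]]; [left|right].
  by rewrite inE => -[[Ax ->]|[Ax ->]]; rewrite ?eqxx ?orbT.
have mi : measurable (A `&` u @^-1` [set i]) by exact: measurableI.
rewrite E big_cons -Lr; split; first exact: measurableU.
apply: aL => //; apply/seteqP; split=> x //= [[_ uxi] [_]].
by rewrite uxi (negPf ir).
Qed.

Variables (s : R) (m : set X -> R).

(* For the set function [L A = int_A g w `^ s], where [w] is the density of [m],
   this says that [g] has L_p-norm at most [K], by duality. *)
Definition dual_bounded_by (K : R) L :=
  forall (I : finType) (u : X -> I) (t : I -> R), msr_part u -> (forall i, 0 <= t i) ->
  \sum_i t i `^ s * `|L (u @^-1` [set i])| <= K * (\sum_i t i * m (u @^-1` [set i])) `^ s.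

Definition null_for L := forall A, measurable A -> m A = 0 -> L A = 0.

End SetFunctions.

Section FinitePartition.
Context (R : realType) (p : \bar R) (p1 : (1 <= p)%E) (F E : normedModType R).
Context (iota : {linear F -> E}).
Context (d : measure_display) (X : measurableType d).
Local Notation s := (cexp p).
Variables (m : set X -> R) (lam : F -> set X -> R) (K K' : R).
Hypothesis (am : set_additive m) (m0 : forall A, measurable A -> 0 <= m A).
Hypothesis (K0 : 0 <= K) (K'0 : 0 <= K').
Hypothesis lam_lin : forall a x y A, measurable A ->
  lam (a *: x + y) A = a * lam x A + lam y A.
Hypothesis lam_add : forall x, set_additive (lam x).
Hypothesis lam_null : forall x, null_for m (lam x).
Hypothesis lam_bound : forall x, dual_bounded_by s m (K * `|x|) (lam x).
Hypothesis extK : forall n (T : {linear F -> 'rV[R]_n}),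
  (forall z, (lp_norm p (T z) <= (K * `|z|)%:E)%E) ->
  exists T' : {linear E -> 'rV[R]_n}, (forall z, T' (iota z) = T z) /\
    forall e, (lp_norm p (T' e) <= (K' * `|e|)%:E)%E.

Section OnePartition.
Variables (N : nat) (u : X -> 'I_N) (mu : msr_part u).
Local Notation D k := (u @^-1` [set k]).

Definition saturated (A : set X) := forall x y, u x = u y -> A x -> A y.

Let rep k : X := [get x | u x = k].
Let c k : R := if m (D k) == 0 then 0 else m (D k) `^ s.
Let ind (A : set X) k : R := `[< A (rep k) >]%:R.

Let repP k x : u x = k -> u (rep k) = k.
Proof. by move=> uxk; rewrite /rep; exact: (@getPex _ (fun x => u x = k) (ex_intro _ x uxk)). Qed.

Let saturated_sum L A : set_additive L -> saturated A -> measurable A ->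
  L A = \sum_k ind A k * L (D k).
Proof.
move=> aL sA mA; rewrite (set_additive_part aL mu mA); apply: eq_bigr => k _.
have [[x xk]|nk] := pselect (exists x, u x = k); last first.
  have -> : D k = set0 by apply/seteqP; split=> x //= xk; apply: nk; exists x.
  by rewrite setI0 set_additive0// mulr0.
have rk := repP xk; rewrite /ind; case: asboolP => Ar.
  rewrite mul1r; congr L; apply/seteqP; split=> y /=; first by case.
  by move=> yk; split=> //; apply: sA Ar; rewrite rk.
rewrite mul0r -[RHS](set_additive0 aL); congr L; apply/seteqP; split=> y //= [Ay yk].
by apply: Ar; apply: sA Ay; rewrite rk.
Qed.

Let c_ge0 k : 0 <= c k.
Proof. by rewrite /c; case: ifP => // _; exact: powR_ge0. Qed.

(** On the cells D_k, [lam] is the operator z |-> (lam_z(D_k) / m(D_k)^s)_k, of norm at most [K]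
    into l_p^N. Its extension is turned back into a set function by collecting the cells whose
    representative lies in A. This is additive on all sets and correct on unions of cells; the bound
    on all sets is what allows a limit over partitions. *)
Lemma one_partition_extension : exists Lam : E -> set X -> R,
  [/\ forall a x y A, Lam (a *: x + y) A = a * Lam x A + Lam y A,
      forall x A B, A `&` B = set0 -> Lam x (A `|` B) = Lam x A + Lam x B,
      forall z A, measurable A -> saturated A -> Lam (iota z) A = lam z A,
      forall x A, measurable A -> saturated A -> m A = 0 -> Lam x A = 0 &
      (forall x (I : finType) (v : X -> I) (t : I -> R), msr_part v ->
        (forall i, saturated (v @^-1` [set i])) -> (forall i, 0 <= t i) ->
        \sum_i t i `^ s * `|Lam x (v @^-1` [set i])| <=
          K' * `|x| * (\sum_i t i * m (v @^-1` [set i])) `^ s) /\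
      forall x A, `|Lam x A| <= K' * `|x| * m setT `^ s].
Proof.
have mD k : 0 <= m (D k) by exact: m0.
pose T z : 'rV[R]_N := \row_k (lam z (D k) / c k).
have lT : linear T.
  by move=> a x y; apply/rowP => k; rewrite !mxE lam_lin// mulrDl mulrA.
pose TL : {linear F -> 'rV[R]_N} := HB.pack T (GRing.isLinear.Build R _ _ *:%R T lT).
have [|T' [T'i T'K]] := extK (T := TL).
  move=> z; apply: (lp_norm_dual_ge p1) => [|t t0]; first exact: mulr_ge0.
  (* A null cell gets weight 0, since division by 0 gives 0; [lam z] vanishes there. *)
  pose t' k := t k / m (D k).
  have t'0 k : 0 <= t' k by rewrite divr_ge0// ltW.
  apply: (@le_trans _ _ (\sum_k t' k `^ s * `|lam z (D k)|)).
    apply: ler_sum => k _; rewrite [TL z]/(T z) mxE /t' /c.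
    have [mk0|mk0] := eqVneq (m (D k)) 0; first by rewrite lam_null// mul0r !normr0 !mulr0.
    rewrite normrM normfV (ger0_norm (powR_ge0 _ _)) powRM ?invr_ge0 ?(ltW (t0 k))//.
    by rewrite powRV// mulrCA mulrC mulrAC.
  apply: le_trans (lam_bound _ mu t'0) _; apply: ler_wpM2l; first exact: mulr_ge0.
  have t'm : \sum_k t' k * m (D k) <= \sum_k t k.
    apply: ler_sum => k _; rewrite /t'.
    have [->|mk0] := eqVneq (m (D k)) 0; first by rewrite mulr0 ltW.
    by rewrite divfK.
  have t'm0 : 0 <= \sum_k t' k * m (D k) by apply: sumr_ge0 => k _; rewrite mulr_ge0.
  by rewrite ge0_ler_powR ?cexp_ge0// nnegrE// (le_trans t'm0).
pose Lam x A := \sum_k ind A k * (c k * T' x 0 k).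
have bd x (t : 'I_N -> R) : (forall k, 0 <= t k) ->
    \sum_k t k `^ s * (c k * `|T' x 0 k|) <= K' * `|x| * (\sum_k t k * m (D k)) `^ s.
  move=> t0; have tm0 k : 0 <= t k * m (D k) by rewrite mulr_ge0.
  apply: le_trans (lp_norm_dual_leK p1 tm0 (T'K x)); apply: ler_sum => k _.
  rewrite powRM// -mulrA ler_wpM2l ?powR_ge0// ler_wpM2r// /c.
  by case: ifP => // _; exact: powR_ge0.
exists Lam; split.
- move=> a x y A; rewrite /Lam mulr_sumr -big_split/=; apply: eq_bigr => k _.
  by rewrite linearP !mxE; ring.
- move=> x A B AB; rewrite /Lam -big_split/=; apply: eq_bigr => k _.
  rewrite -mulrDl; congr (_ * _); rewrite /ind.
  have [Ar|nAr] := asboolP (A (rep k)); have [Br|nBr] := asboolP (B (rep k)).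
  + by have : (A `&` B) (rep k) by []; rewrite AB.
  + by rewrite addr0; case: asboolP => // -[]; left.
  + by rewrite add0r; case: asboolP => // -[]; right.
  + by rewrite addr0; case: asboolP => // -[].
- move=> z A mA sA; rewrite (saturated_sum (lam_add z) sA mA); apply: eq_bigr => k _.
  rewrite T'i [TL z]/(T z) mxE; congr (_ * _); rewrite /c.
  have [mk0|mk0] := eqVneq (m (D k)) 0; first by rewrite lam_null// !mul0r.
  rewrite mulrC divfK// gt_eqF// powR_gt0// lt_neqAle eq_sym mk0/=.
  exact: mD.
- move=> x A mA sA mA0; rewrite /Lam big1// => k _.
  move: mA0; rewrite (saturated_sum am sA mA) => /eqP.
  rewrite psumr_eq0 => [|i _]; last by rewrite mulr_ge0 ?ler0n.
  move=> /allP /(_ k) /[!mem_index_enum] /(_ isT) /=; rewrite mulf_eq0 => /orP[/eqP ->|mk].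
    by rewrite mul0r.
  by rewrite /c mk mul0r mulr0.
- split=> [x I v t mv sv t0|x A].
    have -> : \sum_i t i * m (v @^-1` [set i]) = \sum_k t (v (rep k)) * m (D k).
      under eq_bigr => i _ do rewrite (saturated_sum am (sv i) (mv i)) mulr_sumr.
      rewrite exchange_big/=; apply: eq_bigr => k _.
      rewrite (bigD1 (v (rep k)))//= big1 ?addr0 => [|i]; last first.
        rewrite /ind; case: asboolP => [/= -> /[!eqxx]//|_ _].
        by rewrite mul0r mulr0.
      by rewrite /ind asboolT// mul1r.
    apply: le_trans (bd x (fun k => t (v (rep k))) (fun k => t0 _)).
    apply: (@le_trans _ _ (\sum_i \sum_k t i `^ s * (ind (v @^-1` [set i]) k * (c k * `|T' x 0 k|)))).
      apply: ler_sum => i _; rewrite -mulr_sumr ler_wpM2l ?powR_ge0//.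
      apply: le_trans (ler_norm_sum _ _ _) _; apply: ler_sum => k _.
      by rewrite !normrM (ger0_norm (ler0n _ _)) (ger0_norm (c_ge0 k)).
    rewrite exchange_big/=; apply: ler_sum => k _.
    rewrite (bigD1 (v (rep k)))//= big1 ?addr0 => [|i]; last first.
      rewrite /ind; case: asboolP => [/= -> /[!eqxx]//|_ _].
      by rewrite mul0r mulr0.
    rewrite ler_wpM2l ?powR_ge0// ler_piMl ?mulr_ge0// /ind.
    by case: asboolP; rewrite ?ler01.
  have := bd x (fun=> 1) (fun=> ler01).
  under [X in _ <= _ * X `^ _]eq_bigr do rewrite mul1r -[D _]setTI.
  rewrite -(set_additive_part am mu measurableT); apply: le_trans.
  apply: le_trans (ler_norm_sum _ _ _) _; apply: ler_sum => k _.
  rewrite powR1 mul1r !normrM (ger0_norm (ler0n _ _)) (ger0_norm (c_ge0 k)).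
  rewrite ler_piMl ?mulr_ge0// /ind.
  by case: asboolP; rewrite ?ler01.
Qed.

End OnePartition.

(** Finite lists of sets, ordered by inclusion, index the partitions: [cell L] labels a point by its
    memberships in the measurable sets of [L]. A measurable set is saturated as soon as it occurs in
    the list. *)
Let cut (L : seq (set X)) := [seq A <- L | `[< measurable A >]].
Let sig L (x : X) : (size (cut L)).-tuple bool :=
  map_tuple (fun A : set X => `[< A x >]) (in_tuple (cut L)).
Let cell L (x : X) : 'I_#|{: (size (cut L)).-tuple bool}| := enum_rank (sig L x).

Let cell_part L : msr_part (cell L).
Proof.
move=> k; have -> : cell L @^-1` [set k] = sig L @^-1` [set enum_val k].
  apply/seteqP; split=> x /=; rewrite /cell; first by move=> <-; rewrite enum_rankK.
  by move=> ->; rewrite enum_valK.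
move: (enum_val k) => {k} b.
suff H (l : seq (set X)) (b' : seq bool) : (forall A, A \in l -> measurable A) ->
    measurable [set x | [seq `[< A x >] | A <- l] = b' :> seq bool].
  have -> : sig L @^-1` [set b] =
      [set x | [seq `[< A x >] | A <- cut L] = tval b :> seq bool].
    by apply/seteqP; split=> x /=; [move=> /(congr1 val)|move=> H'; exact: val_inj].
  by apply: H => A; rewrite mem_filter => /andP[/asboolP].
elim: l b' => [|A l IH] [|b0 b'] mL.
- by rewrite (_ : [set x | _] = setT)//; apply/seteqP; split.
- by rewrite (_ : [set x | _] = set0)//; apply/seteqP; split.
- by rewrite (_ : [set x | _] = set0)//; apply/seteqP; split.
- have -> : [set x | [seq `[< A x >] | A <- A :: l] = b0 :: b' :> seq bool] =
      (fun x => `[< A x >]) @^-1` [set b0] `&` [set x | [seq `[< A x >] | A <- l] = b'].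
    by apply/seteqP; split=> x /= => [[-> ->]|[-> ->]].
  apply: measurableI; first by apply: msr_part_bool; apply: mL; rewrite inE eqxx.
  by apply: IH => B Bl; apply: mL; rewrite inE Bl orbT.
Qed.

Let cell_saturated L A : measurable A -> A \in L -> saturated (cell L) A.
Proof.
move=> mA AL x y /enum_rank_inj /(congr1 val) /= /eq_in_map H Ax.
have /H : A \in cut L by rewrite mem_filter AL andbT; exact/asboolP.
by move=> AE; apply/asboolP; rewrite -AE; exact/asboolP.
Qed.

(** Linearity and additivity hold at every list, the identities on a set at all lists containing it,
    and the bound along a partition at all lists containing its cells. *)
Lemma finitely_additive_extension : exists Lam : E -> set X -> R,
  [/\ forall a x y A, measurable A -> Lam (a *: x + y) A = a * Lam x A + Lam y A,
      forall x, set_additive (Lam x),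
      forall z A, measurable A -> Lam (iota z) A = lam z A,
      forall x, null_for m (Lam x) &
      forall x, dual_bounded_by s m (K' * `|x|) (Lam x)].
Proof.
have [Lm LmP] := choice (fun L => one_partition_extension (@cell_part L)).
pose le (L L' : seq (set X)) := {subset L <= L'}.
have le_refl L : le L L by [].
have le_tr L1 L2 L3 : le L1 L2 -> le L2 L3 -> le L1 L3.
  by move=> h1 h2 A /h1 /h2.
have le_dir L L' : exists L2, le L L2 /\ le L' L2.
  by exists (L ++ L'); split=> A AL; rewrite mem_cat AL ?orbT.
have [lim limP] := @directed_limit_exists R _ [::] le le_refl le_tr le_dir.
pose Lam x A := lim (fun L => Lm L x A).
have bd x A : bounded_net (fun L => Lm L x A).
  by exists (K' * `|x| * m setT `^ s) => L; have [_ _ _ _ []] := LmP L.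
exists Lam; split.
- move=> a x y A mA; rewrite /Lam -(dlim_lin limP)//; congr lim.
  by apply/funext => L; have [] := LmP L.
- move=> x A B mA mB AB; rewrite /Lam -(dlimD limP)//; congr lim.
  by apply/funext => L; have [_ + _ _ _] := LmP L; apply.
- move=> z A mA; apply: (dlim_eq limP (i := [:: A])) => // L /(_ A).
  rewrite inE eqxx => /(_ isT) AL; have [_ _ + _ _] := LmP L; apply=> //.
  exact: cell_saturated.
- move=> x A mA mA0; apply: (dlim_eq limP (i := [:: A])) => // L /(_ A).
  rewrite inE eqxx => /(_ isT) AL; have [_ _ _ + _] := LmP L; apply=> //.
  exact: cell_saturated.
- move=> x I u t mu t0.
  apply: (dlim_sum_norm_le limP (i := [seq u @^-1` [set i] | i <- index_enum I])) => //.
    by move=> i; exact: powR_ge0.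
  move=> L leL; have [_ _ _ _ [+ _]] := LmP L; apply=> // i.
  by apply: cell_saturated => //; apply: leL; apply/mapP; exists i.
Qed.

End FinitePartition.

(** * The countably additive part of a bounded additive set function *)

Section CountablyAdditivePart.
Context (R : realType) (d : measure_display) (X : measurableType d).
Variables (s : R) (m : set X -> R).
Hypothesis (am : set_additive m).

(** Decreasing sequences of measurable sets with empty intersection are encoded as the tails of a
    labelling by integers. *)
Definition continuous_at_empty (L : set X -> R) := forall (P : X -> nat) (e : R),
  msr_part P -> 0 < e ->
  exists M0, forall M, (M0 <= M)%N -> `|L [set x | (M <= P x)%N]| <= e.

Lemma msr_part_comp (J : Type) (P : X -> nat) (f : nat -> J) :
  msr_part P -> msr_part (f \o P).
Proof.
move=> mP j; have -> : (f \o P) @^-1` [set j] =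
    \bigcup_(n in [set n | f n = j]) P @^-1` [set n].
  by apply/seteqP; split=> x /= => [fj|[n /= fn ->//]]; exists (P x).
exact: bigcup_measurable.
Qed.

Lemma msr_part_setge (P : X -> nat) M : msr_part P -> measurable [set x | (M <= P x)%N].
Proof. by move=> /(msr_part_comp (leq M)) /(_ true). Qed.

Let pair_sum (I J : finType) (f : I * J -> R) : \sum_ij f ij = \sum_i \sum_j f (i, j).
Proof. by rewrite pair_big; apply: eq_bigr => -[]. Qed.

Section Bound.
Variables (K : R) (L : set X -> R).
Hypothesis (bL : dual_bounded_by s m K L).

(** Apply the bound to pairs of labels from [v] and from [P] truncated at [N], with weights
    depending on [v] only. The labels of [P] from [N] on merge into one extra cell, whose term is
    dropped. *)
Lemma dual_bounded_by_refine (I : finType) (v : X -> I) (t : I -> R) (P : X -> nat) N :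
  msr_part v -> msr_part P -> (forall i, 0 <= t i) ->
  \sum_i t i `^ s * (\sum_(n < N) `|L (v @^-1` [set i] `&` P @^-1` [set n : nat])|) <=
  K * (\sum_i t i * m (v @^-1` [set i])) `^ s.
Proof.
move=> mv mP t0; pose f n : 'I_N.+1 := inord (minn n N).
have mq : msr_part (f \o P) by exact: msr_part_comp.
have := bL (msr_part_pair mv mq) (t := fun ij => t ij.1) (fun ij => t0 _).
rewrite !pair_sum /=.
have pre i k : (fun x => (v x, f (P x))) @^-1` [set (i, k)] =
    v @^-1` [set i] `&` (f \o P) @^-1` [set k].
  by apply/seteqP; split=> x /= => [[-> ->]|[-> ->]].
under [X in _ <= _ * X `^ _]eq_bigr => i _.
  under eq_bigr do rewrite pre.
  rewrite -mulr_sumr -(set_additive_part am mq (mv i)).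
  over.
apply: le_trans; apply: ler_sum => i _.
rewrite -mulr_sumr ler_wpM2l ?powR_ge0// big_ord_recr/= ler_wpDr//.
apply: ler_sum => n _; rewrite pre le_eqVlt; apply/orP; left; apply/eqP.
congr `|L (_ `&` _)|; apply/seteqP; split=> x /=.
  by move=> ->; apply/val_inj; rewrite /f /= inordK ?ltnS ?geq_minr//; apply/minn_idPl/ltnW.
move=> /(congr1 val); rewrite /f /= inordK ?ltnS ?geq_minr// => h.
move: h; rewrite /minn; case: ltnP => // _ Nn.
by have := ltn_ord n; rewrite -Nn ltnn.
Qed.

Lemma sum_cells_le A (P : X -> nat) N : measurable A -> msr_part P ->
  \sum_(n < N) `|L (A `&` P @^-1` [set n : nat])| <= K * m setT `^ s.
Proof.
move=> mA mP; have mb := msr_part_bool mA.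
have := dual_bounded_by_refine N mb mP (t := fun=> 1) (fun=> ler01).
have -> : \sum_b 1 * m ((fun x => `[< A x >]) @^-1` [set b]) = m setT.
  rewrite (set_additive_part am mb measurableT).
  by apply: eq_bigr => b _; rewrite setTI mul1r.
apply: le_trans; rewrite big_bool/= powR1 !mul1r.
have -> : (fun x => `[< A x >]) @^-1` [set true] = A.
  apply/seteqP; split=> x /=; last by move/asboolP.
  by move/asboolP.
by rewrite lerDl sumr_ge0.
Qed.

End Bound.

Let index := {P : X -> nat | msr_part P}.
Let refines (P Q : index) := forall x y, sval Q x = sval Q y -> sval P x = sval P y.

Let msr_part0 : msr_part (fun _ : X => 0%N).
Proof.
case=> [|n].
  by rewrite (_ : _ @^-1` _ = setT)//; apply/seteqP; split.
by rewrite (_ : _ @^-1` _ = set0)//; apply/seteqP; split.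
Qed.

Let refines_dir (P Q : index) : exists S, refines P S /\ refines Q S.
Proof.
case: P => P' mP; case: Q => Q' mQ.
have mS : msr_part (fun x => pickle (P' x, Q' x)).
  move=> n; have [[ij <-]|nij] := pselect (exists ij : nat * nat, pickle ij = n).
    rewrite (_ : _ @^-1` _ = (fun x => (P' x, Q' x)) @^-1` [set ij]).
      exact: msr_part_pair.
    by apply/seteqP; split=> x /= => [/(pcan_inj pickleK)|->].
  rewrite (_ : _ @^-1` _ = set0)//; apply/seteqP; split=> x //= Pn.
  by apply: nij; exists (P' x, Q' x).
by exists (exist _ _ mS); split=> x y /= /(pcan_inj pickleK)[].
Qed.

Let limP_ex := @directed_limit_exists R index (exist _ _ msr_part0) refines
  (fun P x y Pxy => Pxy) (fun P Q S PQ QS x y Sxy => PQ _ _ (QS _ _ Sxy)) refines_dir.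
Let limP := sval (cid limP_ex).
Let limPP : directed_limit refines limP := svalP (cid limP_ex).

Let leN (i j : nat) : Prop := (i <= j)%N.
Let leN_dir i j : exists k, leN i k /\ leN j k.
Proof. by exists (maxn i j); rewrite /leN leq_maxl leq_maxr. Qed.
Let limN_ex := @directed_limit_exists R nat 0%N leN leqnn
  (fun i j k => @leq_trans j i k) leN_dir.
Let limN := sval (cid limN_ex).
Let limNP : directed_limit leN limN := svalP (cid limN_ex).

Let psum L A (P : index) N : R := \sum_(n < N) L (A `&` sval P @^-1` [set n : nat]).

(* The countably additive part, as in the Yosida-Hewitt decomposition, but
   defined by a generalized limit along refining countable partitions, which
   makes it linear in [L]. *)
Definition ca_part (L : set X -> R) A := limP (fun P => limN (psum L A P)).

Section PartialSums.
Variables (K : R) (L : set X -> R).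
Hypothesis (bL : dual_bounded_by s m K L).

Let B := K * m setT `^ s.

Lemma psum_le A P N : measurable A -> `|psum L A P N| <= B.
Proof.
move=> mA; apply: le_trans (ler_norm_sum _ _ _) _.
by apply: sum_cells_le => //; exact: (svalP P).
Qed.

Lemma psum_bounded A P : measurable A -> bounded_net (psum L A P).
Proof. by move=> mA; exists B => N; exact: psum_le. Qed.

Lemma limN_psum_le A P : measurable A -> `|limN (psum L A P)| <= B.
Proof.
move=> mA; apply: (dlim_norm_le limNP (i := 0%N)); first exact: psum_bounded.
by move=> N _; exact: psum_le.
Qed.

Lemma limN_psum_bounded A : measurable A -> bounded_net (fun P => limN (psum L A P)).
Proof. by move=> mA; exists B => P; exact: limN_psum_le. Qed.

End PartialSums.

Lemma ca_part_lin (K1 K2 a : R) (L L1 L2 : set X -> R) A :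
  dual_bounded_by s m K1 L1 -> dual_bounded_by s m K2 L2 ->
  (forall A, measurable A -> L A = a * L1 A + L2 A) -> measurable A ->
  ca_part L A = a * ca_part L1 A + ca_part L2 A.
Proof.
move=> b1 b2 LE mA; rewrite /ca_part -(dlim_lin limPP); first last.
- exact: limN_psum_bounded b2 _ mA.
- exact: limN_psum_bounded b1 _ mA.
congr limP; apply/funext => P; rewrite -(dlim_lin limNP); first last.
- exact: psum_bounded b2 _ _ mA.
- exact: psum_bounded b1 _ _ mA.
congr limN; apply/funext => N; rewrite /psum mulr_sumr -big_split/=.
apply: eq_bigr => n _; apply: LE; apply: measurableI => //; exact: (svalP P).
Qed.

Section CaPart.
Variables (K : R) (L : set X -> R).
Hypothesis (aL : set_additive L) (bL : dual_bounded_by s m K L).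

Lemma ca_part_additive : set_additive (ca_part L).
Proof.
move=> A B mA mB AB; rewrite /ca_part -(dlimD limPP); first last.
- exact: limN_psum_bounded bL _ mB.
- exact: limN_psum_bounded bL _ mA.
congr limP; apply/funext => P; rewrite -(dlimD limNP); first last.
- exact: psum_bounded bL _ _ mB.
- exact: psum_bounded bL _ _ mA.
congr limN; apply/funext => N; rewrite /psum -big_split/=.
apply: eq_bigr => n _; rewrite setIUl aL//.
- apply: measurableI => //; exact: (svalP P).
- apply: measurableI => //; exact: (svalP P).
- by rewrite setIACA AB set0I.
Qed.

Lemma ca_part_null : (forall A, measurable A -> 0 <= m A) ->
  null_for m L -> null_for m (ca_part L).
Proof.
move=> m0 nL A mA mA0; apply: (dlim_eq limPP (i := exist _ _ msr_part0)).
  exact: limN_psum_bounded bL _ mA.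
move=> P _; apply: (dlim_eq limNP (i := 0%N)); first exact: psum_bounded bL _ _ mA.
move=> N _; rewrite /psum big1// => n _.
have mP : measurable (sval P @^-1` [set n : nat]) by exact: (svalP P).
have mAP : measurable (A `&` sval P @^-1` [set n : nat]) by exact: measurableI.
apply: nL => //; apply/eqP; rewrite eq_le m0// andbT.
have mAD : measurable (A `\` sval P @^-1` [set n : nat]) by exact: measurableD.
rewrite -mA0 -{2}(setUIDK A (sval P @^-1` [set n : nat])) am ?lerDl ?m0//.
by apply/seteqP; split=> x //= [[_ ?] []].
Qed.

Lemma ca_part_bounded : dual_bounded_by s m K (ca_part L).
Proof.
move=> I v t mv t0; apply: (dlim_sum_norm_le limPP (i := exist _ _ msr_part0)).
- by move=> i; exact: powR_ge0.
- by move=> i; exact: limN_psum_bounded bL _ (mv i).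
move=> P _; apply: (dlim_sum_norm_le limNP (i := 0%N)).
- by move=> i; exact: powR_ge0.
- by move=> i; exact: psum_bounded bL _ _ (mv i).
move=> N _; apply: le_trans (dual_bounded_by_refine bL N mv (svalP P) t0).
apply: ler_sum => i _; rewrite ler_wpM2l ?powR_ge0//.
exact: ler_norm_sum.
Qed.

Lemma ca_part_id A : measurable A -> (forall (P : X -> nat) (e : R),
  msr_part P -> 0 < e -> exists M0, forall M, (M0 <= M)%N ->
    `|L (A `&` [set x | (M <= P x)%N])| <= e) -> ca_part L A = L A.
Proof.
move=> mA cL; apply: (dlim_eq limPP (i := exist _ _ msr_part0)).
  exact: limN_psum_bounded bL _ mA.
move=> P _; have mP := svalP P; have bp := psum_bounded bL P mA.
have E N : L A = psum L A P N + L (A `&` [set x | (N <= sval P x)%N]).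
  elim: N => [|N IH].
    by rewrite /psum big_ord0 add0r; congr L; apply/seteqP; split=> x //= [].
  rewrite IH /psum big_ord_recr/= -addrA; congr (_ + _).
  rewrite -aL; first last.
  - by apply/seteqP; split=> x //= [[_ ->] [_]]; rewrite ltnn.
  - by apply: measurableI => //; exact: msr_part_setge.
  - by apply: measurableI => //; exact: mP.
  congr L; apply/seteqP; split=> x /=.
    by move=> [Ax]; rewrite leq_eqVlt => /orP[/eqP <-|]; [left|right].
  by move=> [[Ax ->]//|[Ax /ltnW]].
apply/eqP; rewrite eq_le; apply/andP; split; apply/ler_addgt0Pr => e e0;
    have [M0 HM] := cL _ _ mP e0.
  apply: (dlim_le limNP (i := M0)) => // N MN.
  rewrite -lerBlDl (E N) opprD addrA subrr sub0r.
  by have := HM _ MN; rewrite ler_norml => /andP[+ _]; rewrite lerNl.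
rewrite -lerBlDr; apply: (dlim_ge limNP (i := M0)) => // N MN.
rewrite lerBlDr (E N) lerD2l.
by have := HM _ MN; rewrite ler_norml => /andP[].
Qed.

(* A partition on which [sum |L|] is almost maximal leaves almost no mass in a
   tail that it avoids. *)
Lemma ca_part_continuous : continuous_at_empty (ca_part L).
Proof.
move=> P0 e mP0 e0.
pose P0' : index := exist _ _ mP0.
pose S (P : index) N := \sum_(n < N) `|L (sval P @^-1` [set n : nat])|.
(* Only refinements of [P0] compete, so that the tails of [P0] are unions of their cells. *)
pose W := [set z | exists P N, refines P0' P /\ z = S P N].
have SB P N : S P N <= K * m setT `^ s.
  have := sum_cells_le bL N measurableT (svalP P).
  by under eq_bigr do rewrite setTI.
have supW : has_sup W.
  split; first by exists (S P0' 0%N), P0', 0%N; split.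
  by exists (K * m setT `^ s) => _ [P [N [_ ->]]]; exact: SB.
have [_ [Q [N0 [P0Q ->]]] SQ] := sup_adherent e0 supW.
pose rep n : X := [get x | sval Q x = n].
(* [P0] is constant on each cell of [Q]; [M0] exceeds its values on the first [N0] cells, so the
   tail [A] misses them. *)
pose M0 := (\sum_(n < N0) P0 (rep n)).+1.
have repP x : (sval Q x < N0)%N -> (P0 x < M0)%N.
  move=> xN0; have -> : P0 x = P0 (rep (sval Q x)).
    apply: P0Q; symmetry.
    exact: (@getPex _ (fun y => sval Q y = sval Q x) (ex_intro _ x erefl)).
  by rewrite /M0 ltnS (bigD1 (Ordinal xN0))//= leq_addr.
exists M0 => M MM0; set A := [set x | (M <= P0 x)%N].
have mA : measurable A by exact: msr_part_setge.
apply: (dlim_norm_le limPP (i := P0')); first exact: limN_psum_bounded bL _ mA.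
move=> P P0P; apply: (dlim_norm_le limNP (i := 0%N)).
  exact: psum_bounded bL _ _ mA.
move=> N _; apply: le_trans (ler_norm_sum _ _ _) _.
have mP := svalP P; have mQ := svalP Q.
(* Use [P] on the tail, with odd labels, and [Q] off it, with even labels. This refines [P0], and
   its even cells alone carry more than [sup W - e], which leaves at most [e] for the odd ones. *)
pose P1 x := if `[< A x >] then (sval P x).*2.+1 else (sval Q x).*2.
have even_cell n : P1 @^-1` [set n.*2] = ~` A `&` sval Q @^-1` [set n].
  apply/seteqP; split=> x /=; rewrite /P1; case: asboolP => Ax.
  - by move=> /(congr1 odd); rewrite /= !odd_double.
  - by move=> /double_inj.
  - by case.
  - by move=> [_ ->].
have odd_cell n : P1 @^-1` [set n.*2.+1] = A `&` sval P @^-1` [set n].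
  apply/seteqP; split=> x /=; rewrite /P1; case: asboolP => Ax.
  - by move=> -[] /double_inj.
  - by move=> /(congr1 odd); rewrite /= !odd_double.
  - by move=> [_ ->].
  - by case.
have mP1 : msr_part P1.
  move=> n; rewrite -(odd_double_half n); case: (odd n); rewrite ?add0n ?add1n.
    by rewrite odd_cell; exact: measurableI.
  by rewrite even_cell; apply: measurableI => //; exact: measurableC.
pose P1' : index := exist _ _ mP1.
have P0P1 : refines P0' P1'.
  move=> x y /=; rewrite /P1; case: asboolP => Ax; case: asboolP => Ay.
  - by move=> -[] /double_inj; exact: P0P.
  - by move=> /(congr1 odd); rewrite /= !odd_double.
  - by move=> /(congr1 odd); rewrite /= !odd_double.
  - by move=> /double_inj; exact: P0Q.
pose Z := maxn N N0.
have double_sum (g : nat -> R) k :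
    \sum_(n < k.*2) g n = \sum_(n < k) g n.*2 + \sum_(n < k) g n.*2.+1.
  elim: k => [|k IH]; first by rewrite !big_ord0 addr0.
  by rewrite doubleS !big_ord_recr/= IH addrACA -!addrA.
have le1 : S P1' Z.*2 <= sup W.
  by apply: ub_le_sup; [have [] := supW|exists P1', Z.*2].
have mono (g : nat -> R) j : (forall n, 0 <= g n) -> (j <= Z)%N ->
    \sum_(n < j) g n <= \sum_(n < Z) g n.
  move=> g0 jZ; rewrite -(subnKC jZ) big_split_ord/= lerDl; exact: sumr_ge0.
have le2 : S Q N0 <= \sum_(n < Z) `|L (P1 @^-1` [set n.*2])|.
  apply: le_trans (mono (fun n => `|L (P1 @^-1` [set n.*2])|) _ _ (leq_maxr _ _)) => //.
  apply: ler_sum => n _; rewrite even_cell le_eqVlt; apply/orP; left; apply/eqP.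
  congr `|L _|; apply/seteqP; split=> x /=; last by case.
  move=> xn; split=> //; apply/negP; rewrite -ltnNge.
  by apply: leq_trans MM0; apply: repP; rewrite xn.
have le3 : \sum_(n < N) `|L (A `&` sval P @^-1` [set n : nat])| <=
    \sum_(n < Z) `|L (P1 @^-1` [set n.*2.+1])|.
  apply: le_trans (mono (fun n => `|L (P1 @^-1` [set n.*2.+1])|) _ _ (leq_maxl _ _)) => //.
  by apply: ler_sum => n _; rewrite odd_cell.
have := lerD le2 le3; rewrite -(double_sum (fun n => `|L (P1 @^-1` [set n])|)).
move=> /le_trans /(_ le1) H.
by move: H SQ; set a := S Q N0; set b := \sum_(n < N) _; set c := sup W; lra.
Qed.

End CaPart.
End CountablyAdditivePart.

(** * Densities and L_p norms *)

Section IntegralSetFunction.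
Context (R : realType) (d : measure_display) (X : measurableType d).
Variable mu : {measure set X -> \bar R}.
Implicit Types (f : X -> R) (A B : set X).

Lemma integrableT_sub f A : measurable A -> mu.-integrable setT (EFin \o f) ->
  mu.-integrable A (EFin \o f).
Proof. by move=> mA; exact: integrableS. Qed.

Lemma Rintegral_set_additive f : mu.-integrable setT (EFin \o f) ->
  set_additive (fun A => \int[mu]_(x in A) f x).
Proof.
move=> intf A B mA mB AB; apply: Rintegral_setU => //.
  by apply: integrableT_sub => //; exact: measurableU.
by apply/disj_setPS; rewrite AB.
Qed.

(** Dominated convergence: every point eventually leaves the tails. *)
Lemma Rintegral_tail f (P : X -> nat) A (e : R) :
  mu.-integrable setT (EFin \o f) -> msr_part P -> measurable A -> 0 < e ->
  exists M0, forall M, (M0 <= M)%N ->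
    `|\int[mu]_(x in A `&` [set x | (M <= P x)%N]) f x| <= e.
Proof.
move=> intf mP mA e0.
pose f_ n : X -> \bar R := EFin \o (f \_ [set x | (n <= P x)%N]).
have mf : measurable_fun setT f by apply/measurable_EFinP; case/integrableP : intf.
have := @dominated_convergence _ _ _ mu A mA f_ (cst 0%E) (fun x => `|f x|%:E).
case.
- move=> n; apply/measurable_EFinP; apply: measurable_funTS.
  by apply/(measurable_restrictT _ _).1; [exact: msr_part_setge|exact: measurable_funTS].
- exact: measurable_cst.
- apply: aeW => x Ax; apply: cvg_near_cst; exists (P x).+1 => // n /= Pn.
  by rewrite /f_ /= patchE memNset//= leqNgt Pn.
- exact: integrable_abse (integrableT_sub mA intf).
- apply: aeW => x n Ax; rewrite /f_ /= patchE; case: ifP => _ //.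
  by rewrite normr0 lee_fin.
move=> _ _; rewrite integral0 => /fine_cvg /cvgrPdist_le /(_ e e0)[M0 _ HM].
exists M0 => M MM; rewrite Rintegral_mkcondr.
by have := HM M MM; rewrite sub0r normrN.
Qed.

End IntegralSetFunction.

Section Density.
Context (R : realType) (d : measure_display) (X : measurableType d).
Variable mu : {sigma_finite_measure set X -> \bar R}.

(** Continuity at the empty set upgrades finite to countable additivity, so that [L] is a charge and
    Radon-Nikodym applies. *)
Lemma set_function_density (L : set X -> R) : set_additive L ->
  continuous_at_empty L -> (forall A, measurable A -> mu A = 0%E -> L A = 0) ->
  exists h : X -> R, mu.-integrable setT (EFin \o h) /\
    forall A, measurable A -> L A = \int[mu]_(x in A) h x.
Proof.
move=> aL cL nL; pose nu A : \bar R := (L A)%:E.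
have nu0 : nu set0 = 0%E by rewrite /nu set_additive0.
have nu_fin A : measurable A -> nu A \is a fin_num by [].
have nu_sigma : semi_sigma_additive nu.
  move=> F mF tF mUF.
  (* Points outside the union share the label 0 with [F 0]; hence only tails with n > 0 are used
     below. *)
  pose P x := xget 0%N [set i | F i x].
  have PE x i : F i x -> P x = i.
    move=> Fix; rewrite /P; case: xgetP => [j _ Fjx|/(_ i)//].
    by apply: (tF j i) => //; exists x.
  pose U := \bigcup_i F i.
  have mP : msr_part P.
    move=> i; have -> : P @^-1` [set i] = F i `|` (if i == 0%N then ~` U else set0).
      apply/seteqP; split=> x /=.
        rewrite /P; case: xgetP => [j -> Fjx ji|nF <-]; first by left; rewrite -ji.
        by right; rewrite eqxx => -[j _ Fjx]; exact: (nF j).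
      case=> [/PE //|]; case: eqVneq => // -> nU.
      by rewrite /P; case: xgetP => // j _ Fjx; exfalso; apply: nU; exists j.
    by apply: measurableU => //; case: ifP => // _; exact: measurableC.
  have UE n : (0 < n)%N -> L U = \sum_(0 <= i < n) L (F i) + L [set x | (n <= P x)%N].
    case: n => // n _; elim: n => [|n IH].
      rewrite big_nat1 -aL//; first last.
      - by apply/seteqP; split=> x //= [/PE ->].
      - exact: msr_part_setge.
      - congr L; apply/seteqP; split=> x /=.
          move=> [i _ Fix]; have := PE _ _ Fix; case: i Fix => [|i] Fix Pi; first by left.
          by right; rewrite Pi.
        case=> [F0x|]; first by exists 0%N.
        by rewrite /P; case: xgetP => // j _ Fjx _; exists j.
    rewrite IH [in RHS]big_nat_recr//= -addrA; congr (_ + _).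
    rewrite -aL//; first last.
    - by apply/seteqP; split=> x //= [/PE ->]; rewrite ltnn.
    - exact: msr_part_setge.
    - congr L; apply/seteqP; split=> x /=.
        rewrite leq_eqVlt => /orP[/eqP nP|]; [left|by right].
        move: nP; rewrite /P; case: xgetP => // j _ Fjx nj.
        by rewrite nj.
      by case=> [/PE ->//|/ltnW].
  rewrite -/U /nu; under eq_fun do rewrite sumEFin.
  apply: cvg_EFin; first exact: nearW.
  apply/cvgrPdist_le => e e0; have [M0 HM] := cL P e mP e0.
  exists (maxn M0 1) => // n /=; rewrite geq_max => /andP[Mn n0].
  rewrite (UE n n0) [X in `|X|](_ : _ = L [set x | (n <= P x)%N]); first exact: HM.
  by rewrite /= addrAC subrr add0r.
pose nuC : {charge set X -> \bar R} :=
  HB.pack nu (isCharge.Build _ _ _ nu nu0 nu_fin nu_sigma).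
have nu_mu : nuC `<< mu.
  apply/null_content_dominatesP => A mA muA0.
  by rewrite /nuC/= /nu nL.
pose g := Radon_Nikodym nuC mu.
have gE x : (fine (g x))%:E = g x by rewrite fineK// Radon_Nikodym_fin_num.
exists (fine \o g); split.
  rewrite (_ : EFin \o _ = g); first exact: Radon_Nikodym_integrable.
  by apply/funext => x; exact: gE.
move=> A mA; rewrite /Rintegral; under eq_integral do rewrite /= gE.
by rewrite -Radon_Nikodym_integral.
Qed.

End Density.

Section Weight.
Context (R : realType) (d : measure_display) (X : measurableType d).

(** Cut the space into disjoint pieces of finite measure and let [v] be constant on each, so small
    that its integral over the i-th piece is at most 2^-(i+1). *)
Lemma sigma_finite_weight (mu : {sigma_finite_measure set X -> \bar R}) :
  exists v : X -> R, [/\ forall x, 0 < v x, measurable_fun setT v &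
    mu.-integrable setT (EFin \o v)].
Proof.
have [S ST Sfin] := sigma_finiteT mu.
pose D := seqDU S.
have mS i : measurable (S i) by have [] := Sfin i.
have mD i : measurable (D i) by apply: measurableD => //; exact: bigsetU_measurable.
have UD : \bigcup_i D i = setT by rewrite -seqDU_bigcup_eq -ST.
have tD : trivIset setT D by exact: trivIset_seqDU.
pose P x := xget 0%N [set i | D i x].
have DP x : D (P x) x.
  have : (\bigcup_i D i) x by rewrite UD.
  by move=> [i _ Dix]; rewrite /P; case: xgetP => [j -> //|/(_ i)].
have PE x i : D i x -> P x = i by move=> Dix; apply: (tD (P x) i) => //; exists x.
have mP : msr_part P.
  move=> i; rewrite (_ : _ @^-1` _ = D i)//; apply/seteqP; split=> x /=.
    by move=> <-; exact: DP.
  by move=> /PE.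
have Dfin i : (mu (D i) < +oo)%E.
  have [_ Soo] := Sfin i; apply: le_lt_trans Soo.
  by apply: le_measure; rewrite ?inE//; exact: subset_seqDU.
pose w i : R := (2 ^+ i.+1)^-1 / (1 + fine (mu (D i))).
have mu0 i : 0 <= fine (mu (D i)) by exact: fine_ge0.
have w0 i : 0 < w i by rewrite divr_gt0 ?invr_gt0 ?exprn_gt0// ltr_wpDr.
pose v x := w (P x).
have mv : measurable_fun setT v.
  move=> _ B mB; rewrite setTI.
  have -> : v @^-1` B = \bigcup_(i in w @^-1` B) P @^-1` [set i].
    apply/seteqP; split=> x => [Bx|[i wi Pi]]; first by exists (P x).
    by rewrite /preimage /= /v (Pi : P x = i).
  by apply: bigcup_measurable => i _; exact: mP.
exists v; split=> [x|//|]; first exact: w0.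
apply/integrableP; split; first exact/measurable_EFinP.
rewrite -UD ge0_integral_bigcup//; last first.
  by apply: measurable_funTS; do 2 apply: measurableT_comp => //.
apply: (@le_lt_trans _ _ 1%E); last exact: ltry.
apply: le_trans (@epsilon_trick0 R 1 predT ler01).
apply: lee_nneseries => [i _ _|i _]; first by exact: integral_ge0.
have -> : (\int[mu]_(x in D i) `|(EFin \o v) x| = \int[mu]_(x in D i) (w i)%:E)%E.
  apply: eq_integral => x; rewrite inE => /PE Px.
  have vx : v x = w i by rewrite /v Px.
  by rewrite [in LHS]/comp vx abse_EFin gtr0_norm.
rewrite integral_cst//.
have wa : w i * fine (mu (D i)) <= 1 / (2 ^ i.+1)%:R.
  rewrite /w natrX mul1r -mulrA ler_piMr// mulrC ler_pdivrMr ?ltr_wpDr//.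
  by rewrite mul1r lerDr.
rewrite -lee_fin EFinM in wa; apply: le_trans wa; rewrite fineK//.
by rewrite ge0_fin_numE.
Qed.

Variable mu : {measure set X -> \bar R}.

(** A general weight [w] allows a step function times [v], which yields the bound along partitions
    for an operator into L_p. *)
Lemma hoelder_weight (p : \bar R) (p1 : (1 <= p)%E) (g w : X -> R) (N : R) :
  measurable_fun setT g -> measurable_fun setT w -> (forall x, 0 <= w x) ->
  mu.-integrable setT (EFin \o w) -> 0 <= N -> (Lnorm mu p (EFin \o g) <= N%:E)%E ->
  (\int[mu]_x `|g x * w x `^ cexp p|%:E <= (N * (\int[mu]_x w x) `^ cexp p)%:E)%E.
Proof.
move=> mg mw w0 iw N0.
have wE : (\int[mu]_x w x)%R%:E = (\int[mu]_x (w x)%:E)%E.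
  by rewrite fineK//; exact: integrable_fin_num.
have mws s : measurable_fun setT (fun x => w x `^ s).
  exact: (@measurableT_comp _ _ _ _ _ _ (@powR R ^~ s)).
rewrite /cexp; move: p1; case: p => [r|_|//] /=.
  rewrite lee_fin le_eqVlt => /predU1P[<-|r1] gN.
    rewrite invr1 subrr powRr0 mulr1; apply: le_trans gN; rewrite Lnorm1.
    by under eq_integral do rewrite powRr0 mulr1.
  have r0 : 0 < r by rewrite (lt_trans _ r1).
  have s0 : 0 < 1 - r^-1 by rewrite subr_gt0 invf_lt1.
  have := @hoelder _ _ _ mu g (fun x => w x `^ (1 - r^-1)) r (1 - r^-1)^-1
    mg (mws _) r0.
  rewrite invr_gt0 invrK subrKC => /(_ s0 erefl).
  rewrite Lnorm1 => /le_trans; apply.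
  rewrite EFinM; apply: lee_pmul => //; rewrite ?Lnorm_ge0//.
  rewrite unlock /= invrK -poweR_EFin wE le_eqVlt; apply/orP; left; apply/eqP.
  congr (_ `^ _)%E; apply: eq_integral => x _.
  rewrite ger0_norm ?powR_ge0// -powRrM mulfV ?gt_eqF//.
  by rewrite powRr1.
rewrite invr0 subr0 => gN; rewrite powRr1; last by rewrite Rintegral_ge0.
rewrite EFinM wE -ge0_integralZl//; first last.
- by move=> x _; rewrite lee_fin.
- exact/measurable_EFinP.
apply: ae_ge0_le_integral => //.
- by apply/measurable_EFinP; apply: measurableT_comp => //; exact: measurable_funM.
- by move=> x _; rewrite -EFinM lee_fin mulr_ge0.
- by apply: measurable_funeM; exact/measurable_EFinP.
(* For p = +oo the norm is the essential supremum only when the measure is nonzero; for the zero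
   measure every bound holds almost everywhere. *)
move: gN; rewrite unlock; have [mu0|mu0] := ltP 0%E (mu setT).
  move=> /ess_supP; apply: filterS => x /= gN _.
  rewrite powRr1// -EFinM lee_fin normrM (ger0_norm (w0 x)) ler_wpM2r//.
move=> _; exists setT; split => //.
by apply/eqP; rewrite eq_le mu0 measure_ge0.
Qed.

End Weight.

Section DensityNorm.
Import HBNNSimple.
Context (R : realType) (d : measure_display) (X : measurableType d).

Lemma Rintegral_le0_null (mu : {measure set X -> \bar R}) (f : X -> R) A :
  mu.-integrable setT (EFin \o f) -> measurable A -> (forall x, A x -> 0 < f x) ->
  \int[mu]_(x in A) f x <= 0 -> mu A = 0%E.
Proof.
move=> intf mA f0 intf0; have iA := integrableT_sub mA intf.
have [mf _] := integrableP _ _ _ iA.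
have : (\int[mu]_(x in A) `|(EFin \o f) x| = 0)%E.
  apply/eqP; rewrite eq_le integral_ge0// andbT.
  rewrite (_ : (\int[mu]_(x in A) _)%E = (\int[mu]_(x in A) f x)%:E)//.
  rewrite fineK; last exact: integrable_fin_num.
  by apply: eq_integral => x; rewrite inE => /f0 fx; rewrite /= gtr0_norm.
move=> /(ae_eq_integral_abs mu mA mf)[N [mN muN AN]].
apply: (subset_measure0 mA mN _ muN) => x Ax; apply: AN => /(_ Ax) /= [fx].
by have := f0 x Ax; rewrite fx ltxx.
Qed.

Variables (mu : {measure set X -> \bar R}) (p : \bar R) (p1 : (1 <= p)%E).
Variables (h v : X -> R) (K : R).
Hypothesis (K0 : 0 <= K) (v0 : forall x, 0 < v x) (mv : measurable_fun setT v).
Hypothesis (iv : mu.-integrable setT (EFin \o v)) (ih : mu.-integrable setT (EFin \o h)).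
Let m A := \int[mu]_(x in A) v x.
Let L A := \int[mu]_(x in A) h x.
Hypothesis bL : dual_bounded_by (cexp p) m K L.

Let mh : measurable_fun setT h.
Proof. by apply/measurable_EFinP; case/integrableP : ih. Qed.

Let mh_ge0 : measurable [set x | 0 <= h x].
Proof.
rewrite -[X in measurable X]setTI (_ : [set x | 0 <= h x] = h @^-1` `[0, +oo[%classic).
  by apply: mh => //; exact: measurable_itv.
by apply/seteqP; split=> x /=; rewrite in_itv/= andbT.
Qed.

Let cell_lower A c : measurable A -> 0 <= c -> (forall x, A x -> c * v x <= `|h x|) ->
  (forall x, A x -> 0 <= h x) \/ (forall x, A x -> h x < 0) -> c * m A <= `|L A|.
Proof.
move=> mA c0 ch sh.
have iA f : mu.-integrable setT (EFin \o f) -> mu.-integrable A (EFin \o f).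
  exact: integrableT_sub.
have icv : mu.-integrable A (EFin \o (fun x => c * v x)).
  by have := integrableZl mA c (iA _ iv).
rewrite /m -RintegralZl//; last exact: iA.
case: sh => sh; last rewrite -normrN.
  apply: le_trans (ler_norm _); apply: le_Rintegral => // [|x Ax]; first exact: iA.
  by apply: le_trans (ch x Ax) _; rewrite ger0_norm ?sh.
apply: le_trans (ler_norm _); rewrite -mulN1r -RintegralZl//; last exact: iA.
apply: le_Rintegral => // [|x Ax].
  by have := integrableZl mA (-1) (iA _ ih).
by apply: le_trans (ch x Ax) _; rewrite mulN1r ltr0_norm ?sh.
Qed.

(** Partition by the values c of [f] and the sign of [h], with weights c^r. The weighted sum [S] is
    the integral of f^r v, and the bound gives S <= K S^s, hence S <= K^r. The sign is fixed on each
    cell to avoid cancellation in [L]. *)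
Let simple_bound (r : R) (f : {nnsfun X >-> R}) : p = r%:E ->
  (forall x, f x * v x <= `|h x|) ->
  (\int[mu]_x (f x `^ r * v x)%:E <= (K `^ r)%:E)%E.
Proof.
move=> pr fh; have r1 : 1 <= r by move: p1; rewrite pr lee_fin.
have r0 : 0 < r by rewrite (lt_le_trans _ r1).
have /finite_seqP[l lE] := @fimfunP _ _ f.
have fl x : f x \in l by have : range f (f x) by []; rewrite lE.
pose u x : 'I_(size l).+1 := inord (index (f x) l).
pose c (i : 'I_(size l).+1) := nth 0 l i.
have cu x : c (u x) = f x.
  by rewrite /c /u inordK ?ltnS ?index_size// nth_index.
have mu_part : msr_part u.
  move=> i; have [[x0 ui]|nui] := pselect (exists x0, u x0 = i).
    rewrite (_ : _ @^-1` _ = f @^-1` [set c i]); first exact: measurable_funPTI.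
    apply/seteqP; split=> x /=; first by move=> <-; rewrite cu.
    by rewrite -ui cu => fx; rewrite /u fx.
  by rewrite (_ : _ @^-1` _ = set0)//; apply/seteqP; split=> x //= ux; apply: nui; exists x.
have f0 x : 0 <= f x by [].
pose w x := (u x, `[< 0 <= h x >]).
have mw : msr_part w by apply: msr_part_pair => //; exact: msr_part_bool.
pose D ib := w @^-1` [set ib].
pose t (ib : 'I_(size l).+1 * bool) := `|c ib.1| `^ r.
have t0 ib : 0 <= t ib by exact: powR_ge0.
have s01 := cexp_itv p1; set s := cexp p in s01 *.
pose S := \sum_ib t ib * m (D ib).
have m0 A : 0 <= m A by apply: Rintegral_ge0 => x _; exact: ltW.
have S0 : 0 <= S by apply: sumr_ge0 => ib _; exact: mulr_ge0.
have SK : S <= K * S `^ s.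
  apply: le_trans (bL mw t0); apply: ler_sum => ib _.
  have cD : `|c ib.1| * m (D ib) <= `|L (D ib)|.
    apply: (cell_lower (mw ib) (normr_ge0 _)) => [x|].
      rewrite /D /w /= => <- /=; rewrite cu ger0_norm//; exact: fh.
    case: ib => i [|]; [left|right] => x /= -[_].
      by move/asboolP.
    by move=> /negbT/asboolPn/negP; rewrite -ltNge.
  apply: le_trans (ler_wpM2l (powR_ge0 _ _) cD); rewrite mulrA ler_wpM2r// /t.
  have [->|cn0] := eqVneq (c ib.1) 0.
    by rewrite normr0 powR0 ?gt_eqF// mulr0.
  rewrite -powRrM -[X in _ * X]powRr1// -powRD; last by rewrite normr_eq0 cn0 implybT.
  by rewrite /s /cexp pr/= mulrBr mulr1 mulfV ?gt_eqF// subrK.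
have SKr : S <= K `^ r.
  have [->|Sn0] := eqVneq S 0; first exact: powR_ge0.
  have S0' : 0 < S by rewrite lt_neqAle eq_sym Sn0.
  have : S `^ s * S `^ r^-1 <= S `^ s * K.
    rewrite -powRD; last by rewrite Sn0 implybT.
    have -> : s + r^-1 = 1 by rewrite /s /cexp pr/= subrK.
    by rewrite powRr1// mulrC.
  rewrite ler_pM2l ?powR_gt0// => SK'.
  have -> : S = (S `^ r^-1) `^ r by rewrite -powRrM mulVf ?gt_eqF// powRr1.
  by rewrite ge0_ler_powR ?nnegrE ?powR_ge0// ltW.
pose C := \sum_ib t ib.
have fC x : f x `^ r <= C.
  rewrite /C (bigD1 (w x))//= /t /= cu ger0_norm// lerDl; apply: sumr_ge0 => ib _.
  exact: powR_ge0.
have mfv : measurable_fun setT (fun x => f x `^ r * v x).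
  apply: measurable_funM => //.
  exact: (@measurableT_comp _ _ _ _ _ _ (@powR R ^~ r)).
have ifv : mu.-integrable setT (EFin \o (fun x => f x `^ r * v x)).
  apply: (@le_integrable _ _ _ mu setT measurableT _ (EFin \o (fun x => C * v x))) => //.
  - exact/measurable_EFinP.
  - move=> x _ /=; rewrite lee_fin !normrM ler_wpM2r// !ger0_norm ?powR_ge0//.
    exact: le_trans (powR_ge0 _ _) (fC x).
  - by have := integrableZl measurableT C iv.
have -> : (\int[mu]_x (f x `^ r * v x)%:E)%E = (\int[mu]_x (f x `^ r * v x))%:E.
  by rewrite fineK//; exact: integrable_fin_num.
rewrite lee_fin; apply: le_trans SKr.
rewrite (set_additive_part (Rintegral_set_additive ifv) mw measurableT).
apply: ler_sum => ib _; rewrite setTI le_eqVlt; apply/orP; left; apply/eqP.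
rewrite -(RintegralZl (t ib) (mw ib) (integrableT_sub (mw ib) iv)).
apply: eq_Rintegral => x; rewrite inE /= => <-.
by rewrite /t /= cu ger0_norm.
Qed.

(** Converse of [hoelder_weight]. For finite p, (|h| v^-s)^p = (|h| / v)^p v, and |h| / v is an
    increasing limit of simple functions. For p = +oo, the bound on the sets where h or -h exceeds K
    v shows that they are null. *)
Lemma density_Lnorm :
  (Lnorm mu p (EFin \o (fun x => (h x * (v x `^ cexp p)^-1)%R)) <= K%:E)%E.
Proof.
move: p1 simple_bound bL; rewrite unlock; case: p => [r|_ _|//].
  rewrite lee_fin => r1 /(_ r) sb _; rewrite /cexp /=.
  have r0 : 0 < r by rewrite (lt_le_trans _ r1).
  pose w x := `|h x| * v x `^ (-1).
  have wv x : w x * v x = `|h x|.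
    by rewrite /w powR_inv1 ?(ltW (v0 x))// divfK// gt_eqF.
  have mw : measurable_fun setT (EFin \o w).
    apply/measurable_EFinP; apply: measurable_funM; first exact: measurableT_comp.
    exact: (@measurableT_comp _ _ _ _ _ _ (@powR R ^~ (-1))).
  have w0 x : (0 <= (EFin \o w) x)%E by rewrite lee_fin mulr_ge0 ?powR_ge0.
  pose f := nnsfun_approx measurableT mw.
  have fw x : EFin \o f^~ x @ \oo --> (w x)%:E by exact: cvg_nnsfun_approx.
  have fnd x : {homo f ^~ x : a b / (a <= b)%N >-> a <= b}.
    by move=> a b ab; have /lefP := nd_nnsfun_approx measurableT mw ab; exact.
  have fle n x : f n x <= w x.
    have fwx : f^~ x @ \oo --> w x by exact: fine_cvg (fw x).
    rewrite -(cvg_lim _ fwx)//; apply: nondecreasing_cvgn_le => //.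
    by apply/cvg_ex; exists (w x).
  have bd n : (\int[mu]_x (f n x `^ r * v x)%:E <= (K `^ r)%:E)%E.
    by apply: sb => // x; rewrite -wv ler_wpM2r// ltW.
  have gE x : (`|h x * (v x `^ (1 - r^-1))^-1| `^ r)%R = w x `^ r * v x.
    rewrite normrM normfV (ger0_norm (powR_ge0 _ _)) powRM ?invr_ge0 ?powR_ge0//.
    rewrite /w powRM ?powR_ge0// -mulrA; congr (_ * _).
    rewrite -powRN -!powRrM; transitivity (v x `^ (-1 * r + 1)).
      by congr (_ `^ _); field; rewrite gt_eqF.
    rewrite powRD; first by rewrite powRr1// ltW.
    by rewrite (gt_eqF (v0 x)) implybT.
  have H : (\int[mu]_x (w x `^ r * v x)%:E <= (K `^ r)%:E)%E.
    have wlim x : (w x `^ r * v x)%:E = limn (fun n => (f n x `^ r * v x)%:E).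
      apply/esym/cvg_lim => //; apply: cvg_EFin; first exact: nearW.
      (* Continuity of the power is used at positive points; where [w] vanishes, so do the
         approximations. *)
      have [wx0|wx0] := eqVneq (w x) 0.
        have f0 n : f n x = 0 by apply/eqP; rewrite eq_le -{1}wx0 fle/=.
        by under eq_fun do rewrite f0; rewrite wx0; exact: cvg_cst.
      apply: cvgM; last exact: cvg_cst.
      apply: (cvg_comp (fun n => f n x) (@powR R ^~ r)); first exact: fine_cvg (fw x).
      suff : {for w x, continuous (@powR R ^~ r)} by [].
      apply/differentiable_continuous/derivable1_diffP/derivable_powR.
      by rewrite in_itv/= andbT lt_neqAle eq_sym wx0 -lee_fin w0.
    under eq_integral do rewrite wlim.
    have fv0 n x : (0 <= (f n x `^ r * v x)%:E)%E.
      by rewrite lee_fin mulr_ge0 ?powR_ge0 ?ltW.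
    have mfv n : measurable_fun setT (fun x => (f n x `^ r * v x)%:E).
      apply/measurable_EFinP; apply: measurable_funM => //.
      exact: (@measurableT_comp _ _ _ _ _ _ (@powR R ^~ r)).
    have fv_nd x : {homo (fun n => (f n x `^ r * v x)%:E) : a b / (a <= b)%N >-> (a <= b)%E}.
      move=> a b ab; rewrite lee_fin ler_wpM2r ?(ltW (v0 x))//.
      by rewrite ge0_ler_powR ?nnegrE ?(ltW r0)//; exact: fnd.
    rewrite monotone_convergence//; apply: lime_le; last by apply: nearW => n; exact: bd.
    apply: ereal_nondecreasing_is_cvgn => a b ab; apply: ge0_le_integral => //.
    by move=> x _; exact: fv_nd.
  under eq_integral do rewrite gE.
  have -> : K = (K `^ r) `^ r^-1 by rewrite -powRrM mulfV ?gt_eqF// powRr1.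
  rewrite -poweR_EFin; apply: gt0_ler_poweR => //.
  - by rewrite invr_ge0 ltW.
  - by rewrite in_itv/= leey andbT integral_ge0// => x _; rewrite lee_fin mulr_ge0 ?powR_ge0 ?ltW.
  - by rewrite in_itv/= leey andbT lee_fin powR_ge0.
rewrite /cexp /= invr0 subr0 => bL'; case: ifPn => // _; apply/ess_supP.
have powv x : v x `^ 1 = v x by rewrite powRr1// ltW.
have LK A : measurable A -> `|L A| <= K * m A.
  move=> mA; have mb := msr_part_bool mA.
  have := bL' _ _ (fun b : bool => b%:R) mb (fun b => ler0n _ b); rewrite !big_bool/=.
  have mA0 : 0 <= m A by apply: Rintegral_ge0 => x _; exact: ltW.
  have -> : (fun x => `[< A x >]) @^-1` [set true] = A.
    by apply/seteqP; split=> x /=; move/asboolP.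
  by rewrite !mulr0n !mulr1n !mul1r !mul0r !addr0 !powRr1 ?ler01// mul1r mul0r addr0.
pose A (sg : bool) := [set x | K * v x < (-1) ^+ sg * h x].
have mA sg : measurable (A sg).
  have m1 : measurable_fun setT (fun x => K * v x) by exact: measurable_funM.
  have m2 : measurable_fun setT (fun x => (-1) ^+ sg * h x) by exact: measurable_funM.
  have := measurable_fun_ltr m1 m2 measurableT (Y := [set true]) I.
  by rewrite setTI.
have nullA sg : mu (A sg) = 0%E.
  have i1 : mu.-integrable setT (EFin \o (fun x => (-1) ^+ sg * h x)).
    by have := integrableZl measurableT ((-1) ^+ sg) ih.
  have i2 : mu.-integrable setT (EFin \o (fun x => K * v x)).
    by have := integrableZl measurableT K iv.
  have i3 : mu.-integrable setT (EFin \o (fun x => (-1) ^+ sg * h x - K * v x)).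
    by have := integrableB measurableT i1 i2.
  apply: (Rintegral_le0_null i3 (mA sg)) => [x|]; first by rewrite subr_gt0.
  have S1 := integrableT_sub (mA sg) i1; have S2 := integrableT_sub (mA sg) i2.
  rewrite (RintegralB (mA sg) S1 S2) subr_le0.
  rewrite (RintegralZl _ (mA sg) (integrableT_sub (mA sg) ih)).
  rewrite (RintegralZl _ (mA sg) (integrableT_sub (mA sg) iv)).
  apply: le_trans (LK _ (mA sg)); apply: le_trans (ler_norm _) _.
  by rewrite normrM normrX normrN1 expr1n mul1r.
exists (A false `|` A true); split.
- exact: measurableU.
- by rewrite measureU0 ?nullA//; exact: mA.
- move=> x /= nKx; rewrite /A /= expr0 expr1 mul1r mulN1r.
  apply/orP; move/negP: nKx; rewrite lee_fin powv normrM normfV (gtr0_norm (v0 x)).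
  by rewrite ler_pdivrMr// -ltNge ltr_normr.
Qed.

End DensityNorm.

Section LspaceElements.
Context (R : realType) (d : measure_display) (X : measurableType d).
Variables (mu : {measure set X -> \bar R}) (p : \bar R) (p1 : (1 <= p)%E).

Lemma ae_eq_Lnorm (f g : X -> R) : measurable_fun setT f -> measurable_fun setT g ->
  {ae mu, forall x, f x = g x} ->
  Lnorm mu p (EFin \o f) = Lnorm mu p (EFin \o g).
Proof.
move=> mf mg fg; rewrite unlock; move: p1; case: p => [r r1|_|//].
  have mpow (k : X -> R) : measurable_fun setT k ->
      measurable_fun setT (fun x => (`|(EFin \o k) x| `^ r)%E).
    move=> mk; apply: (@measurableT_comp _ _ _ _ _ _ (@poweR R ^~ r)).
      exact: measurable_poweR.
    by apply: measurableT_comp => //; exact/measurable_EFinP.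
  congr (_ `^ _)%E; apply: ae_eq_integral => //; [exact: mpow|exact: mpow|].
  by apply: filterS fg => x fgx _; rewrite /= fgx.
case: ifPn => // _; apply: eq_ess_sup.
by apply: filterS fg => x fgx; rewrite /= fgx.
Qed.

Lemma LnormZ_fun (a : R) (f : X -> R) : measurable_fun setT f ->
  (Lnorm mu p (EFin \o f) < +oo)%E ->
  Lnorm mu p (EFin \o (fun x => (a * f x)%R)) = (`|a|%:E * Lnorm mu p (EFin \o f))%E.
Proof.
move=> mf ff; have fL : f \in Lfun mu p by apply/andP; split; rewrite inE.
by have := LnormZ (Lfun_Sub p1 fL) a.
Qed.

Implicit Types f g : LspaceType mu p1.

Lemma Lspace_measurable f : measurable_fun setT (f : X -> R).
Proof. exact: (measurable_funP (repr (f : {mfun_ mu, X >-> measurableTypeR R}))). Qed.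

Lemma Lp_norm_lty f : (Lp_norm f < +oo)%E.
Proof. exact: Lebesgue_finite. Qed.

Lemma Lspace_ae_eq f g : {ae mu, forall x, f x = g x :> R} -> f = g.
Proof.
move=> fg; have E : (f : {mfun_ mu, X >-> measurableTypeR R}) = g.
  by rewrite -[LHS]reprK -[RHS]reprK; apply/eqP/ae_eqP; apply: filterS fg.
case: f g fg E => f cf [g cg] _ /= E; subst g.
congr LebesgueSpace.Pack.
case: cf => -[a]; case: cg => -[b].
by congr LebesgueSpace.Class; congr isFinLebesgue.Axioms_; exact: Prop_irrelevance.
Qed.

Lemma Lspace_of_fun (h : X -> R) : measurable_fun setT h ->
  (Lnorm mu p (EFin \o h) < +oo)%E ->
  exists f, {ae mu, forall x, f x = h x :> R}.
Proof.
move=> mh hoo.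
pose hm : {mfun X >-> measurableTypeR R} := HB.pack h (@isMeasurableFun.Build _ _ X (measurableTypeR R) h mh).
pose q : {mfun_ mu, X >-> measurableTypeR R} := \pi_({mfun_ mu, X >-> measurableTypeR R})%qT hm.
have qh : {ae mu, forall x, q x = h x :> R}.
  have : (repr q = hm %[mod {mfun_ mu, X >-> measurableTypeR R}])%qT by rewrite reprK.
  by move=> /eqquotP /asboolP; apply: filterS => x /(_ I).
have qf : finite_norm mu p (q : X -> R).
  by rewrite /finite_norm (@ae_eq_Lnorm _ h)//; exact: (measurable_funP (repr q)).
pose f : LspaceType mu p1 := HB.pack q (@isFinLebesgue.Build _ X R mu p p1 q qf).
by exists f.
Qed.

End LspaceElements.

Lemma msr_part_measurable_fun (R : realType) (d : measure_display)
    (X : measurableType d) (I : finType) (u : X -> I) (t : I -> R) :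
  msr_part u -> measurable_fun setT (fun x => t (u x)).
Proof.
move=> mu _ B mB; rewrite setTI.
have -> : (fun x => t (u x)) @^-1` B =
    \bigcup_(i in [set i | B (t i)]) (u @^-1` [set i]).
  apply/seteqP; split=> x => [Bx|[i Bi ui]]; first by exists (u x).
  by rewrite /preimage /= (ui : u x = i).
by apply: fin_bigcup_measurable => // i _; exact: mu.
Qed.

(** * Extension of operators into L_p(mu) *)

Section LpExtension.
Context (R : realType) (p : \bar R) (p1 : (1 <= p)%E) (F E : normedModType R).
Context (iota : {linear F -> E}) (C : R) (C0 : 0 < C).
Hypothesis ext : forall n (T : {linear F -> 'rV[R]_n}) (K : R), 0 <= K ->
  (forall z, (lp_norm p (T z) <= (K * `|z|)%:E)%E) ->
  exists T' : {linear E -> 'rV[R]_n}, (forall z, T' (iota z) = T z) /\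
    forall e, (lp_norm p (T' e) <= (C * K * `|e|)%:E)%E.
Context (d : measure_display) (X : measurableType d).
Variables (mu : {sigma_finite_measure set X -> \bar R}).
Variables (T : F -> LspaceType mu p1) (K : R).
Hypothesis (T_lin : forall (a : R) (x y : F),
  {ae mu, forall t : X, T (a *: x + y) t = a * T x t + T y t :> R}).
Hypothesis (K0 : 0 <= K) (TK : forall x, (Lp_norm (T x) <= (K * `|x|)%:E)%E).
Local Notation s := (cexp p).

Lemma Lp_extension : exists T' : E -> LspaceType mu p1,
  [/\ forall (a : R) (x y : E),
        {ae mu, forall t : X, T' (a *: x + y) t = a * T' x t + T' y t :> R},
      forall z, T' (iota z) = T z &
      forall x, (Lp_norm (T' x) <= (C * K * `|x|)%:E)%E].
Proof.
have [v [v0 mv iv]] := sigma_finite_weight mu.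
have CK0 : 0 <= C * K by rewrite mulr_ge0// ltW.
pose m A := \int[mu]_(x in A) v x.
have am : set_additive m := Rintegral_set_additive iv.
have m0 A : measurable A -> 0 <= m A by move=> _; apply: Rintegral_ge0 => x _; exact: ltW.
have mu_m A : measurable A -> m A = 0 -> mu A = 0%E.
  by move=> mA mA0; apply: (Rintegral_le0_null iv mA) => [x _ //|]; rewrite -/(m A) mA0.
have m_mu A : measurable A -> mu A = 0%E -> m A = 0.
  move=> mA muA0; rewrite /m /Rintegral null_set_integral//.
  by apply: measurable_funTS; exact/measurable_EFinP.
have mT z : measurable_fun setT (T z : X -> R) by exact: Lspace_measurable.
have KN (z : F) : 0 <= K * `|z| by rewrite mulr_ge0.
have holder z (w : X -> R) : measurable_fun setT w -> (forall x, 0 <= w x) ->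
    mu.-integrable setT (EFin \o w) ->
    mu.-integrable setT (EFin \o (fun x => T z x * w x `^ s)) /\
    (\int[mu]_x `|T z x * w x `^ s| <= K * `|z| * (\int[mu]_x w x) `^ s).
  move=> mw w0 iw.
  have H := hoelder_weight p1 (mT z) mw w0 iw (KN z) (TK z).
  have mTw : measurable_fun setT (fun x => T z x * w x `^ s).
    apply: measurable_funM => //.
    exact: (@measurableT_comp _ _ _ _ _ _ (@powR R ^~ s)).
  have iTw : mu.-integrable setT (EFin \o (fun x => T z x * w x `^ s)).
    apply/integrableP; split; first exact/measurable_EFinP.
    exact: le_lt_trans H (ltry _).
  split=> //; rewrite -lee_fin; apply: le_trans H; rewrite fineK//.
  by apply: integrable_fin_num => //; exact: integrable_abse iTw.
(* Integrable for every p by Hoelder, although [T z] itself may not be. *)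
pose f z x := T z x * v x `^ s.
have if_ z : mu.-integrable setT (EFin \o f z) by have [] := holder z v mv (fun x => ltW (v0 x)) iv.
pose lam z A := \int[mu]_(x in A) f z x.
have lam_lin a x y A : measurable A -> lam (a *: x + y) A = a * lam x A + lam y A.
  move=> mA; have ix := integrableT_sub mA (if_ x); have iy := integrableT_sub mA (if_ y).
  rewrite /lam -(RintegralZl a mA ix).
  have iax : mu.-integrable A (EFin \o (fun t => a * f x t)) by have := integrableZl mA a ix.
  rewrite -(RintegralD mA iax iy) /Rintegral; congr fine.
  apply: ae_eq_integral => //.
  - by case/integrableP : (integrableT_sub mA (if_ (a *: x + y))).
  - by case/integrableP : (integrableD mA iax iy).
  - apply: filterS (T_lin a x y) => t Tt _.
    by rewrite /f Tt mulrDl mulrA.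
have lam_add x : set_additive (lam x) by exact: Rintegral_set_additive.
have lam_null x : null_for m (lam x).
  move=> A mA /(mu_m A mA) muA0; rewrite /lam /Rintegral null_set_integral//.
  by case/integrableP : (integrableT_sub mA (if_ x)).
have lam_bound x : dual_bounded_by s m (K * `|x|) (lam x).
  move=> I u t mu_ t0.
  have mtu := msr_part_measurable_fun t mu_.
  pose w y := t (u y) * v y.
  have mw : measurable_fun setT w by exact: measurable_funM.
  have w0 y : 0 <= w y by rewrite mulr_ge0// ltW.
  have iw : mu.-integrable setT (EFin \o w).
    apply: (@le_integrable _ _ _ mu setT measurableT _ (EFin \o (fun y => (\sum_i t i) * v y))).
    - exact/measurable_EFinP.
    - move=> y _ /=; rewrite lee_fin !normrM ler_wpM2r// !ger0_norm ?sumr_ge0//.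
      by rewrite (bigD1 (u y))//= lerDl sumr_ge0.
    - by have := integrableZl measurableT (\sum_i t i) iv.
  have [iTw Tw] := holder x w mw w0 iw.
  have wE : \int[mu]_y w y = \sum_i t i * m (u @^-1` [set i]).
    rewrite (set_additive_part (Rintegral_set_additive iw) mu_ measurableT).
    apply: eq_bigr => i _; rewrite setTI.
    rewrite /m -(RintegralZl (t i) (mu_ i) (integrableT_sub (mu_ i) iv)).
    by apply: eq_Rintegral => y; rewrite inE /= /w => <-.
  rewrite -wE; apply: le_trans Tw.
  have iaTw : mu.-integrable setT (EFin \o (fun y => `|T x y * w y `^ s|)).
    exact: integrable_abse iTw.
  rewrite (set_additive_part (Rintegral_set_additive iaTw) mu_ measurableT).
  apply: ler_sum => i _; rewrite setTI.
  have ifi := integrableT_sub (mu_ i) (if_ x).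
  have iafi : mu.-integrable (u @^-1` [set i]) (EFin \o (fun y => `|f x y|)).
    exact: integrable_abse ifi.
  apply: (@le_trans _ _ (t i `^ s * \int[mu]_(y in u @^-1` [set i]) `|f x y|)).
    by rewrite ler_wpM2l ?powR_ge0// le_normr_Rintegral//; exact: mu_.
  rewrite -(RintegralZl _ (mu_ i) iafi) le_eqVlt; apply/orP; left; apply/eqP.
  apply: eq_Rintegral => y; rewrite inE /= /w /f => <-.
  rewrite powRM ?(ltW (v0 y))// mulrCA !normrM.
  by rewrite [X in _ = X * _](ger0_norm (powR_ge0 _ _)).
have [Lam [Lam_lin Lam_add Lam_iota Lam_null Lam_bound]] :=
  finitely_additive_extension p1 am m0 K0 lam_lin lam_add lam_null lam_bound
    (fun n T => @ext n T K K0).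
pose L x := ca_part (Lam x).
have KE (x : E) : 0 <= C * K * `|x| by rewrite mulr_ge0.
have L_lin a x y A : measurable A -> L (a *: x + y) A = a * L x A + L y A.
  by move=> mA; apply: (ca_part_lin am (Lam_bound x) (Lam_bound y)) => // B mB; exact: Lam_lin.
have L_add x : set_additive (L x) := ca_part_additive am (Lam_add x) (Lam_bound x).
have L_bound x : dual_bounded_by s m (C * K * `|x|) (L x) := ca_part_bounded am (Lam_bound x).
have L_null x : null_for m (L x) := ca_part_null am (Lam_bound x) m0 (Lam_null x).
(* The set functions coming from F are integrals, so their tails vanish and taking the countably
   additive part changes nothing. *)
have L_iota z A : measurable A -> L (iota z) A = lam z A.
  move=> mA; rewrite -Lam_iota//; apply: (ca_part_id am (Lam_add _) (Lam_bound _) mA).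
  move=> P e mP e0; have [M0 HM] := Rintegral_tail (if_ z) mP mA e0.
  exists M0 => M MM; rewrite Lam_iota; first exact: HM.
  by apply: measurableI => //; exact: msr_part_setge.
have dens x : exists h : X -> R, mu.-integrable setT (EFin \o h) /\
    forall A, measurable A -> L x A = \int[mu]_(t in A) h t.
  apply: set_function_density => //.
    exact: (ca_part_continuous am (Lam_bound x)).
  by move=> A mA muA0; apply: L_null => //; exact: m_mu.
have [h hP] := choice dens.
have ih x : mu.-integrable setT (EFin \o h x) by have [] := hP x.
have hL x A : measurable A -> L x A = \int[mu]_(t in A) h x t by have [_] := hP x; exact.
pose g x t := h x t * (v t `^ s)^-1.
have gK x : (Lnorm mu p (EFin \o g x) <= (C * K * `|x|)%:E)%E.
  apply: (density_Lnorm p1 (KE x) v0 mv iv (ih x)) => I u t mu_ t0.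
  apply: le_trans (L_bound x I u t mu_ t0); apply: ler_sum => i _.
  by rewrite hL//; exact: mu_.
have mh x : measurable_fun setT (h x) by apply/measurable_EFinP; case/integrableP : (ih x).
have mg x : measurable_fun setT (g x).
  apply: measurable_funM => //.
  rewrite (_ : (fun t => _) = (fun t => v t `^ (- s))); last first.
    by apply/funext => t; rewrite powRN.
  exact: (@measurableT_comp _ _ _ _ _ _ (@powR R ^~ (- s))).
have goo x : (Lnorm mu p (EFin \o g x) < +oo)%E := le_lt_trans (gK x) (ltry _).
have [T' T'P] := choice (fun x => Lspace_of_fun p1 (mg x) (goo x)).
(* Densities are determined almost everywhere by their integrals; linearity and the extension
   property thus pass from [L] to the chosen [h]. *)
have h_ae (h1 h2 : X -> R) : mu.-integrable setT (EFin \o h1) ->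
    mu.-integrable setT (EFin \o h2) ->
    (forall A, measurable A -> \int[mu]_(t in A) h1 t = \int[mu]_(t in A) h2 t) ->
    {ae mu, forall t, h1 t = h2 t}.
  move=> i1 i2 h12; have m2 : measurable_fun setT (EFin \o h2) by case/integrableP : i2.
  have H A : A `<=` setT -> measurable A ->
      (\int[mu]_(t in A) (h1 t)%:E = \int[mu]_(t in A) (h2 t)%:E)%E.
    move=> _ mA.
    have e1 := integrable_fin_num mA (integrableT_sub mA i1).
    have e2 := integrable_fin_num mA (integrableT_sub mA i2).
    by rewrite -(fineK e1) -(fineK e2); congr EFin; exact: h12.
  have [N [mN N0 NP]] := integral_ae_eq measurableT i1 m2 H.
  exists N; split=> // t /= ht; apply: NP => /= hI; apply: ht.
  by have [] := hI I.
exists T'; split.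
- move=> a x y.
  have hlin : {ae mu, forall t, h (a *: x + y) t = a * h x t + h y t}.
    have iah : mu.-integrable setT (EFin \o (fun t => a * h x t)).
      by have := integrableZl measurableT a (ih x).
    apply: (h_ae _ (fun t => a * h x t + h y t)) => //.
      by have := integrableD measurableT iah (ih y).
    move=> A mA; have S1 := integrableT_sub mA iah; have S2 := integrableT_sub mA (ih y).
    rewrite (RintegralD mA S1 S2) (RintegralZl a mA (integrableT_sub mA (ih x))).
    by rewrite -!hL// L_lin.
  apply: filterS3 (T'P (a *: x + y)) (T'P x) (filterI (T'P y) hlin).
  by move=> t -> -> [-> hl]; rewrite /g hl mulrDl mulrA.
- move=> z; apply: Lspace_ae_eq.
  have hz : {ae mu, forall t, h (iota z) t = f z t}.
    by apply: h_ae => // A mA; rewrite -hL// L_iota.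
  apply: filterS2 (T'P (iota z)) hz => t -> hz; rewrite /g hz /f mulfK// gt_eqF//.
  exact: powR_gt0.
- move=> x; rewrite /Lp_norm (@ae_eq_Lnorm _ _ _ _ _ p1 _ (g x))//.
  exact: Lspace_measurable.
Qed.

End LpExtension.

(** * The three implications *)

Section Counting.
Context (R : realType) (p : \bar R) (p1 : (1 <= p)%E).
Local Notation mu := (@counting nat R).

(** The empty set is the only null set of the counting measure. *)
Lemma counting_aeP (P : nat -> Prop) : {ae mu, forall k, P k} -> forall k, P k.
Proof.
move=> [N [_ N0 NP]] k; apply: contrapT => nP.
have Nk : N k by exact: NP.
move: N0; rewrite /counting; case: asboolP => // fN [] /eqP.
rewrite pnatr_eq0 finmap.cardfs_eq0 => /eqP /fset_set_set0 => /(_ fN) N_0.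
by move: Nk; rewrite N_0.
Qed.

Lemma counting_Lnorm_pinfty (f : nat -> \bar R) :
  Lnorm mu +oo f = ess_sup mu (abse \o f).
Proof.
have pos : (0 < mu [set: nat])%E.
  by rewrite /counting asboolF//; exact: cardinality.infinite_nat.
by rewrite unlock pos.
Qed.

Lemma counting_Lnorm_ge n (h : nat -> R) :
  (lp_norm p (\row_(k < n) h k) <= Lnorm mu p (EFin \o h))%E.
Proof.
move: p1; case: p => [r|_|//].
  rewrite lee_fin => r1; have r0 : 0 < r by rewrite (lt_le_trans _ r1).
  rewrite Lnorm_counting// /lp_norm -poweR_EFin.
  have S0 : (0 <= \sum_(k <oo) (`|(EFin \o h) k| `^ r))%E.
    by apply: nneseries_ge0 => k _ _; exact: poweR_ge0.
  apply: gt0_ler_poweR; rewrite ?invr_ge0 ?(ltW r0)// ?in_itv/= ?leey ?andbT//.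
    by rewrite lee_fin sumr_ge0// => k _; exact: powR_ge0.
  apply: le_trans (nneseries_lim_ge n _) => [|k _ /=]; last by rewrite lee_fin powR_ge0.
  by rewrite big_mkord -sumEFin; apply: lee_sum => k _; rewrite mxE.
rewrite counting_Lnorm_pinfty.
have H := counting_aeP (ess_sup_ge mu (abse \o (EFin \o h))).
set M := ess_sup _ _ in H *; rewrite /lp_norm.
have M0 : (0 <= M)%E := le_trans (abse_ge0 _) (H 0%N).
by elim/big_ind : _ => // [x y xM yM|k _];
  [rewrite EFin_max ge_max xM|rewrite mxE; exact: H].
Qed.

Lemma counting_Lnorm_le n (h : nat -> R) : (forall k, (n <= k)%N -> h k = 0) ->
  (Lnorm mu p (EFin \o h) <= lp_norm p (\row_(k < n) h k))%E.
Proof.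
move=> h0; move: p1; case: p => [r|_|//].
  rewrite lee_fin => r1; have r0 : 0 < r by rewrite (lt_le_trans _ r1).
  rewrite Lnorm_counting// /lp_norm -poweR_EFin.
  rewrite (nneseries_split 0 n); last by move=> k _; exact: poweR_ge0.
  rewrite add0n eseries0 ?adde0; last first.
    by move=> k nk _ /=; rewrite h0// normr0 powR0// gt_eqF.
  rewrite big_mkord -sumEFin le_eqVlt; apply/orP; left; apply/eqP.
  by congr (_ `^ _)%E; apply: eq_bigr => k _; rewrite mxE.
rewrite counting_Lnorm_pinfty /lp_norm.
apply/ess_supP; apply: aeW => k /=; rewrite lee_fin.
have [nk|kn] := leqP n k.
  by rewrite h0// normr0; elim/big_ind : _ => // x y x0 y0; rewrite le_max x0.
have := le_bigmax 0 (fun i : 'I_n => `|(\row_(k < n) h k) 0 i|) (Ordinal kn).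
by rewrite mxE.
Qed.

End Counting.

Section Implications.
Context (R : realType) (p : \bar R) (p1 : (1 <= p)%E).
Context (F E : normedModType R) (iota : {linear F -> E}).
Context (iota_isometry : forall x, `|iota x| = `|x|).

Lemma opnorm_lp_bound n (V : normedModType R) (T : {linear V -> 'rV[R]_n}) (K : R) :
  (opnorm (@lp_norm R p n) T <= K%:E)%E ->
  forall x, (lp_norm p (T x) <= (K * `|x|)%:E)%E.
Proof.
by apply: opnorm_bound => a x a0; rewrite linearZ lp_normZ// ger0_norm.
Qed.

Lemma counting_operator_extension (C : R) (C0 : 0 < C) :
  (forall T : F -> LspaceType (@counting nat R) p1,
     bounded_Lp_operator T ->
     exists T' : E -> LspaceType (@counting nat R) p1,
       [/\ bounded_Lp_operator T', forall x : F, T' (iota x) = T x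
         & (opnorm (@Lp_norm R _ _ (@counting nat R) p p1) T'
            <= C%:E * opnorm (@Lp_norm R _ _ (@counting nat R) p p1) T)%E]) ->
  forall n (T : {linear F -> 'rV[R]_n}), (opnorm (@lp_norm R p n) T < +oo)%E ->
  exists T' : {linear E -> 'rV[R]_n},
    [/\ (opnorm (@lp_norm R p n) T' < +oo)%E, forall x : F, T' (iota x) = T x
      & (opnorm (@lp_norm R p n) T' <= C%:E * opnorm (@lp_norm R p n) T)%E].
Proof.
move=> ext n T Too.
pose h z k := if insub k is Some i then T z 0 (i : 'I_n) else 0.
have hi z (i : 'I_n) : h z i = T z 0 i by rewrite /h valK.
have h0 z k : (n <= k)%N -> h z k = 0.
  by move=> nk; rewrite /h insubN// -leqNgt.
have hT z : \row_(k < n) h z k = T z by apply/rowP => k; rewrite mxE hi.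
have hN z : (Lnorm (@counting nat R) p (EFin \o h z) <= lp_norm p (T z))%E.
  by rewrite -[in leRHS]hT; exact: counting_Lnorm_le (h0 z).
have /choice[S Sh] z : exists f : LspaceType (@counting nat R) p1, forall k, f k = h z k :> R.
  have [||f fh] := @Lspace_of_fun _ _ _ (@counting nat R) p p1 (h z).
  - by [].
  - apply: le_lt_trans (hN z) _; rewrite ltey_eq lp_norm_fin//.
  - by exists f; exact: counting_aeP fh.
have SN z : (Lp_norm (S z) <= lp_norm p (T z))%E.
  rewrite /Lp_norm; have -> : (S z : nat -> R) = h z by apply/funext => k; exact: Sh.
  exact: hN.
have ST : (opnorm (@Lp_norm R _ _ (@counting nat R) p p1) S <= opnorm (@lp_norm R p n) T)%E.
  apply: ge_ereal_sup => _ [x x1 <-]; apply: le_trans (SN x) _.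
  by apply: ereal_sup_ubound; exists x.
have Slin (a : R) (x y : F) k : S (a *: x + y) k = a * S x k + S y k :> R.
  have [kn|nk] := ltnP k n; last by rewrite !Sh !h0// mulr0 addr0.
  by rewrite !Sh -[k]/(val (Ordinal kn)) !hi linearP !mxE.
have [|S' [[S'lin S'oo] S'iota S'C]] := ext S.
  split; first by move=> a x y; apply: aeW => k; exact: Slin.
  exact: le_lt_trans ST Too.
pose T0 e : 'rV[R]_n := \row_k S' e k.
have T0lin : linear T0.
  move=> a x y; apply/rowP => k; rewrite !mxE.
  exact: (counting_aeP (S'lin a x y)).
pose T' : {linear E -> 'rV[R]_n} := HB.pack T0 (GRing.isLinear.Build R E 'rV[R]_n *:%R T0 T0lin).
have T'S' : (opnorm (@lp_norm R p n) T' <= opnorm (@Lp_norm R _ _ (@counting nat R) p p1) S')%E.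
  apply: ge_ereal_sup => _ [x x1 <-].
  apply: le_trans (counting_Lnorm_ge p1 n (S' x : nat -> R)) _.
  by apply: ereal_sup_ubound; exists x.
exists T'; split.
- exact: le_lt_trans T'S' S'oo.
- by move=> x; apply/rowP => k; rewrite mxE S'iota Sh hi.
- apply: le_trans T'S' _; apply: le_trans S'C _.
  by rewrite lee_wpmul2l// lee_fin ltW.
Qed.

Lemma fbl_norm_pullback_ge (C : R) (f : dual F -> R^o) : 0 < C -> FBL p f ->
  (forall (n : nat) (eps : R), 0 < eps -> forall T : {linear F -> 'rV[R]_n},
     (opnorm (@lp_norm R p n) T < +oo)%E ->
     exists T' : {linear E -> 'rV[R]_n},
       [/\ (opnorm (@lp_norm R p n) T' < +oo)%E, forall x : F, T' (iota x) = T x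
         & (opnorm (@lp_norm R p n) T'
            <= (C * (1 + eps))%:E * opnorm (@lp_norm R p n) T)%E]) ->
  ((C^-1)%:E * fbl_norm p f <= fbl_norm p (f \o pullback iota_isometry))%E.
Proof.
move=> C0 [hf foo _] ext; set N := fbl_norm p (_ \o _).
have N0 : (0 <= N)%E by exact: fbl_norm_ge0.
have Noo : (N < +oo)%E by exact: le_lt_trans (pullback_norm _ _ _) foo.
have key eps : 0 < eps -> (fbl_norm p f <= (C * (1 + eps))%:E * N)%E.
  move=> e0; have K0 : 0 < C * (1 + eps) by rewrite mulr_gt0// addr_gt0.
  apply: fbl_norm_le => // n xs xs1.
  pose T0 z : 'rV[R]_n := \row_k (xs k z : R).
  have T0lin : linear T0 by move=> a x y; apply/rowP => k; rewrite !mxE linearP.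
  pose T : {linear F -> 'rV[R]_n} := HB.pack T0 (GRing.isLinear.Build R F 'rV[R]_n *:%R T0 T0lin).
  have T1 : (opnorm (@lp_norm R p n) T <= 1%:E)%E by apply: opnorm_le.
  have [T' [_ T'iota T'C]] := ext n eps e0 T (le_lt_trans T1 (ltry _)).
  have {}T'C : (opnorm (@lp_norm R p n) T' <= (C * (1 + eps))%:E)%E.
    by apply: le_trans T'C _; rewrite -[leRHS]mule1 lee_wpmul2l// lee_fin ltW.
  have [ys [ysT ysC]] := coord_linear p1 (opnorm_lp_bound T'C).
  (* Extending the operator amounts to lifting the tuple [xs] through the pullback with control of
     its weak norm. *)
  have pbys k : pullback iota_isometry (ys k) = xs k.
    by apply/val_inj/funext => z /=; rewrite ysT T'iota mxE.
  have -> : \row_k (f (xs k) : R) = \row_k ((f \o pullback iota_isometry) (ys k) : R).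
    by apply/rowP => k; rewrite !mxE /= pbys.
  apply: fbl_norm_geZ => // a y a0 /=; rewrite -hf//; congr f; exact: val_inj.
move: key; rewrite -(fineK (x := N)) ?ge0_fin_numE//.
have -> : fbl_norm p f = (fine (fbl_norm p f))%:E.
  by rewrite fineK// ge0_fin_numE// fbl_norm_ge0.
move=> key; rewrite -EFinM lee_fin ler_pdivrMl//.
apply/ler_addgt0Pr => e e0.
(* As [N] is finite, this [eps] keeps the excess [C * eps * N] below [e]. *)
have := key (e / (C * (fine N + 1))) _.
have M0 : 0 < C * (fine N + 1) by rewrite mulr_gt0// ltr_wpDl// fine_ge0.
move=> /(_ (divr_gt0 e0 M0)); rewrite -EFinM lee_fin => /le_trans; apply.
have -> : C * (1 + e / (C * (fine N + 1))) * fine N = C * fine N + e * (fine N / (fine N + 1)).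
  by field; rewrite !gt_eqF// ltr_wpDl// fine_ge0.
rewrite lerD2l ler_piMr ?(ltW e0)// ler_pdivrMr ?mul1r ?lerDl ?ler01//.
by rewrite ltr_wpDl// fine_ge0.
Qed.

Lemma fbl_embedding_Lp_extension (C : R) (d : measure_display) (X : measurableType d)
    (mu : {sigma_finite_measure set X -> \bar R}) (T : F -> LspaceType mu p1) :
  0 < C ->
  (forall f, @delta_lattice R F f ->
    ((C^-1)%:E * fbl_norm p f <= fbl_norm p (f \o pullback iota_isometry))%E) ->
  bounded_Lp_operator T ->
  exists T' : E -> LspaceType mu p1,
    [/\ bounded_Lp_operator T', forall x : F, T' (iota x) = T x
      & (opnorm (@Lp_norm R d X mu p p1) T'
         <= C%:E * opnorm (@Lp_norm R d X mu p p1) T)%E].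
Proof.
move=> C0 embC [Tlin Too]; set N := opnorm (@Lp_norm R d X mu p p1) T in Too *.
have N0 : (0 <= N)%E.
  apply: le_trans (Lnorm_ge0 mu p (EFin \o (T 0 : X -> R))) _.
  by apply: ereal_sup_ubound; exists 0 => //=; rewrite normr0.
have Nfin : N = (fine N)%:E by rewrite fineK// ge0_fin_numE.
(* Almost-everywhere linearity gives this, and with it the homogeneity that [opnorm_bound] asks
   for. *)
have T0 : {ae mu, forall t, T 0 t = 0 :> R}.
  apply: filterS (Tlin 1 0 0) => t; rewrite scaler0 addr0 mul1r => /eqP.
  by rewrite -subr_eq subrr eq_sym => /eqP.
have TZ a x : 0 <= a -> Lp_norm (T (a *: x)) = (a%:E * Lp_norm (T x))%E.
  move=> a0; rewrite -{2}(ger0_norm a0) /Lp_norm -LnormZ_fun//; last 2 first.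
  - exact: Lspace_measurable.
  - exact: Lp_norm_lty.
  apply: ae_eq_Lnorm => //.
  - exact: Lspace_measurable.
  - by apply: measurable_funM => //; exact: Lspace_measurable.
  have := Tlin a x 0; rewrite addr0 => Ta.
  by apply: filterS2 Ta T0 => t -> ->; rewrite addr0.
have [|T' [T'lin T'iota T'C]] := Lp_extension C0
    (fbl_embedding_extension p1 C0 embC) Tlin (K := fine N) (fine_ge0 N0).
  by apply: opnorm_bound => //; rewrite -Nfin.
have T'N : (opnorm (@Lp_norm R d X mu p p1) T' <= (C * fine N)%:E)%E.
  by apply: opnorm_le => //; rewrite mulr_ge0 ?fine_ge0// ltW.
exists T'; split=> //; first by split=> //; exact: le_lt_trans T'N (ltry _).
by rewrite Nfin -EFinM.
Qed.

End Implications.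

Theorem theorem3p7 (R : realType) (p : \bar R) (p1 : (1 <= p)%E)
    (F E : completeNormedModType R)
    (F_neq0 : exists x : F, x != 0) (E_neq0 : exists x : E, x != 0)
    (iota : {linear F -> E}) (iota_isometry : forall x, `|iota x| = `|x|)
    (iotabar : (dual F -> R^o) -> (dual E -> R^o))
    (iotabarP : is_fbl_extension p iota iotabar)
    (C : R) (C_gt0 : 0 < C) :
  [<-> (* 1 *)
       forall f, FBL p f ->
         ((C^-1)%:E * fbl_norm p f <= fbl_norm p (iotabar f))%E ;
       (* 2 *)
       forall (d : measure_display) (X : measurableType d)
              (mu : {sigma_finite_measure set X -> \bar R})
              (T : F -> LspaceType mu p1),
         bounded_Lp_operator T ->
         exists T' : E -> LspaceType mu p1,
           [/\ bounded_Lp_operator T',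
               forall x : F, T' (iota x) = T x
             & (opnorm (@Lp_norm R d X mu p p1) T'
                <= C%:E * opnorm (@Lp_norm R d X mu p p1) T)%E] ;
       (* 3 *)
       forall (n : nat) (eps : R), 0 < eps ->
       forall T : {linear F -> 'rV[R]_n},
         (opnorm (@lp_norm R p n) T < +oo)%E ->
         exists T' : {linear E -> 'rV[R]_n},
           [/\ (opnorm (@lp_norm R p n) T' < +oo)%E,
               forall x : F, T' (iota x) = T x
             & (opnorm (@lp_norm R p n) T'
                <= (C * (1 + eps))%:E * opnorm (@lp_norm R p n) T)%E] ].
Proof.
tfae.
(* (1) is applied on the lattice generated by the [delta x], where [iotabar] is determined
   algebraically. *)
- move=> emb d X mu T; apply: (@fbl_embedding_Lp_extension _ p p1 F E iota iota_isometry C d X mu T)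
    => // f df.
  rewrite -(fbl_extension_delta_lattice p1 iota_isometry iotabarP df).
  exact: (emb f (delta_lattice_FBL p1 df)).
- move=> ext n eps eps0 T Too.
  pose c : {sigma_finite_measure set nat -> \bar R} :=
    HB.pack (@counting nat R)
      (@Measure_isSigmaFinite.Build _ nat R (@counting nat R) (sigma_finite_counting R)).
  have [T' [T'oo T'iota T'C]] :=
    counting_operator_extension C_gt0 (ext _ _ c) Too.
  exists T'; split=> //; apply: le_trans T'C _; rewrite lee_wpmul2r//.
    apply: le_trans (lp_norm_ge0 p (T 0)) _; apply: ereal_sup_ubound.
    by exists 0 => //=; rewrite normr0.
  by rewrite lee_fin ler_peMr// ?lerDl ltW.
(* Here [f] ranges over all of FBL, so the formula for [iotabar] is used beyond the generated
   lattice. *)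
- move=> ext f Ff; rewrite (fbl_extension_unique p1 iota_isometry iotabarP Ff).
  exact: fbl_norm_pullback_ge.
Qed.
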